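(* Suppose that a pair of smooth functions $(\phi,u):\overline{\Omega}\times[0,T]\to\mathbb{R}\times\mathbb{R}^2$ satisfies, in $\Omega\times(0,T)$, $$\frac{\partial\phi}{\partial t}+\nabla\cdot(\phi u)=0,$$ $$\rho\phi\Bigl[\frac{\partial u}{\partial t}+(u\cdot\nabla)u\Bigr]-2\mu\nabla\cdot(\phi D(u))+\rho g\phi\nabla\eta=0,$$ $$\phi=\eta+\zeta,$$ together with the boundary conditions $$u=0\ \text{ on }\Gamma_D\times(0,T),$$ $$(D(u)n)\times n=0,\quad u\cdot n=0\ \text{ on }\Gamma_S\times(0,T),$$ $$u=c\,\frac{\eta}{\phi}\,n\ \text{ on }\Gamma_T\times(0,T),$$ and the inequality $$\phi(x,t)>0,\quad (x,t)\in\overline{\Gamma}_T\times[0,T],$$ and that there exists $\alpha\in(0,1)$ such that $$\eta(x,t)\ge-\alpha\,\zeta(x),\quad x\in\overline{\Gamma}_T,\ t\in[0,T],$$ $$0<c_0\le\sqrt{\frac{2}{\alpha}}\,(1-\alpha).$$ Then $$I_1(t;\Gamma_T)+I_2(t;\Gamma_T)\le0,$$ and, in particular, $$\frac{d}{dt}E(t)\le I_3(t;\Gamma_T).$$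
   Context: Let $\Omega\subset\mathbb{R}^2$ be a bounded domain with boundary $\Gamma=\partial\Omega$ and unit outward normal vector $n$, and let $T$ be a positive constant. The boundary $\Gamma$ consists of three non-overlapped parts $\Gamma_D,\Gamma_S,\Gamma_T$ (Dirichlet, slip and transmission boundaries), i.e., $\overline{\Gamma}=\overline{\Gamma}_D\cup\overline{\Gamma}_S\cup\overline{\Gamma}_T$ and $\Gamma_D\cap\Gamma_S=\Gamma_S\cap\Gamma_T=\Gamma_T\cap\Gamma_D=\varnothing$. Here $\phi$ is the total height of wave, $u=(u_1,u_2)^T$ is the velocity, and $\eta:\overline{\Omega}\times[0,T]\to\mathbb{R}$ is the water level from the reference height. The constants $\rho$ (density), $\mu$ (viscosity), $g$ (gravity) and $c_0$ are positive, $\zeta\in C^1(\overline{\Omega})$ is a given depth function with $\zeta(x)>0$ for $x\in\overline{\Omega}$, and $c(x)=c_0\sqrt{g\zeta(x)}$. The strain-rate tensor is $D(u)=\frac12(\nabla u+(\nabla u)^T)$, and $a\times b=a_1b_2-a_2b_1$ for $a,b\in\mathbb{R}^2$. The total energy at time $t\in[0,T]$ is $$E(t)=\int_\Omega\frac{\rho}{2}\phi|u|^2\,dx+\int_\Omega\frac{\rho g|\eta|^2}{2}\,dx.$$ For $t\in[0,T]$, with all integrands evaluated at time $t$, $$I_1(t;\Gamma_T)=-\frac{\rho}{2}\int_{\Gamma_T}\phi|u|^2\,u\cdot n\,ds,\qquad I_2(t;\Gamma_T)=-\rho g\int_{\Gamma_T}\phi\,\eta\,u\cdot n\,ds,$$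 $$I_3(t;\Gamma_T)=2\mu\int_{\Gamma_T}\phi\,[D(u)n]\cdot u\,ds.$$
   Formalization: The bound dE/dt ≤ I_3 is stated for φ ≥ 0 in Ω×(0,T), without which it can fail (Γ_T empty, φ<0). Γ is taken as finitely many C^1 arcs, the three parts as Borel sets covering Γ up to zero length, and η as continuous up to the boundary. *)

(* Defs.v *)
From mathcomp Require Import all_boot all_order all_algebra.
From mathcomp Require Import all_classical all_reals all_analysis.

Set Implicit Arguments.
Unset Strict Implicit.
Unset Printing Implicit Defensive.

Import Order.TTheory GRing.Theory Num.Theory.
Import numFieldNormedType.Exports.

Local Open Scope classical_set_scope.
Local Open Scope ring_scope.

(* The library norm on R * R is the maximum norm; it is used only for the
   topology.  The Euclidean structure of the plane is the following one. *)
Definition dotp {R : realType} (a b : R * R) : R := a.1 * b.1 + a.2 * b.2.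

Definition sqnorm {R : realType} (a : R * R) : R := dotp a a.

Definition cross {R : realType} (a b : R * R) : R := a.1 * b.2 - a.2 * b.1.

(* A 2 x 2 tensor is the pair of its rows. *)
Definition tensor (R : realType) : Type := ((R * R) * (R * R))%type.

Definition tens_app {R : realType} (A : tensor R) (v : R * R) : R * R :=
  (dotp A.1 v, dotp A.2 v).

(* C^k on an open set U: the directional derivatives of order at most k, along
   constant vectors, exist and are continuous on U. *)
Fixpoint Ck {R : realType} {V W : normedModType R} (k : nat) (U : set V)
    (f : V -> W) : Prop :=
  (forall x, U x -> {for x, continuous f}) /\
  (if k is k'.+1 then
     forall v : V, (forall x, U x -> derivable f x v) /\
       Ck k' U (fun x => 'D_v f x)
   else True).

(* C^k and C^oo up to the boundary of a closed set K: f, which is a total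
   function, is of that class on some open neighbourhood of K.  Its values away
   from that neighbourhood are irrelevant. *)
Definition Ck_on {R : realType} {V W : normedModType R} (k : nat) (K : set V)
    (f : V -> W) : Prop :=
  exists U : set V, [/\ open U, K `<=` U & Ck k U f].

Definition smooth_on {R : realType} {V W : normedModType R} (K : set V)
    (f : V -> W) : Prop :=
  exists U : set V, [/\ open U, K `<=` U & forall k, Ck k U f].

(* Space-time points are pairs ((x_1, x_2), t). *)
Definition pd1 {R : realType} {W : normedModType R} (f : (R * R) * R -> W) z : W :=
  'D_(((1, 0), 0) : (R * R) * R) f z.

Definition pd2 {R : realType} {W : normedModType R} (f : (R * R) * R -> W) z : W :=
  'D_(((0, 1), 0) : (R * R) * R) f z.

Definition pdt {R : realType} {W : normedModType R} (f : (R * R) * R -> W) z : W :=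
  'D_(((0, 0), 1) : (R * R) * R) f z.

Definition grad {R : realType} (f : (R * R) * R -> R) z : R * R := (pd1 f z, pd2 f z).

Definition divg {R : realType} (F : (R * R) * R -> R * R) z : R :=
  pd1 (fun y => (F y).1) z + pd2 (fun y => (F y).2) z.

Definition tens_divg {R : realType} (A : (R * R) * R -> tensor R) z : R * R :=
  (divg (fun y => (A y).1) z, divg (fun y => (A y).2) z).

Definition strain {R : realType} (u : (R * R) * R -> R * R) z : tensor R :=
  let g1 := grad (fun y => (u y).1) z in
  let g2 := grad (fun y => (u y).2) z in
  (2^-1 *: (g1 + (g1.1, g2.1)), 2^-1 *: (g2 + (g1.2, g2.2))).

(* (u . nabla) w *)
Definition advect {R : realType} (u w : (R * R) * R -> R * R) z : R * R :=
  (u z).1 *: pd1 w z + (u z).2 *: pd2 w z.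

Definition domain {R : realType} (Omega : set (R * R)) : Prop :=
  [/\ open Omega, Omega !=set0 & connected Omega].

Definition boundary {R : realType} (Omega : set (R * R)) : set (R * R) :=
  closure Omega `\` interior Omega.

(* Points of the boundary which are interior to one of the C^1 arcs gam k that
   it is made of; only finitely many boundary points are left out. *)
Definition regular_points {R : realType} (N : nat)
    (gam : 'I_N -> R -> R * R) : set (R * R) :=
  [set x | exists k, exists2 s, s \in `]0, 1[ & x = gam k s].

(* The boundary of Omega is the union of finitely many regular C^1 arcs, each
   parametrized by [0, 1], which can meet only at their end points, and n is
   the unit outward normal vector at every regular point.  The arcs are oriented
   so that Omega lies on their left, hence n is the unit tangent vector rotated
   by - pi / 2.  Nothing is assumed about the angles at the end points (corners,
   if any), where n is left unspecified. *)
Definition piecewise_C1_boundary {R : realType} (Omega : set (R * R)) (N : nat)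
    (gam : 'I_N -> R -> R * R) (n : R * R -> R * R) : Prop :=
  [/\ forall k, Ck_on 1 (`[0, 1] : set R) (gam k),
      forall k s, s \in `[0, 1] -> derive1 (gam k) s != 0,
      forall k l s s', s \in `[0, 1] -> s' \in `]0, 1[ ->
        gam k s = gam l s' -> k = l /\ s = s',
      boundary Omega = \bigcup_k (gam k @` (`[0, 1] : set R)) &
      forall k s, s \in `]0, 1[ ->
        let: v := derive1 (gam k) s in
        n (gam k s) = (Num.sqrt (sqnorm v))^-1 *: (v.2, - v.1) /\
        \forall tau \near 0^'+,
          Omega (gam k s - tau *: n (gam k s)) /\
          ~ closure Omega (gam k s + tau *: n (gam k s))].

Definition lebesgue2 (R : realType) :
    {measure set (measurableTypeR R * measurableTypeR R) -> \bar R} :=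
  (@lebesgue_measure R \x @lebesgue_measure R)%E.

(* Integral of f over G, a part of the boundary, with respect to arc length. *)
Definition line_integral {R : realType} (N : nat) (gam : 'I_N -> R -> R * R)
    (G : set (R * R)) (f : R * R -> R) : R :=
  \sum_(k < N) \int[@lebesgue_measure R]_(s in `[0, 1] `&` gam k @^-1` G)
    (f (gam k s) * Num.sqrt (sqnorm (derive1 (gam k) s))).

Definition null_length {R : realType} (N : nat) (gam : 'I_N -> R -> R * R)
    (G : set (R * R)) : Prop :=
  forall k, (@lebesgue_measure R).-negligible (`[0, 1] `&` gam k @^-1` G).

(* The boundary is split into three parts, which are Borel sets and leave
   uncovered only a set of length zero (such as the common end points). *)
Definition boundary_parts {R : realType} (Omega : set (R * R)) (N : nat)
    (gam : 'I_N -> R -> R * R) (GD GS GT : set (R * R)) : Prop :=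
  [/\ [/\ GD `<=` boundary Omega, GS `<=` boundary Omega
        & GT `<=` boundary Omega],
      closure (boundary Omega) = closure GD `|` closure GS `|` closure GT,
      [/\ GD `&` GS = set0, GS `&` GT = set0 & GT `&` GD = set0],
      [/\ measurable (GD : set (measurableTypeR R * measurableTypeR R)),
          measurable (GS : set (measurableTypeR R * measurableTypeR R))
        & measurable (GT : set (measurableTypeR R * measurableTypeR R))] &
      null_length gam (boundary Omega `\` (GD `|` GS `|` GT))].

Definition energy {R : realType} (rho g : R) (phi eta : (R * R) * R -> R)
    (u : (R * R) * R -> R * R) (Omega : set (R * R)) (t : R) : R :=
  (\int[lebesgue2 R]_(x in Omega)
     (rho / 2 * phi (x, t) * sqnorm (u (x, t)))) +
  (\int[lebesgue2 R]_(x in Omega) (rho * g * `|eta (x, t)| ^+ 2 / 2)).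

Definition I1 {R : realType} (rho : R) (phi : (R * R) * R -> R)
    (u : (R * R) * R -> R * R) (N : nat) (gam : 'I_N -> R -> R * R)
    (n : R * R -> R * R) (G : set (R * R)) (t : R) : R :=
  - (rho / 2) * line_integral gam G (fun x =>
      phi (x, t) * sqnorm (u (x, t)) * dotp (u (x, t)) (n x)).

Definition I2 {R : realType} (rho g : R) (phi eta : (R * R) * R -> R)
    (u : (R * R) * R -> R * R) (N : nat) (gam : 'I_N -> R -> R * R)
    (n : R * R -> R * R) (G : set (R * R)) (t : R) : R :=
  - (rho * g) * line_integral gam G (fun x =>
      phi (x, t) * eta (x, t) * dotp (u (x, t)) (n x)).

Definition I3 {R : realType} (mu : R) (phi : (R * R) * R -> R)
    (u : (R * R) * R -> R * R) (N : nat) (gam : 'I_N -> R -> R * R)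
    (n : R * R -> R * R) (G : set (R * R)) (t : R) : R :=
  2 * mu * line_integral gam G (fun x =>
      phi (x, t) * dotp (tens_app (strain u (x, t)) (n x)) (u (x, t))).

(* c(x) *)
Definition wave_speed {R : realType} (c0 g : R) (zeta : R * R -> R)
    (x : R * R) : R := c0 * Num.sqrt (g * zeta x).

Definition shallow_water {R : realType} (rho mu g T : R)
    (Omega : set (R * R)) (zeta : R * R -> R) (phi eta : (R * R) * R -> R)
    (u : (R * R) * R -> R * R) : Prop :=
  forall x t, Omega x -> t \in `]0, T[ -> let: z := (x, t) in
  [/\ pdt phi z + divg (fun y => phi y *: u y) z = 0,
      (rho * phi z) *: (pdt u z + advect u u z)
        - (2 * mu) *: tens_divg (fun y => (phi y *: (strain u y).1,
                                           phi y *: (strain u y).2)) z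
        + (rho * g * phi z) *: grad eta z = 0
    & phi z = eta z + zeta x].

(* The conditions that involve the normal vector are required at the points
   where it exists. *)
Definition boundary_conditions {R : realType} (c0 g T : R) (N : nat)
    (gam : 'I_N -> R -> R * R) (n : R * R -> R * R) (GD GS GT : set (R * R))
    (zeta : R * R -> R) (phi eta : (R * R) * R -> R)
    (u : (R * R) * R -> R * R) : Prop :=
  forall x t, t \in `]0, T[ -> let: z := (x, t) in
  [/\ GD x -> u z = 0,
      GS x -> regular_points gam x ->
        cross (tens_app (strain u z) (n x)) (n x) = 0 /\ dotp (u z) (n x) = 0
    & GT x -> regular_points gam x ->
        u z = (wave_speed c0 g zeta x * (eta z / phi z)) *: n x].

(* Main.v *)
(* Multiplying the momentum equations by u and using the mass equation, the
   energy density e = rho phi |u|^2 / 2 + rho g eta^2 / 2 satisfies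
   e_t = div F - 2 mu phi |D(u)|^2 with F = - rho phi |u|^2 u / 2
   - rho g phi eta u + 2 mu phi D(u) u.  The divergence theorem turns the integral
   of div F into the flux of F . n through the boundary: it vanishes where u = 0
   and on the slip part, where D(u) n is normal and u tangential, so that the
   transmission part alone contributes I1 + I2 + I3.  There u = (c eta / phi) n,
   and the integrand of I1 + I2 is nonpositive because phi >= (1 - alpha) zeta and
   alpha c0^2 <= 2 (1 - alpha)^2.

   The divergence theorem is proved for each constant direction separately.  Near
   a regular boundary point the domain is one side of a graph over any direction
   transversal to the boundary, and two such directions span the plane.  A finite
   cover patches these local formulas for functions vanishing near the end points
   of the arcs, and cutting off balls of radius e around the end points costs
   O(e), whatever the angles there. *)
Require Import Defs.
From mathcomp Require Import all_boot all_order all_algebra.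
From mathcomp Require Import all_classical all_reals all_analysis.
From mathcomp Require Import measurable_realfun ring lra.
Set Implicit Arguments.
Unset Strict Implicit.
Unset Printing Implicit Defensive.
Import Order.TTheory GRing.Theory Num.Theory.
Import numFieldNormedType.Exports.
Local Open Scope classical_set_scope.
Local Open Scope ring_scope.

(** [Ck] speaks of directional derivatives only, each continuous by itself, so even the additivity
    of ['D_v f] in [v] has to be proved; it is what recombines the formulas for two transversal
    directions. These directions are normalized as [(1, c)] because a shear then carries the
    horizontal direction to them, and on horizontal lines Fubini and the fundamental theorem of
    calculus apply; the vertical direction is reached only as a combination of two others.

    The normal [n] is unspecified at the end points of the arcs. Boundary integrals are therefore
    rewritten with [cross A (derive1 (gam k) s)], the density of [A . n ds] in the parameter, which
    is continuous on the whole of [[0, 1]].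

    The equations are given in [Omega] for [t] in []0, T[] only, and [eta] is merely continuous.
    Hence [eta] is replaced by [phi - zeta] wherever a derivative is taken, and the identities
    needed on the boundary or at [t = 0] and [t = T] are obtained by continuity; the transmission
    condition is first multiplied by [phi] to clear the quotient [eta / phi]. *)

Section line_derivative.
Context {R : realType} {V W : normedModType R}.
Implicit Types (f : V -> W) (U : set V).

Lemma line_quotient f (x0 v : V) (t : R) :
  (fun h : R => h^-1 *: (f (x0 + (h *: (1 : R) + t) *: v) - f (x0 + t *: v))) =
  (fun h : R => h^-1 *: (f (h *: v + (x0 + t *: v)) - f (x0 + t *: v))).
Proof.
apply/funext => h; congr (_ *: (f _ - _)).
by rewrite scalerDl [h *: 1]mulr1 addrCA.
Qed.

Lemma derivable_line f (x0 v : V) (t : R) :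
  derivable f (x0 + t *: v) v = derivable (fun s : R => f (x0 + s *: v)) t 1.
Proof. by rewrite /derivable line_quotient. Qed.

Lemma derive_line f (x0 v : V) (t : R) :
  'D_v f (x0 + t *: v) = 'D_1 (fun s : R => f (x0 + s *: v)) t.
Proof. by rewrite /derive line_quotient. Qed.

Lemma Ck1P U f : Ck 1 U f <->
  (forall x, U x -> {for x, continuous f}) /\
  (forall v x, U x -> derivable f x v /\ {for x, continuous (fun y => 'D_v f y)}).
Proof.
split=> [[cf df]|[cf df]]; split => // v.
  by move=> x Ux; have [d [c _]] := df v; split; [exact: d|exact: c].
by split=> [x Ux|]; [have [] := df v x Ux|split=> // x Ux; have [] := df v x Ux].
Qed.

Lemma CkW k U f : Ck k.+1 U f -> Ck k U f.
Proof.
elim: k f => [|k IH] f; first by case.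
by case=> cf df; split => // v; have [d c] := df v; split => //; exact: IH.
Qed.

Lemma Ck_subset k U U' f : U' `<=` U -> Ck k U f -> Ck k U' f.
Proof.
move=> sU; elim: k f => [|k IH] f [cf df]; split => //; try by move=> x /sU /cf.
by move=> v; have [d c] := df v; split; [move=> x /sU /d|exact: IH].
Qed.

End line_derivative.

Lemma derive_comp_near {R : realType} {V W : normedModType R} (f g : V -> W)
   (U : set V) v x : open U -> U x -> (forall y, U y -> f y = g y) ->
  (derivable f x v <-> derivable g x v) /\ 'D_v f x = 'D_v g x.
Proof.
move=> oU Ux fg.
have nfg : \near x, f x = g x by apply: (filterS fg); exact: open_nbhs_nbhs.
have ngf : \near x, g x = f x by apply: filterS nfg.
by split; [split; exact: near_eq_derivable|exact: near_eq_derive].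
Qed.

Lemma near_continuous_eq {T T' : topologicalType} (f g : T -> T') (U : set T) x :
  open U -> U x -> (forall y, U y -> f y = g y) ->
  {for x, continuous f} -> {for x, continuous g}.
Proof.
move=> oU Ux fg; rewrite /prop_for /continuous_at -(fg _ Ux) => cf.
apply: cvg_trans cf; apply: near_eq_cvg.
by apply: (filterS fg); exact: open_nbhs_nbhs.
Qed.

Lemma Ck_eq {R : realType} {V W : normedModType R} k (f g : V -> W) (U : set V) :
  open U -> (forall y, U y -> f y = g y) -> Ck k U f -> Ck k U g.
Proof.
move=> oU; elim: k f g => [|k IH] f g fg [cf df]; split => //.
- by move=> x Ux; apply: (near_continuous_eq oU Ux fg); exact: cf.
- by move=> x Ux; apply: (near_continuous_eq oU Ux fg); exact: cf.
move=> v; have [d c] := df v; split.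
  by move=> x Ux; apply/(derive_comp_near v oU Ux fg).1; exact: d.
by apply: IH c => y Uy; exact: (derive_comp_near v oU Uy fg).2.
Qed.

Section Ck1_algebra.
Context {R : realType} {V : normedModType R} (U : set V).
Implicit Types f g : V -> R.

Lemma Ck1_cst {W : normedModType R} (c : W) : Ck 1 U (fun=> c).
Proof.
apply/Ck1P; split=> [x _|v x _]; first exact: cvg_cst.
split; first exact: derivable_cst.
have -> : (fun y => 'D_v (fun=> c) y) = (fun=> 0 : W) by apply/funext => y; rewrite derive_cst.
exact: cvg_cst.
Qed.

Lemma is_deriveD_fun f g (x v : V) df dg :
  is_derive x v f df -> is_derive x v g dg ->
  is_derive x v (fun y => f y + g y) (df + dg).
Proof. by move=> F G; exact: (is_deriveD F G). Qed.

Lemma is_deriveM_fun f g (x v : V) df dg :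
  is_derive x v f df -> is_derive x v g dg ->
  is_derive x v (fun y => f y * g y) (f x * dg + g x * df).
Proof. by move=> F G; exact: (is_deriveM F G). Qed.

Lemma continuousD_fun {T : topologicalType} (f g : T -> R) (x : T) :
  {for x, continuous f} -> {for x, continuous g} ->
  {for x, continuous (fun y => f y + g y)}.
Proof. by move=> F G; exact: (cvgD F G). Qed.

Lemma continuousM_fun {T : topologicalType} (f g : T -> R) (x : T) :
  {for x, continuous f} -> {for x, continuous g} ->
  {for x, continuous (fun y => f y * g y)}.
Proof. by move=> F G; exact: (cvgM F G). Qed.

Lemma Ck1D f g : open U -> Ck 1 U f -> Ck 1 U g -> Ck 1 U (fun x => f x + g x).
Proof.
move=> oU /Ck1P[cf df] /Ck1P[cg dg]; apply/Ck1P; split=> [x Ux|v x Ux].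
  exact: continuousD_fun (cf _ Ux) (cg _ Ux).
have D y : U y -> is_derive y v (fun x => f x + g x) ('D_v f y + 'D_v g y).
  by move=> Uy; apply: is_deriveD_fun; apply: derivableP;
    [exact: (df v y Uy).1|exact: (dg v y Uy).1].
split; first by have [] := D x Ux.
apply: (near_continuous_eq oU Ux (fun y Uy => esym (@derive_val _ _ _ _ _ _ _ (D y Uy)))).
exact: continuousD_fun (df v x Ux).2 (dg v x Ux).2.
Qed.

Lemma Ck1M f g : open U -> Ck 1 U f -> Ck 1 U g -> Ck 1 U (fun x => f x * g x).
Proof.
move=> oU /Ck1P[cf df] /Ck1P[cg dg]; apply/Ck1P; split=> [x Ux|v x Ux].
  exact: continuousM_fun (cf _ Ux) (cg _ Ux).
have D y : U y -> is_derive y v (fun x => f x * g x) (f y * 'D_v g y + g y * 'D_v f y).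
  by move=> Uy; apply: is_deriveM_fun; apply: derivableP;
    [exact: (df v y Uy).1|exact: (dg v y Uy).1].
split; first by have [] := D x Ux.
apply: (near_continuous_eq oU Ux (fun y Uy => esym (@derive_val _ _ _ _ _ _ _ (D y Uy)))).
apply: continuousD_fun; apply: continuousM_fun.
- exact: cf.
- exact: (dg v x Ux).2.
- exact: cg.
- exact: (df v x Ux).2.
Qed.

End Ck1_algebra.

Section derive_linear.
Context {R : realType} {V : normedModType R}.
Implicit Types f : V -> R.

Lemma MVT0 (F : R -> R) (h : R) :
  (forall s : R, `|s| <= `|h| -> derivable F s 1) ->
  exists2 s : R, `|s| <= `|h| & F h - F 0 = derive1 F s * h.
Proof.
move=> dF.
have H (a b : R) : a <= b -> (forall s, s \in `[a, b] -> derivable F s 1) ->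
    exists2 s : R, s \in `[a, b] & F b - F a = derive1 F s * (b - a).
  move=> ab d; apply: MVT_segment => //.
    by move=> x xab; rewrite derive1E; apply/derivableP/d; exact: subset_itv_oo_cc.
  by apply: derivable_within_continuous.
have [h0|h0] := leP 0 h.
  have [|s /[!in_itv]/= /andP[s0 sh] E] := H 0 h h0.
    move=> s /[!in_itv]/= /andP[s0 sh]; apply: dF.
    by rewrite !ger0_norm.
  by exists s; [rewrite !ger0_norm|rewrite E subr0].
have [|s /[!in_itv]/= /andP[s0 sh] E] := H h 0 (ltW h0).
  move=> s /[!in_itv]/= /andP[s0 sh]; apply: dF.
  by rewrite !ler0_norm ?lerN2// ltW.
exists s; first by rewrite !ler0_norm ?lerN2// ltW.
by rewrite -[LHS]opprB E sub0r mulrN opprK.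
Qed.

(** The increment along [h (v + w)] is split at [x + h v]. The first half gives ['D_v f x]; on the
    second half the mean value theorem produces ['D_w f] at a point tending to [x], and continuity
    of ['D_w f] concludes. *)
Lemma derive_add U f (v w x : V) : open U -> Ck 1 U f -> U x ->
  'D_(v + w) f x = 'D_v f x + 'D_w f x.
Proof.
move=> oU /Ck1P[cf df] Ux.
apply: cvg_lim => //.
rewrite (_ : (fun h => _) = (fun h : R =>
    h^-1 *: (f (h *: v + x) - f x) +
    h^-1 *: (f (h *: (v + w) + x) - f (h *: v + x)))); last first.
  by apply/funext => h; rewrite -scalerDr; congr (_ *: _); rewrite [RHS]addrC addrA subrK.
apply: cvgD; first exact: (df v x Ux).1.
have [_ cw] := df w x Ux.
have [e /= e0 He] : exists2 e : R, 0 < e & ball x e `<=` U.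
  by have /nbhs_ballP[e e0 He] := open_nbhs_nbhs (conj oU Ux); exists e.
apply/cvgrPdist_lt => eps eps0.
have /cvgrPdist_lt/(_ _ eps0)/nbhs_ballP[e' /= e'0 He'] := cw.
(* [e] keeps the segment inside [U], [e'] controls the oscillation of ['D_w f] around [x]. *)
pose m := Num.min e e'.
have m0 : 0 < m by rewrite lt_min e0.
have K0 : 0 < `|v| + `|w| + 1 by rewrite ltr_wpDl// addr_ge0.
near=> h.
have hm : `|h| * (`|v| + `|w| + 1) < m.
  rewrite -ltr_pdivlMr//; near: h.
  apply: dnbhs0_lt; exact: divr_gt0.
have h0 : h != 0 by near: h; exact: nbhs_dnbhs_neq.
have Hb s : `|s| <= `|h| -> ball x m (h *: v + x + s *: w).
  move=> sh; rewrite -ball_normE/= addrAC opprD addrCA subrr addr0 normrN.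
  apply: le_lt_trans hm; rewrite (le_trans (ler_normD _ _))// !normrZ.
  rewrite mulrDr mulr1 mulrDr -addrA lerD2l ler_wpDr//.
  by rewrite ler_wpM2r.
have HU s : `|s| <= `|h| -> U (h *: v + x + s *: w).
  by move=> /Hb sb; apply: He; apply: le_ball sb; rewrite /m ge_min lexx.
have [s sh E] := @MVT0 (fun s => f (h *: v + x + s *: w)) h
   (fun s sh => let: conj d _ := df w _ (HU s sh) in
      eq_ind _ id d _ (derivable_line f (h *: v + x) w s)).
have -> : h *: (v + w) + x = h *: v + x + h *: w by rewrite scalerDr addrAC.
rewrite scale0r addr0 in E; rewrite E derive1E -derive_line.
rewrite /GRing.scale /= [_ * h]mulrC mulrA mulVf// mul1r.
apply: He' => /=; apply: le_ball (Hb _ sh).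
by rewrite /m ge_min lexx orbT.
Unshelve. all: by end_near.
Qed.

End derive_linear.

Lemma continuous_pair {T T1 T2 : topologicalType} (f : T -> T1) (g : T -> T2) (x : T) :
  {for x, continuous f} -> {for x, continuous g} ->
  {for x, continuous (fun z => (f z, g z))}.
Proof.
move=> cf cg.
exact: (@cvg_pair T T1 T2 (nbhs x) (nbhs (f x)) (nbhs (g x)) _ _ _ f g cf cg).
Qed.

Lemma continuous_cst {T T1 : topologicalType} (c : T1) (x : T) :
  {for x, continuous (fun _ : T => c)}.
Proof. exact: cvg_cst. Qed.

Lemma continuous_at_id {T : topologicalType} (x : T) : {for x, continuous (fun z : T => z)}.
Proof. exact: cvg_id. Qed.

Lemma continuous_comp_at {T T1 T2 : topologicalType} (f : T -> T1) (g : T1 -> T2) (x : T) :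
  {for x, continuous f} -> {for f x, continuous g} ->
  {for x, continuous (fun z => g (f z))}.
Proof. by move=> cf cg; exact: (continuous_comp cf cg). Qed.

Lemma open_superlevel {R : realType} {T : topologicalType} (h : T -> R) (c : R) :
  (forall z, {for z, continuous h}) -> open [set z | c < h z].
Proof.
move=> ch; apply: (@open_comp _ _ h [set r | c < r]); last exact: open_gt.
by move=> z _; exact: ch.
Qed.

Section pair_valued.
Context {R : realType} {V W1 W2 : normedModType R}.

Lemma is_derive_fst (f : V -> W1 * W2) (x v : V) df :
  is_derive x v f df -> is_derive x v (fun y => (f y).1) df.1.
Proof.
move=> [d <-].
have c : h^-1 *: ((f (h *: v + x)).1 - (f x).1) @[h --> 0^'] --> ('D_v f x).1.
  exact: (cvg_comp _ _ d cvg_fst).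
by apply: DeriveDef; [apply/cvg_ex; exists ('D_v f x).1|exact: cvg_lim].
Qed.

Lemma is_derive_snd (f : V -> W1 * W2) (x v : V) df :
  is_derive x v f df -> is_derive x v (fun y => (f y).2) df.2.
Proof.
move=> [d <-].
have c : h^-1 *: ((f (h *: v + x)).2 - (f x).2) @[h --> 0^'] --> ('D_v f x).2.
  exact: (cvg_comp _ _ d cvg_snd).
by apply: DeriveDef; [apply/cvg_ex; exists ('D_v f x).2|exact: cvg_lim].
Qed.

Lemma continuous_fst_at {T : topologicalType} (f : T -> W1 * W2) (x : T) :
  {for x, continuous f} -> {for x, continuous (fun y => (f y).1)}.
Proof. by move=> cf; exact: (cvg_comp _ _ cf cvg_fst). Qed.

Lemma continuous_snd_at {T : topologicalType} (f : T -> W1 * W2) (x : T) :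
  {for x, continuous f} -> {for x, continuous (fun y => (f y).2)}.
Proof. by move=> cf; exact: (cvg_comp _ _ cf cvg_snd). Qed.

Lemma Ck_fst k (U : set V) (f : V -> W1 * W2) : open U ->
  Ck k U f -> Ck k U (fun x => (f x).1).
Proof.
move=> oU; elim: k f => [|k IH] f [cf df]; split=> //.
- by move=> x Ux; apply: continuous_fst_at; exact: cf.
- by move=> x Ux; apply: continuous_fst_at; exact: cf.
move=> v; have [d c] := df v.
have D x : U x -> is_derive x v (fun y => (f y).1) ('D_v f x).1.
  by move=> Ux; apply/is_derive_fst/derivableP/d.
split; first by move=> x /D[].
apply: (Ck_eq oU _ (IH _ c)) => y Uy.
by rewrite (@derive_val _ _ _ _ _ _ _ (D y Uy)).
Qed.

Lemma Ck_snd k (U : set V) (f : V -> W1 * W2) : open U ->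
  Ck k U f -> Ck k U (fun x => (f x).2).
Proof.
move=> oU; elim: k f => [|k IH] f [cf df]; split=> //.
- by move=> x Ux; apply: continuous_snd_at; exact: cf.
- by move=> x Ux; apply: continuous_snd_at; exact: cf.
move=> v; have [d c] := df v.
have D x : U x -> is_derive x v (fun y => (f y).2) ('D_v f x).2.
  by move=> Ux; apply/is_derive_snd/derivableP/d.
split; first by move=> x /D[].
apply: (Ck_eq oU _ (IH _ c)) => y Uy.
by rewrite (@derive_val _ _ _ _ _ _ _ (D y Uy)).
Qed.

End pair_valued.

Lemma continuous_fst {T1 T2 : topologicalType} (p : T1 * T2) :
  {for p, continuous (fun q : T1 * T2 => q.1)}.
Proof. exact: cvg_fst. Qed.

Lemma continuous_snd {T1 T2 : topologicalType} (p : T1 * T2) :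
  {for p, continuous (fun q : T1 * T2 => q.2)}.
Proof. exact: cvg_snd. Qed.

Lemma continuous_norm_at {R : realType} {T : topologicalType} (f : T -> R) (x : T) :
  {for x, continuous f} -> {for x, continuous (fun y => `|f y|)}.
Proof.
move=> cf; apply: (@continuous_comp_at _ _ _ f Num.norm) => //.
exact: norm_continuous.
Qed.

(** * Lebesgue measure on the plane *)

Section plane_measure.
Context {R : realType}.
Local Notation mR := (measurableTypeR R).
Local Notation mu2 := (lebesgue2 R).

(** The measurable sets of the plane form the product sigma-algebra, so an open set is written as a
    countable union of rational squares. *)
Lemma open2_measurable (U : set (R * R)) : open U ->
  measurable (U : set (mR * mR)).
Proof.
move=> oU.
pose B (q : rat * rat * nat) : set (R * R) :=
  ball (ratr q.1.1 : R) q.2.+1%:R^-1 `*` ball (ratr q.1.2 : R) q.2.+1%:R^-1.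
(* Squares that stick out of [U] are replaced by the empty set, so that the union can run over the
   whole countable index type. *)
pose F q := if `[< B q `<=` U >] then B q else set0.
have -> : U = \bigcup_q F q.
  rewrite eqEsubset; split=> [[x y] Uxy|p [q _]]; last first.
    by rewrite /F; case: asboolP => // sU /sU.
  have /nbhs_ballP[e /= e0 He] := open_nbhs_nbhs (conj oU Uxy).
  have [k] : exists k : nat, k.+1%:R^-1 < e / 2.
    have /ltr_add_invr[k] : 0 < e / 2 by rewrite divr_gt0.
    by rewrite add0r => ?; exists k.
  have : 0 < k.+1%:R^-1 :> R by rewrite invr_gt0.
  set r := k.+1%:R^-1 => r0 re.
  have near_rat (z : R) : exists q : rat, ball (ratr q : R) r z.
    have [|q /[!in_itv]/= /andP[q1 q2]] := @rat_in_itvoo R (z - r) (z + r).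
      by lra.
    exists q; rewrite -ball_normE/= ltr_norml; apply/andP; split; lra.
  have [q1 q1x] := near_rat x; have [q2 q2y] := near_rat y.
  exists (q1, q2, k) => //; rewrite /F asboolT; first by split.
  move=> [z1 z2] [/= z1q z2q]; apply: He.
  have half (a b q : R) : ball q r a -> ball q r b -> ball a e b.
    by move=> qa qb; apply: (@ball_splitr _ _ q); apply: le_ball (ltW re) _ _.
  by split; [exact: half q1x z1q|exact: half q2y z2q].
apply: countable_bigcupT_measurable => // q; rewrite /F; case: asboolP => // _.
by apply: measurableX; apply: open_measurable; exact: ball_open.
Qed.

Lemma open2_measurable_fun (D : set (R * R)) (f : R * R -> R) : open D ->
  (forall x, D x -> {for x, continuous f}) ->
  measurable_fun (D : set (mR * mR)) (f : mR * mR -> mR).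
Proof.
move=> oD cf mD; apply: (measurability _ (RGenOpens.measurableE R)) => //.
move=> _ [_ [a [b ->] <-]]; apply: open2_measurable.
rewrite openE => x [Dx fx]; apply: filterI.
  exact: open_nbhs_nbhs.
apply: (cf _ Dx); apply: open_nbhs_nbhs; split => //; exact: interval_open.
Qed.

(** The image of the measure under the translation agrees with it on the intervals []a, b]], which
    determine it. *)
Lemma lebesgue_measureD (c : R) (A : set R) : measurable (A : set mR) ->
  @lebesgue_measure R ((fun y => y + c) @^-1` A) = lebesgue_measure A.
Proof.
move=> mA.
have mf : @measurable_fun _ _ mR mR setT (fun y : R => y + c).
  by apply: measurable_funD.
pose f := MeasurableFun.Pack (MeasurableFun.Class (isMeasurableFun.Build _ _ mR mR _ mf)).
have fE : f = (fun y => y + c) :> (R -> R) by [].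
rewrite -fE -[LHS]/(pushforward (@lebesgue_measure R) f A).
apply/esym/lebesgue_measure_unique => //= _ [[a b]] _ <-.
rewrite /pushforward.
have -> : f @^-1` `]a, b]%classic = `](a - c), (b - c)]%classic.
  by apply/seteqP; split=> x /=; rewrite !in_itv/= ltrBlDr lerBrDr.
rewrite !lebesgue_measure_itv/= !lte_fin ltrD2r.
by case: ifP => // _; rewrite -!EFinB; congr EFin; ring.
Qed.

Definition shear (c : R) (p : R * R) : R * R := (p.1, p.2 + c * p.1).

Lemma measurable_shear c : @measurable_fun _ _ (mR * mR)%type (mR * mR)%type setT (shear c).
Proof.
apply/measurable_fun_pairP; split.
 exact: measurable_fst.
apply: measurable_funD; first exact: measurable_snd.
by apply: measurable_funM => //; exact: measurable_fst.
Qed.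

(** On each vertical slice the shear is the translation by [c * x], which preserves the length of
    the slice. *)
Lemma lebesgue2_shear c (A : set (R * R)) : measurable (A : set (mR * mR)) ->
  mu2 (shear c @^-1` A) = mu2 A.
Proof.
move=> mA; rewrite /lebesgue2/= /product_measure1.
apply: eq_integral => x _ /=.
rewrite -[RHS](lebesgue_measureD (c * x)); last exact: measurable_xsection.
by congr (lebesgue_measure _).
Qed.

Lemma Rintegral2_shear c (D : set (R * R)) (f : R * R -> R) :
  measurable (D : set (mR * mR)) ->
  mu2.-integrable (shear c @^-1` D) (EFin \o (f \o shear c)) ->
  measurable_fun setT (f : mR * mR -> mR) ->
  \int[mu2]_(p in D) f p = \int[mu2]_(p in shear c @^-1` D) f (shear c p).
Proof.
move=> mD intf mf; rewrite /Rintegral; congr fine.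
pose S := MeasurableFun.Pack (MeasurableFun.Class (isMeasurableFun.Build _ _ _ _ _ (measurable_shear c))).
transitivity (\int[pushforward mu2 S]_(p in D) (f p)%:E)%E.
  by apply: eq_measure_integral => A mA _; rewrite -(lebesgue2_shear c mA).
rewrite integral_pushforward//.
by apply/measurable_EFinP.
Qed.

Lemma lebesgue2_box (a b c d : R) : a <= b -> c <= d ->
  mu2 (`[a, b] `*` `[c, d]) = ((b - a) * (d - c))%:E.
Proof.
move=> ab cd; rewrite /lebesgue2/= product_measure1E//.
have len (x y : R) : x <= y -> lebesgue_measure `[x, y]%classic = (y - x)%:E.
  move=> xy; rewrite lebesgue_measure_itv/= lte_fin.
  have [_|yx|->] := ltgtP x y; last by rewrite subrr.
    by rewrite EFinB.
  by move: xy; rewrite leNgt yx.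
by rewrite EFinM -len// -len.
Qed.

Lemma integrable2_bounded (D : set (R * R)) (f : R * R -> R) (r M : R) :
  measurable (D : set (mR * mR)) -> D `<=` `[- r, r] `*` `[- r, r] ->
  measurable_fun (D : set (mR * mR)) (f : mR * mR -> mR) ->
  (forall x, D x -> `|f x| <= M) -> mu2.-integrable D (EFin \o f).
Proof.
move=> mD Dr mf fM; apply: measurable_bounded_integrable => //.
  have [r0|r0] := leP 0 r.
    apply: (@le_lt_trans _ _ (mu2 (`[- r, r] `*` `[- r, r]))).
      by apply: le_measure => //; rewrite inE//; exact: measurableX.
    by rewrite lebesgue2_box ?ltry//; lra.
  suff -> : D = set0 by rewrite measure0 ltry.
  rewrite -subset0 => x /Dr[/=]; rewrite in_itv/= => /andP[? ?] _.
  exfalso; lra.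
exists M; split; first exact: num_real.
by move=> x Mx y Dy; apply: le_trans (ltW Mx); exact: fM.
Qed.

(** [D] may be unbounded, such as the half-plane used for interior points; the bounded support of
    [f] confines the integral to a box. *)
Lemma integrable2_supp (D : set (R * R)) (f : R * R -> R) (r : R) :
  open D -> continuous f -> (forall p, f p != 0 -> `|p.1| <= r /\ `|p.2| <= r) ->
  mu2.-integrable D (EFin \o f).
Proof.
move=> oD cf fr; pose box := `[- r, r]%classic `*` `[- r, r]%classic.
have mD : measurable (D `&` box : set (mR * mR)).
  by apply: measurableI; [exact: open2_measurable|exact: measurableX].
apply/(integrable_mkcond _ (open2_measurable oD)).
have -> : ((EFin \o f) \_ D) = ((EFin \o f) \_ (D `&` box)).
  apply/funext => p; rewrite !patchE.
  have [f0|/fr[p1 p2]] := eqVneq (f p) 0; first by rewrite /= f0; do 2 case: ifP.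
  have bp : box p by split; rewrite /= in_itv/= -ler_norml.
  have -> // : (p \in D `&` box) = (p \in D).
  by apply/idP/idP => /set_mem Op; apply/mem_set; [case: Op|split].
apply/(integrable_mkcond _ mD).
have cb : compact box by apply: compact_setX; exact: segment_compact.
have /compact_bounded[M [_ HM]] := continuous_compact (continuous_subspaceT cf) cb.
apply: (@integrable2_bounded _ _ r (M + 1)) => //.
- apply: measurable_funTS; apply: open2_measurable_fun; first exact: openT.
  by move=> x _; exact: cf.
- by move=> p [_ bp]; apply: (HM (M + 1)); [rewrite ltrDl|exists p].
Qed.

End plane_measure.

(** * The divergence theorem near a regular boundary arc *)

Section horizontal_slices.
Context {R : realType}.
Local Notation mu := (@lebesgue_measure R).
Local Notation mu2 := (lebesgue2 R).
Local Notation e1 := ((1, 0) : R * R).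

Lemma slice1E (x y : R) : (0, y) + x *: e1 = (x, y).
Proof.
apply: injective_projections => /=; rewrite /GRing.scale/=.
  by rewrite mulr1 add0r.
by rewrite mulr0 addr0.
Qed.

Lemma derivable_slice1 (f : R * R -> R) (x y : R) :
  derivable f (x, y) e1 -> derivable (fun z => f (z, y)) x 1.
Proof.
rewrite -{1}(slice1E x y) derivable_line.
by under eq_fun do rewrite slice1E.
Qed.

Lemma derive_slice1 (f : R * R -> R) (x y : R) :
  derive1 (fun z => f (z, y)) x = 'D_e1 f (x, y).
Proof.
rewrite -(slice1E x y) derive_line derive1E.
by congr ('D_1 _ x); apply/funext => z; rewrite slice1E.
Qed.

Lemma continuous_slice1 (T : topologicalType) (f : R * R -> T) (x y : R) :
  {for (x, y), continuous f} -> {for x, continuous (fun z => f (z, y))}.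
Proof.
move=> cf; apply: (@continuous_comp_at _ _ _ (fun z => (z, y)) f) => //.
by apply: continuous_pair; [exact: continuous_at_id|exact: continuous_cst].
Qed.

Lemma FTC_slice1 (f : R * R -> R) (y a b : R) : a < b ->
  (forall p, derivable f p e1) -> continuous ('D_e1 f) ->
  (\int[mu]_(x in `]a, b[) ('D_e1 f (x, y))%:E = (f (b, y) - f (a, y))%:E)%E.
Proof.
move=> ab df cdf.
have d x : derivable (fun z => f (z, y)) x 1 by exact: derivable_slice1.
have c : continuous (fun x => f (x, y)).
  by move=> x; apply: differentiable_continuous; apply/derivable1_diffP.
have c' : continuous (fun x => 'D_e1 f (x, y)) by move=> x; exact: (continuous_slice1 (@cdf (x, y))).
rewrite integral_itv_bndo_bndc; last first.
  apply/measurable_EFinP/measurable_funTS; exact: continuous_measurable_fun.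
rewrite integral_itv_obnd_cbnd; last first.
  apply/measurable_EFinP/measurable_funTS; exact: continuous_measurable_fun.
have dO : derivable_oo_LRcontinuous (fun x => f (x, y)) a b.
  split=> [x _||]; first exact: d.
    by apply: cvg_at_right_filter; exact: c.
  by apply: cvg_at_left_filter; exact: c.
have cw : {within `[a, b], continuous (fun x => 'D_e1 f (x, y))}.
  exact: continuous_subspaceT.
have dE : {in `]a, b[, derive1 (fun x => f (x, y)) =1 (fun x => 'D_e1 f (x, y))}.
  by move=> x _; exact: derive_slice1.
by rewrite EFinB; exact: (continuous_FTC2 ab cw dO dE).
Qed.

(** The outside of the closed box is open, so [f] vanishes near each of its points and its
    derivative vanishes there too. *)
Lemma derive_supp (f : R * R -> R) (v : R * R) (B : R) :
  (forall p, f p != 0 -> `|p.1| <= B /\ `|p.2| <= B) ->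
  forall p, 'D_v f p != 0 -> `|p.1| <= B /\ `|p.2| <= B.
Proof.
move=> fB p Dp.
have zero (h : R * R -> R) : continuous h -> B < h p ->
    (forall z, B < h z -> f z = 0) -> 'D_v f p = 0.
  move=> ch hp h0.
  have [_ ->] := derive_comp_near (g := fun=> 0) v (open_superlevel B ch) hp h0.
  exact: derive_cst.
split; rewrite leNgt; apply: contraNN Dp => Bp; apply/eqP.
  apply: (zero (fun z => `|z.1|)) => // [z|z Bz].
    by apply: continuous_norm_at; exact: continuous_fst.
  by apply/eqP; apply: contraTT Bz => /fB[]; rewrite -leNgt.
apply: (zero (fun z => `|z.2|)) => // [z|z Bz].
  by apply: continuous_norm_at; exact: continuous_snd.
by apply/eqP; apply: contraTT Bz => /fB[]; rewrite -leNgt.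
Qed.

(* On the support of [f], [Omega] is the side [sigma w < 0] of the arc
   [(g1, g2)], [w] being the horizontal displacement. *)
Section local_formula.
Variables (f : R * R -> R) (Omega : set (R * R)) (g1 g2 : R -> R).
Variables (a b rho rho' sigma B : R).
Hypothesis ab : a < b.
Hypothesis oO : open Omega.
Hypothesis sigma1 : sigma = 1 \/ sigma = -1.
Hypothesis rho_lt : rho' < rho.
Hypothesis cf : continuous f.
Hypothesis df : forall p, derivable f p e1.
Hypothesis cdf : continuous ('D_e1 f).
Hypothesis fB : forall p, f p != 0 -> `|p.1| <= B /\ `|p.2| <= B.
Hypothesis fsupp : forall p, f p != 0 ->
  exists s, [/\ s \in `]a, b[, `|p.1 - g1 s| <= rho' & p.2 = g2 s].
Hypothesis side : forall s w, s \in `]a, b[ -> `|w| < rho ->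
  Omega (g1 s + w, g2 s) <-> sigma * w < 0.
Hypothesis cg1 : forall s, s \in `[a, b] -> {for s, continuous g1}.
Hypothesis dg2 : forall s, s \in `[a, b] -> derivable g2 s 1.
Hypothesis cdg2 : forall s, s \in `[a, b] -> {for s, continuous (derive1 g2)}.
Hypothesis g2_mono : forall s, s \in `[a, b] -> 0 < sigma * derive1 g2 s.

Let cg2 s : s \in `[a, b] -> {for s, continuous g2}.
Proof.
by move=> sab; apply: differentiable_continuous; apply/derivable1_diffP; exact: dg2.
Qed.

Let cg2w : {within `[a, b], continuous g2}.
Proof. by apply: derivable_within_continuous => x; exact: dg2. Qed.

Let g2_incr : sigma = 1 -> {in `[a, b] &, {homo g2 : x y / x < y}}.
Proof.
move=> s1 x y xab yab xy.
apply: (@gtr0_derive1_lt_cc _ g2 a b) => // z zab; first by apply/dg2/subset_itv_oo_cc.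
by have := g2_mono (subset_itv_oo_cc zab); rewrite s1 mul1r.
Qed.

Let g2_decr : sigma = -1 -> {in `[a, b] &, {homo g2 : x y /~ x < y}}.
Proof.
move=> s1 x y xab yab xy.
apply: (@ltr0_derive1_lt_cc _ g2 a b) => // z zab; first by apply/dg2/subset_itv_oo_cc.
by have := g2_mono (subset_itv_oo_cc zab); rewrite s1 mulN1r oppr_gt0.
Qed.

Let g2_inj : {in `[a, b] &, injective g2}.
Proof.
move=> x y xab yab E.
have [xy|yx|//] := ltgtP x y; case: sigma1 => s1.
- by have := g2_incr s1 xab yab xy; rewrite E ltxx.
- by have := g2_decr s1 yab xab xy; rewrite E ltxx.
- by have := g2_incr s1 yab xab yx; rewrite E ltxx.
- by have := g2_decr s1 xab yab yx; rewrite E ltxx.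
Qed.

Let Df_out (x y : R) U : open U -> U x -> (forall z, U z -> f (z, y) = 0) ->
  'D_e1 f (x, y) = 0.
Proof.
move=> oU Ux fU; rewrite -derive_slice1 derive1E.
have [_ ->] := @derive_comp_near R R R (fun z => f (z, y)) (fun=> 0) U 1 x oU Ux fU.
exact: derive_cst.
Qed.

Let H (p : R * R) : \bar R := ((EFin \o 'D_e1 f) \_ Omega) p.

Let line_zero y : (forall x, f (x, y) = 0) -> (\int[mu]_x H (x, y) = 0)%E.
Proof.
move=> f0; apply: integral0_eq => x _; rewrite /H patchE; case: ifP => // _ /=.
by rewrite (@Df_out x y setT)//; exact: openT.
Qed.

(** At height [g2 s] and within distance [rho] of the arc, [Omega] is an interval of length [rho]
    with [g1 s] as one end point. At the other end point [f] vanishes because [rho' < rho], so the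
    fundamental theorem of calculus leaves only the value on the arc, with sign [sigma]. *)
Let line_graph s : s \in `[a, b] ->
  (\int[mu]_x H (x, g2 s) = (sigma * f (g1 s, g2 s))%:E)%E.
Proof.
move=> sab.
have [sab'|sab'] := boolP (s \in `]a, b[); last first.
  (* At the extreme heights [g2 a] and [g2 b] the whole line misses the support: a point of the
     support has height [g2 s'] with [s'] in the open interval, and [g2] is injective. *)
  have f0 x : f (x, g2 s) = 0.
    apply/eqP; apply: contraNT sab' => /fsupp[s' [s'ab _ /= E]].
    by rewrite (g2_inj sab (subset_itv_oo_cc s'ab) E).
  by rewrite line_zero// f0 mulr0.
have f0 x : rho' < `|x - g1 s| -> f (x, g2 s) = 0.
  move=> xr; apply/eqP; apply: contraTT xr => /fsupp[s' [s'ab /= xs' E]].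
  by rewrite (g2_inj sab (subset_itv_oo_cc s'ab) E) -leNgt.
have [r0|r0] := leP rho 0.
  have fz x : f (x, g2 s) = 0.
    by apply: f0; apply: lt_le_trans rho_lt _; exact: le_trans r0 _.
  by rewrite line_zero// fz mulr0.
have D0 x : rho <= `|x - g1 s| -> 'D_e1 f (x, g2 s) = 0.
  move=> xr; apply: (@Df_out x _ [set z | rho' < `|z - g1 s|]).
  - apply: open_superlevel => z; apply: (@continuous_comp_at _ _ _ (fun z => z - g1 s) Num.norm).
      by apply: continuousD_fun; [exact: continuous_at_id|exact: continuous_cst].
    exact: norm_continuous.
  - exact: lt_le_trans xr.
  - by move=> z /= /f0.
(* [sigma = 1] puts [Omega] to the left of the arc, [sigma = -1] to its right; [l] is the left end
   of the interval in both cases. *)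
pose l := if sigma == 1 then g1 s - rho else g1 s.
have -> : (fun x => H (x, g2 s)) =
    ((fun x => ('D_e1 f (x, g2 s))%:E) \_ `]l, (l + rho)[).
  apply/funext => x; rewrite /H !patchE.
  have [xr|xr] := leP rho `|x - g1 s|; first by rewrite /= D0//; do 2 case: ifP.
  have := side sab' xr; rewrite (addrC (g1 s)) subrK => sd.
  have -> : ((x, g2 s) \in Omega) = (sigma * (x - g1 s) < 0).
    by apply/idP/idP => [/set_mem/sd//|/sd/mem_set].
  have -> : (x \in `]l, (l + rho)[%classic) = (l < x < l + rho).
    by rewrite mem_setE in_itv.
  move: xr; rewrite ltr_norml => /andP[x1 x2].
  have -> // : (sigma * (x - g1 s) < 0) = (l < x < l + rho).
  rewrite /l; case: sigma1 => ->.
    by rewrite eqxx mul1r; apply/idP/idP => [?|/andP[? ?]]; [apply/andP; split|]; lra.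
  have -> : (-1 == 1 :> R) = false by apply/eqP; lra.
  by rewrite mulN1r; apply/idP/idP => [?|/andP[? ?]]; [apply/andP; split|]; lra.
rewrite -integral_mkcond FTC_slice1//; last by rewrite ltrDl.
have fr w : rho <= `|w| -> f (g1 s + w, g2 s) = 0.
  by move=> wr; apply: f0; rewrite addrAC subrr add0r; exact: lt_le_trans wr.
rewrite /l; case: sigma1 => ->.
  by rewrite eqxx subrK mul1r fr ?subr0// normrN ler_norm.
have -> : (-1 == 1 :> R) = false by apply/eqP; lra.
by rewrite mulN1r fr ?sub0r// ler_norm.
Qed.

(** The inverse of [g2] on its range; the default value [a] is only taken outside that range. *)
Let ginv y := xget a [set s | s \in `[a, b] /\ g2 s = y].

Let ginvK : {in `[a, b], cancel g2 ginv}.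
Proof.
move=> s sab; rewrite /ginv; case: xgetP => [t _ [tab E]|]; first exact: g2_inj.
by move=> /(_ s) [].
Qed.

Let lo := Num.min (g2 a) (g2 b).
Let hi := Num.max (g2 a) (g2 b).

Let ginv_cont : {within `[lo, hi], continuous ginv}.
Proof.
have aab : a \in `[a, b] by rewrite in_itv/= lexx ltW.
have bab : b \in `[a, b] by rewrite in_itv/= lexx ltW.
case: sigma1 => s1.
  have gab := g2_incr s1 aab bab ab.
  rewrite /lo /hi min_l ?max_r ?(ltW gab)//.
  exact: (segment_can_le_continuous (ltW ab) cg2w ginvK).
have gab := g2_decr s1 bab aab ab.
rewrite /lo /hi min_r ?max_l ?(ltW gab)//.
exact: (segment_can_ge_continuous (ltW ab) cg2w ginvK).
Qed.

Let G (y : R) := sigma * f (g1 (ginv y), g2 (ginv y)).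

Let image_g2 y : y \in `[lo, hi] -> exists2 s, s \in `[a, b] & g2 s = y.
Proof.
rewrite in_itv => /= ylh; have [s sab <-] := IVT (ltW ab) cg2w ylh.
by exists s.
Qed.

Let ginv_in y : y \in `[lo, hi] -> ginv y \in `[a, b] /\ g2 (ginv y) = y.
Proof. by move=> /image_g2[s sab <-]; rewrite ginvK. Qed.

Let G_cont : {within `[lo, hi], continuous G}.
Proof.
apply/subspace_continuousP => y ylh.
have [sab _] := ginv_in ylh.
have gc := (subspace_continuousP _ _).1 ginv_cont y ylh.
have cc : {for ginv y, continuous (fun s => sigma * f (g1 s, g2 s))}.
  apply: continuousM_fun; first exact: continuous_cst.
  apply: (@continuous_comp_at _ _ _ (fun s => (g1 s, g2 s)) f); last exact: cf.
  by apply: continuous_pair; [exact: cg1|exact: cg2].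
exact: (cvg_comp _ _ gc cc).
Qed.

Let H_int : mu2.-integrable setT H.
Proof.
apply/(integrable_mkcond _ (open2_measurable oO)).
by apply: (@integrable2_supp _ _ _ B) => //; exact: derive_supp.
Qed.

Let g2_range s : s \in `[a, b] -> g2 s \in `[lo, hi].
Proof.
rewrite !in_itv/= => /andP[as_ sb].
have aab : a \in `[a, b] by rewrite in_itv/= lexx ltW.
have bab : b \in `[a, b] by rewrite in_itv/= lexx ltW.
have sab : s \in `[a, b] by rewrite in_itv/= as_.
rewrite /lo /hi ge_min le_max; case: sigma1 => s1.
  have mono := le_mono_in (g2_incr s1).
  by rewrite !mono// as_ sb orbT.
have mono := le_nmono_in (g2_decr s1).
by rewrite !mono// as_ sb !orbT.
Qed.

Let inner y : (\int[mu]_x H (x, y) = ((EFin \o G) \_ `[lo, hi]) y)%E.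
Proof.
rewrite patchE; case: ifPn => [/set_mem ylh|ylh].
  have [sab E] := ginv_in ylh.
  by rewrite -{1}E line_graph//.
apply: line_zero => x; apply/eqP; apply: contraNT ylh => /fsupp[s [sab _ /= ->]].
by apply/mem_set/g2_range/subset_itv_oo_cc.
Qed.

Let G_comp s : s \in `[a, b] -> G (g2 s) = sigma * f (g1 s, g2 s).
Proof. by move=> sab; rewrite /G ginvK. Qed.

Let LR : derivable_oo_LRcontinuous g2 a b.
Proof.
have aab : a \in `[a, b] by rewrite in_itv/= lexx ltW.
have bab : b \in `[a, b] by rewrite in_itv/= lexx ltW.
split=> [x xab||]; first by apply/dg2/subset_itv_oo_cc.
  by apply: cvg_at_right_filter; exact: cg2.
by apply: cvg_at_left_filter; exact: cg2.
Qed.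

(* Fubini and the fundamental theorem of calculus on horizontal lines, then the
   change of variables [y = g2 s]. *)
Lemma horizontal_formula :
  \int[mu2]_(p in Omega) 'D_e1 f p =
  \int[mu]_(s in `[a, b]) (f (g1 s, g2 s) * derive1 g2 s).
Proof.
have aab : a \in `[a, b] by rewrite in_itv/= lexx ltW.
have bab : b \in `[a, b] by rewrite in_itv/= lexx ltW.
have co : {in `]a, b[, continuous (derive1 g2)}.
  by move=> x xab; apply: cdg2; exact: subset_itv_oo_cc.
have cr : cvg (derive1 g2 x @[x --> a^'+]).
  by apply/cvg_ex; exists (derive1 g2 a); apply: cvg_at_right_filter; exact: cdg2.
have cl : cvg (derive1 g2 x @[x --> b^'-]).
  by apply/cvg_ex; exists (derive1 g2 b); apply: cvg_at_left_filter; exact: cdg2.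
rewrite /Rintegral; congr fine.
rewrite integral_mkcond -[LHS]/(\int[mu2]_p H p)%E.
rewrite -[LHS](integral21_prod_meas1 H_int).
transitivity (\int[mu]_y (((EFin \o G) \_ `[lo, hi]) y))%E.
  by apply: eq_integral => y _; exact: inner.
rewrite -integral_mkcond.
(* The substitution [y = g2 s] brings in the absolute value of [derive1 g2 s]. As
   [sigma * derive1 g2 s] is positive, the factor [sigma] of [G] turns it back into
   [derive1 g2 s]. *)
case: sigma1 => s1.
  have gab := g2_incr s1 aab bab ab.
  have := G_cont; rewrite /lo /hi min_l ?max_r ?(ltW gab)// => Gc.
  rewrite [LHS](integration_by_substitution_increasing (ltW ab) (g2_incr s1) co cr cl LR Gc).
  apply: eq_integral => s /set_mem sab; congr EFin.
  by rewrite -[LHS]/(G (g2 s) * derive1 g2 s) G_comp// s1 mul1r.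
have gab := g2_decr s1 bab aab ab.
have := G_cont; rewrite /lo /hi min_r ?max_l ?(ltW gab)// => Gc.
rewrite [LHS](integration_by_substitution_decreasing (ltW ab) (g2_decr s1) co cr cl LR Gc).
apply: eq_integral => s /set_mem sab; congr EFin.
by rewrite -[LHS]/(G (g2 s) * - derive1 g2 s) G_comp// s1 mulN1r mulrNN.
Qed.

End local_formula.

(* A shear makes the direction [(1, c)] horizontal and preserves the measure. *)
Lemma transversal_formula (f : R * R -> R) (Omega : set (R * R)) (gam : R -> R * R)
    (c a b rho rho' sigma B : R) (U : set R) :
  a < b -> open Omega -> sigma = 1 \/ sigma = -1 -> rho' < rho ->
  Ck 1 setT f ->
  (forall p, f p != 0 -> `|p.1| <= B /\ `|p.2| <= B) ->
  (forall p, f p != 0 -> exists s w,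
    [/\ s \in `]a, b[, `|w| <= rho' & p = gam s + w *: ((1, c) : R * R)]) ->
  (forall s w, s \in `]a, b[ -> `|w| < rho ->
    Omega (gam s + w *: ((1, c) : R * R)) <-> sigma * w < 0) ->
  open U -> (forall s, s \in `[a, b] -> U s) -> Ck 1 U gam ->
  (forall s, s \in `[a, b] -> 0 < sigma * cross (1, c) (derive1 gam s)) ->
  \int[mu2]_(p in Omega) 'D_((1, c) : R * R) f p =
  \int[mu]_(s in `[a, b]) (f (gam s) * cross (1, c) (derive1 gam s)).
Proof.
move=> ab oO sig rr Cf fB fsupp side oU abU /Ck1P[cgam dgam] mono.
have [cf df] := (Ck1P _ _).1 Cf.
have cfT : continuous f by move=> x; exact: cf.
have cD : continuous ('D_((1, c) : R * R) f) by move=> x; exact: (df _ x I).2.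
have csh : continuous (shear c).
  move=> p; apply: continuous_pair; first exact: continuous_fst.
  apply: continuousD_fun; first exact: continuous_snd.
  by apply: continuousM_fun; [exact: continuous_cst|exact: continuous_fst].
have shE (h : R) p : shear c (h *: e1 + p) = h *: ((1, c) : R * R) + shear c p.
  apply: injective_projections => /=; first by [].
  by rewrite /GRing.scale/=; ring.
pose F := f \o shear c.
have quotE p : (fun h : R => h^-1 *: (F (h *: e1 + p) - F p)) =
    (fun h => h^-1 *: (f (h *: ((1, c) : R * R) + shear c p) - f (shear c p))).
  by apply/funext => h; rewrite /F /= shE.
have dF p : derivable F p e1.
  by rewrite /derivable quotE; exact: (df _ (shear c p) I).1.
have DF : 'D_e1 F = 'D_((1, c) : R * R) f \o shear c.
  by apply/funext => p; rewrite /derive quotE.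
have cDF : continuous ('D_e1 F).
  by rewrite DF => p; apply: continuous_comp; [exact: csh|exact: cD].
(* [(g1, g2)] is the preimage of the arc under the shear. The derivative of [g2] is
   [cross (1, c) (derive1 gam s)], so transversality of [(1, c)] becomes monotonicity of [g2]. *)
pose g1 s := (gam s).1; pose g2 s := (gam s).2 - c * g1 s.
have dg : forall s, U s -> is_derive s 1 g2 (cross (1, c) (derive1 gam s)).
  move=> s Us; have D := derivableP (dgam 1 s Us).1.
  have D1 := is_derive_fst D; have D2 := is_derive_snd D.
  have -> : cross (1, c) (derive1 gam s) = ('D_1 gam s).2 + - c * ('D_1 gam s).1.
    by rewrite /cross /= derive1E; ring.
  have D3 := is_deriveM_fun (is_derive_cst (- c) s 1) D1.
  rewrite mulr0 addr0 in D3.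
  have -> : g2 = (fun s => (gam s).2 + - c * (gam s).1).
    by apply/funext => z; rewrite /g2 mulNr.
  exact: is_deriveD_fun D2 D3.
have dgE s : U s -> cross (1, c) (derive1 gam s) = derive1 g2 s.
  by move=> Us; rewrite [RHS]derive1E; exact: (esym (@derive_val _ _ _ _ _ _ _ (dg s Us))).
have cdg : forall s, s \in `[a, b] -> {for s, continuous (derive1 g2)}.
  move=> s /abU Us; apply: (near_continuous_eq oU Us dgE).
  have -> : (fun s => cross (1, c) (derive1 gam s)) =
      (fun s => ('D_1 gam s).2 + - c * ('D_1 gam s).1).
    by apply/funext => z; rewrite /cross/= derive1E; ring.
  have cD1 := (dgam 1 s Us).2.
  apply: continuousD_fun; first exact: continuous_snd_at.
  by apply: continuousM_fun; [exact: continuous_cst|exact: continuous_fst_at].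
have FB p : F p != 0 -> `|p.1| <= B * (1 + `|c|) /\ `|p.2| <= B * (1 + `|c|).
  move=> /fB[/= p1 p2].
  have c0 : 0 <= `|c| by [].
  have B0 : 0 <= B by exact: le_trans p1.
  split; first by nra.
  have -> : p.2 = (p.2 + c * p.1) - c * p.1 by ring.
  apply: le_trans (ler_normB _ _) _; rewrite normrM; nra.
have -> : \int[mu2]_(p in Omega) 'D_((1, c) : R * R) f p =
    \int[mu2]_(p in shear c @^-1` Omega) 'D_e1 F p.
  rewrite DF; apply: Rintegral2_shear.
  - exact: open2_measurable.
  - rewrite -DF; apply: integrable2_supp cDF _; last exact: derive_supp FB.
    by apply: open_comp => // z _; exact: csh.
  - by apply: open2_measurable_fun; [exact: openT|move=> x _; exact: cD].
have E s w : (gam s + w *: ((1, c) : R * R)) = shear c (g1 s + w, g2 s).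
  by apply: injective_projections => /=; rewrite /GRing.scale/= /g1 /g2; ring.
rewrite (@horizontal_formula F (shear c @^-1` Omega) g1 g2 a b rho rho' sigma _ ab _ sig rr _ dF cDF FB).
- apply: eq_Rintegral => s /set_mem/abU/dgE <-; congr (f _ * _).
  by have := E s 0; rewrite scale0r !addr0.
- by apply: open_comp => // z _; exact: csh.
- by move=> z; apply: continuous_comp; [exact: csh|exact: cfT].
- move=> [x y] /fsupp[s [w [sab wr]]]; rewrite E => -[Ex Ey].
  exists s; split=> //=; first by rewrite Ex addrC addKr.
  by move: Ey; rewrite Ex => /addIr.
- by move=> s w sab wr; rewrite /preimage/= -E; exact: side.
- by move=> s /abU Us; apply: continuous_fst_at; exact: cgam.
- by move=> s /abU /dg[].
- exact: cdg.
- by move=> s sab; rewrite -dgE; [exact: mono|exact: abU].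
Qed.

End horizontal_slices.

(** * Charts of the domain at regular boundary points *)

Section plane_geometry.
Context {R : realType}.
Implicit Types (p q d : R * R).

Lemma is_derive_cross (gam : R -> R * R) d (s : R) (dg : R * R) :
  is_derive s 1 gam dg -> is_derive s 1 (fun z => cross d (gam z)) (cross d dg).
Proof.
move=> D; have D1 := is_derive_fst D; have D2 := is_derive_snd D.
have D3 := is_deriveM_fun (is_derive_cst d.1 s 1) D2.
have D4 := is_deriveM_fun (is_derive_cst (- d.2) s 1) D1.
rewrite mulr0 addr0 in D3; rewrite mulr0 addr0 in D4.
have -> : cross d dg = d.1 * dg.2 + - d.2 * dg.1 by rewrite /cross mulNr.
have -> : (fun z => cross d (gam z)) = (fun z => d.1 * (gam z).2 + - d.2 * (gam z).1).
  by apply/funext => z; rewrite /cross mulNr.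
exact: is_deriveD_fun D3 D4.
Qed.

Lemma continuous_cross {T : topologicalType} (g : T -> R * R) d (x : T) :
  {for x, continuous g} -> {for x, continuous (fun z => cross d (g z))}.
Proof.
move=> cg.
have c2 := continuousM_fun (@continuous_cst T R d.1 x) (continuous_snd_at cg).
have c1 := continuousM_fun (@continuous_cst T R (- d.2) x) (continuous_fst_at cg).
have -> : (fun z => cross d (g z)) = (fun z => d.1 * (g z).2 + - d.2 * (g z).1).
  by apply/funext => z; rewrite /cross mulNr.
exact: continuousD_fun c2 c1.
Qed.

Lemma crossD d p q : cross d (p + q) = cross d p + cross d q.
Proof. by rewrite /cross/=; ring. Qed.

Lemma crossB d p q : cross d (p - q) = cross d p - cross d q.
Proof. by rewrite /cross/=; ring. Qed.

Lemma crossZ d (w : R) p : cross d (w *: p) = w * cross d p.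
Proof. by rewrite /cross/= /GRing.scale/=; ring. Qed.

Lemma crossvv d : cross d d = 0.
Proof. by rewrite /cross; ring. Qed.

Lemma unit_normal (v : R * R) : v != 0 ->
  let nu := (Num.sqrt (sqnorm v))^-1 *: (v.2, - v.1) : R * R in
  [/\ 0 < Num.sqrt (sqnorm v), cross v nu = - Num.sqrt (sqnorm v),
      dotp nu nu = 1 & `|nu.1| <= 1 /\ `|nu.2| <= 1].
Proof.
move=> v0 nu; rewrite /nu; set r := Num.sqrt _.
have sv0 : 0 < sqnorm v.
  rewrite /sqnorm /dotp -!expr2.
  have [v1|v1] := eqVneq v.1 0; last by rewrite ltr_pwDl ?sqr_ge0// exprn_even_gt0.
  rewrite ltr_wpDl ?sqr_ge0// exprn_even_gt0//.
  by apply: contraNneq v0 => v2; apply/eqP; apply: injective_projections.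
have r0 : 0 < r by rewrite sqrtr_gt0.
have rE : r ^+ 2 = sqnorm v by rewrite sqr_sqrtr// ltW.
have nn : dotp nu nu = 1.
  have -> : dotp nu nu = (r^-1) ^+ 2 * sqnorm v.
    by rewrite /nu /sqnorm /dotp/= /GRing.scale/= /r; ring.
  by rewrite -rE -exprMn mulVf ?expr1n// gt_eqF.
split=> //.
  have -> : cross v (r^-1 *: (v.2, - v.1)) = - (r^-1 * sqnorm v).
    by rewrite /cross/= /GRing.scale/= /sqnorm /dotp; ring.
  by rewrite -rE expr2 mulrA mulVf ?mul1r// gt_eqF.
have sq1 (y : R) : y ^+ 2 <= 1 -> `|y| <= 1.
  by move=> y1; rewrite -(@ler_pXn2r _ 2)// ?nnegrE// expr1n real_normK ?num_real.
by move: nn; rewrite /dotp -!expr2 => nn; split; apply: sq1; rewrite -nn ?lerDl ?lerDr sqr_ge0.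
Qed.

Lemma convex_gt (lo y z t : R) : 0 <= t <= 1 -> lo < y -> lo < z -> lo < y + t * (z - y).
Proof.
move=> /andP[t0 t1] ly lz; rewrite -subr_gt0.
have -> : y + t * (z - y) - lo = (1 - t) * (y - lo) + t * (z - lo) by ring.
have [<-|] := eqVneq 0 t; first by rewrite subr0 mul1r mul0r addr0 subr_gt0.
rewrite eq_sym => tn0.
by rewrite ltr_wpDl ?mulr_ge0 ?mulr_gt0 ?subr_ge0 ?subr_gt0 ?(ltW ly)// lt_neqAle eq_sym tn0.
Qed.

Lemma convex_lt (hi y z t : R) : 0 <= t <= 1 -> y < hi -> z < hi -> y + t * (z - y) < hi.
Proof.
move=> t01 yh zh; rewrite -ltrN2.
have -> : - (y + t * (z - y)) = - y + t * (- z - - y) by ring.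
by apply: convex_gt => //; rewrite ltrN2.
Qed.

(** Off the boundary [Omega] and its closure coincide, so [C] meets [Omega] in a set that is both
    open and closed in [C]. *)
Lemma connected_avoid (Omega C : set (R * R)) : open Omega -> connected C ->
  (forall p, C p -> ~ boundary Omega p) -> (exists2 p, C p & Omega p) -> C `<=` Omega.
Proof.
move=> oO cC Cb [p Cp Op].
have -> : C = C `&` Omega; last by move=> q [].
apply/esym; apply: cC.
- by exists p.
- by exists Omega.
- exists (closure Omega); first exact: closed_closure.
  apply/seteqP; split=> q [Cq Oq]; split=> //; first exact: subset_closure.
  apply: contrapT => nO; apply: (Cb q Cq); split=> //.
  by move=> /interior_subset.
Qed.

Lemma path_avoid (Omega : set (R * R)) (h : R -> R * R) : open Omega ->
  (forall t, t \in `[0, 1] -> {for t, continuous h}) ->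
  (forall t, t \in `[0, 1] -> ~ boundary Omega (h t)) -> Omega (h 0) -> Omega (h 1).
Proof.
move=> oO ch hb h0.
have i0 : (0 : R) \in `[0, 1] by rewrite in_itv/= lexx ler01.
have i1 : (1 : R) \in `[0, 1] by rewrite in_itv/= lexx ler01.
have cC : connected (h @` `[0, 1]).
  apply: connected_continuous_connected; first exact: segment_connected.
  by apply: continuous_in_subspaceT => t /set_mem; exact: ch.
apply: (connected_avoid oO cC).
- by move=> _ [t t01 <-]; exact: hb.
- by exists (h 0) => //; exists 0.
- by exists 1.
Qed.

Lemma MVT_between (F dF : R -> R) (x y : R) :
  (forall z, z \in `[Num.min x y, Num.max x y] -> is_derive z 1 F (dF z)) ->
  exists2 z, z \in `[Num.min x y, Num.max x y] & F y - F x = dF z * (y - x).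
Proof.
have H (a b : R) : a <= b -> (forall z, z \in `[a, b] -> is_derive z 1 F (dF z)) ->
    exists2 z, z \in `[a, b] & F b - F a = dF z * (b - a).
  move=> ab D.
  have c : {within `[a, b], continuous F}.
    by apply: derivable_within_continuous => z /D[].
  exact: (MVT_segment ab (fun z zab => D z (subset_itv_oo_cc zab)) c).
have [xy|yx] := leP x y; first exact: H.
move=> D; have [z zxy E] := H y x (ltW yx) D.
by exists z => //; rewrite -[LHS]opprB E -mulrN opprB.
Qed.

End plane_geometry.

Section regular_point.
Context {R : realType}.
Variables (Omega : set (R * R)) (N : nat) (gam : 'I_N -> R -> R * R) (n : R * R -> R * R).
Hypothesis oO : open Omega.
Hypothesis bO : piecewise_C1_boundary Omega gam n.

Lemma boundary_gam k s : s \in `[0, 1] -> boundary Omega (gam k s).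
Proof. by have [_ _ _ -> _] := bO; move=> s01; exists k => //; exists s. Qed.

Lemma boundary_notin p : boundary Omega p -> ~ Omega p.
Proof. by move=> [_ nI] Op; apply: nI; exact: open_nbhs_nbhs. Qed.

Lemma gam_continuous k s : s \in `[0, 1] -> {for s, continuous (gam k)}.
Proof.
have [/(_ k)[U [oU sU /Ck1P[cg _]]] _ _ _ _] := bO.
by move=> s01; apply: cg; exact: sU.
Qed.

(** The other arcs and the part of the arc [k] outside []a0, b0[] form a compact set. It misses
    [gam k s0], since arcs can only meet at end points, hence it stays at a positive distance. *)
Lemma away_from_rest k s0 (a0 b0 : R) : s0 \in `]0, 1[ -> a0 < s0 < b0 ->
  exists2 delta : R, 0 < delta & forall l s, s \in `[0, 1] ->
    ball (gam k s0) delta (gam l s) -> l = k /\ a0 < s < b0.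
Proof.
move=> s01 /andP[a0s s0b].
pose S l := [set s : R | s \in `[0, 1] /\ (l <> k \/ s <= a0 \/ b0 <= s)].
have cS l : compact (S l).
  have cl : closed (S l).
    have -> : S l = `[0, 1]%classic `&`
        ([set _ | l <> k] `|` ([set s | s <= a0] `|` [set s | b0 <= s])) by [].
    apply: closedI; first exact: interval_closed.
    apply: closedU; last by apply: closedU; [exact: closed_le|exact: closed_ge].
    have [->|lk] := eqVneq l k.
      by have -> : [set _ : R | k <> k] = set0; [rewrite -subset0 => x /=|exact: closed0].
    have -> : [set _ : R | l <> k] = setT; last exact: closedT.
    by apply/seteqP; split=> // x _ /=; exact/eqP.
  by apply: (subclosed_compact cl (@segment_compact R 0 1)) => s [].
have cI l : closed (gam l @` S l).
  apply: compact_closed; first exact: norm_hausdorff.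
  apply: continuous_compact => //.
  by apply: continuous_in_subspaceT => s /set_mem[s01' _]; exact: gam_continuous.
have nx l : \forall p \near gam k s0, ~ (gam l @` S l) p.
  apply: open_nbhs_nbhs; split; first exact: closed_openC.
  move=> [s [s01' C] E]; have [_ _ inj _ _] := bO.
  have [lk ss] := inj l k s s0 s01' s01 E.
  by move: C; rewrite ss lk => -[//|[]]; rewrite leNgt ?a0s ?s0b.
have /nbhs_ballP[delta /= d0 Hd] : \forall p \near gam k s0, forall l, ~ (gam l @` S l) p.
  exact: (@filter_forall _ _ _ (nbhs (gam k s0)) _ nx).
exists delta => // l s s01' /Hd/(_ l) nS.
have [lk|/eqP lk] := eqVneq l k; last by exfalso; apply: nS; exists s => //; split=> //; left.
split=> //; apply/andP; split; rewrite ltNge; apply/negP => C; apply: nS; exists s => //; split=> //; right; [left|right]; exact: C.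
Qed.

End regular_point.

(* [p] is written [gam s + w d]: [cross d] determines [s], and [w] is small. By
   connectedness each of the half charts [w < 0], [w > 0] lies in [Omega] or
   avoids it; the points [gam s0 -+ tau n] tell which. *)
Lemma regular_chart {R : realType} (Omega : set (R * R)) (N : nat)
    (gam : 'I_N -> R -> R * R) (n : R * R -> R * R) (k : 'I_N) (s0 c : R) :
  open Omega -> piecewise_C1_boundary Omega gam n -> s0 \in `]0, 1[ -> `|c| <= 1 ->
  cross (1, c) (derive1 (gam k) s0) != 0 ->
  let d := (1, c) : R * R in
  exists sigma a b rho rho' r : R,
  [/\ [/\ sigma = 1 \/ sigma = -1, 0 < a < b, b < 1, rho' < rho & 0 < r],
     forall s, s \in `[a, b] -> 0 < sigma * cross d (derive1 (gam k) s),
     forall s w, s \in `]a, b[ -> `|w| < rho ->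
       Omega (gam k s + w *: d) <-> sigma * w < 0,
     forall p, ball (gam k s0) r p ->
       exists s w, [/\ s \in `]a, b[, `|w| <= rho' & p = gam k s + w *: d] &
     forall l s, s \in `[0, 1] -> ball (gam k s0) r (gam l s) -> l = k /\ s \in `]a, b[].
Proof.
move=> oO bO s01 c1 kap0 d.
have [/(_ k)[U [oU sU Cg]] dg0 inj bE /(_ k s0 s01)[nE near_n]] := bO.
have [cg dgam] := (Ck1P _ _).1 Cg.
set v := derive1 (gam k) s0 in nE kap0.
pose x := gam k s0.
have s01c : s0 \in `[0, 1] by exact: subset_itv_oo_cc.
have Us0 : U s0 by exact: sU.
have v0 : v != 0 by exact: dg0.
have dgamE (e : R * R) s : U s ->
    is_derive s 1 (fun z => cross e (gam k z)) (cross e (derive1 (gam k) s)).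
  by move=> Us; apply: is_derive_cross; rewrite derive1E; exact/derivableP/(dgam 1 s Us).1.
have cder (e : R * R) : {for s0, continuous (fun s => cross e (derive1 (gam k) s))}.
  apply: continuous_cross.
  have -> : derive1 (gam k) = (fun s => 'D_1 (gam k) s).
    by apply/funext => z; rewrite derive1E.
  exact: (dgam 1 s0 Us0).2.
pose kap := cross d v.
pose sigma : R := if 0 < kap then 1 else -1.
have sig : sigma = 1 \/ sigma = -1 by rewrite /sigma; case: ifP; [left|right].
have sk : sigma * kap = `|kap|.
  rewrite /sigma; have [k0|k0] := ltP 0 kap; first by rewrite mul1r gtr0_norm.
  by rewrite mulN1r ler0_norm.
(* Half the transversal speed at [s0]: by continuity it bounds the transversal speed from below near
   [s0]. *)
pose m := `|kap| / 2.
have m0 : 0 < m by rewrite divr_gt0 ?normr_gt0.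
pose nv := Num.sqrt (sqnorm v).
have [nv0 cnv _ [n1 n2]] := unit_normal v0.
rewrite -[Num.sqrt _]/nv -nE -/x in nv0 cnv n1 n2.
(* Chosen so that, in [sign_w] below, the drift of the arc away from its tangent takes up at most
   half of the normal displacement [theta * nv]. *)
pose eps := nv * m / 4.
have eps0 : 0 < eps by rewrite /eps divr_gt0// mulr_gt0.
have [e0 /= e00 He0] : exists2 e : R, 0 < e & forall s, `|s0 - s| < e ->
   [/\ 0 < s < 1, m < sigma * cross d (derive1 (gam k) s) &
     `|cross v (derive1 (gam k) s)| < eps].
  have A : \forall s \near s0, s \in `]0, 1[.
    by apply: open_nbhs_nbhs; split => //; exact: interval_open.
  have cB : {for s0, continuous (fun s => sigma * cross d (derive1 (gam k) s))}.
    by apply: continuousM_fun; [exact: continuous_cst|exact: cder].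
  have B : \forall s \near s0, m < sigma * cross d (derive1 (gam k) s).
    apply: (cvgr_gt _ cB); rewrite -/v -/kap sk /m ltr_pdivrMr//.
    by rewrite ltr_pMr ?normr_gt0// ltr1n.
  have C : \forall s \near s0, `|cross v (derive1 (gam k) s)| < eps.
    apply: (cvgr_lt _ (continuous_norm_at (cder v))).
    by rewrite -/v crossvv normr0.
  have [e /= e0 He] := (nbhs_ballP _ _).1 (filterI A (filterI B C)).
  by exists e => // s /He[+ []]; rewrite in_itv.
pose a0 := s0 - e0 / 2; pose b0 := s0 + e0 / 2.
have [delta delta0 Hdel] : exists2 delta : R, 0 < delta & forall l s, s \in `[0, 1] ->
    ball (gam k s0) delta (gam l s) -> l = k /\ a0 < s < b0.
  by apply: (away_from_rest bO) => //; rewrite /a0 /b0; apply/andP; split; clear - e00; lra.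
have [e1 /= e10 He1] : exists2 e : R, 0 < e & forall s, `|s0 - s| < e -> ball x (delta / 4) (gam k s).
  have /cvg_ballP/(_ (delta / 4)) := cg s0 Us0.
  rewrite divr_gt0// => /(_ isT) /nbhs_ballP[e e0' He]; exists e => // s /He//.
(* [h <= e0 / 4] places [[a, b]] inside []a0, b0[], where [G] is injective; [h <= e1 / 2] keeps the
   arc over [[a, b]] within [delta / 4] of [x]. *)
pose h := Num.min (e0 / 4) (e1 / 2).
have h0 : 0 < h by rewrite lt_min !divr_gt0.
have he0 : h <= e0 / 4 by rewrite ge_min lexx.
have he1 : h <= e1 / 2 by rewrite ge_min lexx orbT.
pose a := s0 - h; pose b := s0 + h.
have abP s : s \in `[a, b] -> `|s0 - s| <= h.
  by rewrite in_itv/= /a /b -ler_distlC.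
have He0' s : s \in `[a, b] -> [/\ 0 < s < 1, m < sigma * cross d (derive1 (gam k) s) &
     `|cross v (derive1 (gam k) s)| < eps].
  by move=> /abP sh; apply: He0; clear - sh he0 e00 h0; lra.
have U01 s : 0 < s < 1 -> U s.
  by move=> /andP[? ?]; apply: sU; rewrite /= in_itv/= !ltW.
have abgam s : s \in `[a, b] -> ball x (delta / 4) (gam k s).
  by move=> /abP sh; apply: He1; clear - sh he1 e10 h0; lra.
pose G s := cross d (gam k s).
have G_inj s s' : a0 < s < b0 -> a0 < s' < b0 -> G s = G s' -> s = s'.
  move=> /andP[sa sb] /andP[s'a s'b] E.
  have sub z : z \in `[Num.min s s', Num.max s s'] -> `|s0 - z| < e0.
    rewrite in_itv/= ge_min le_max => /andP[z1 z2].
    have : a0 < z < b0.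
      apply/andP; split.
        by case/orP: z1; [exact: lt_le_trans|exact: lt_le_trans].
      by case/orP: z2 => ?; [exact: le_lt_trans sb|exact: le_lt_trans s'b].
    by rewrite /a0 /b0 -ltr_distlC => /lt_trans; apply; clear - e00; lra.
  have [|z zss EE] := @MVT_between _ G (fun z => cross d (derive1 (gam k) z)) s s'.
    by move=> z /sub /He0[z01 _ _]; apply: dgamE; exact: U01.
  move: EE; rewrite E subrr => /esym/eqP; rewrite mulf_eq0 => /orP[/eqP zz|]; last by rewrite subr_eq0 => /eqP.
  have [_ mm _] := He0 _ (sub _ zss).
  by rewrite zz mulr0 ltNge ltW in mm.
have incl s : s \in `]a, b[ -> s \in `[a, b] by exact: subset_itv_oo_cc.
have ab_ab0 s : s \in `[a, b] -> a0 < s < b0.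
  by move=> /abP; rewrite ler_distlC /a0 /b0 => /andP[as1 as2]; apply/andP; split; clear - as1 as2 he0 e00; lra.
have s0ab : s0 \in `[a, b] by rewrite in_itv/= /a /b; apply/andP; split; clear - h0; lra.
have dist_ab s t z : s \in `[a, b] -> t \in `[a, b] ->
    z \in `[Num.min s t, Num.max s t] -> z \in `[a, b].
  rewrite !in_itv/= ge_min le_max => /andP[? ?] /andP[? ?] /andP[z1 z2].
  apply/andP; split.
    by case/orP: z1; exact: le_trans.
  by case/orP: z2 => /le_trans; apply.
have MVTab (e : R * R) s t : s \in `[a, b] -> t \in `[a, b] -> exists2 z, z \in `[a, b] &
    cross e (gam k t - gam k s) = cross e (derive1 (gam k) z) * (t - s).
  move=> sab tab.
  have [|z zst E] := @MVT_between _ (fun z => cross e (gam k z))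
      (fun z => cross e (derive1 (gam k) z)) s t.
    by move=> z /(dist_ab _ _ _ sab tab)/He0'[z01 _ _]; apply: dgamE; exact: U01.
  by exists z; [exact: dist_ab zst|rewrite crossB].
(* Since the arc stays within [delta / 4] of [x], the chart [|w| < delta / 2] stays in the ball of
   radius [delta]. A point within [delta / 8] of [x] has [|w| <= delta / 4 + delta / 8], which is
   [rho']. The bound [m * h / 2] on [r] keeps [cross d p] strictly between [G a] and [G b]. *)
pose rho := delta / 2; pose rho' := 3 / 8 * delta.
pose r := Num.min (delta / 8) (m * h / 2).
have r0 : 0 < r by rewrite lt_min !divr_gt0// mulr_gt0.
have rd : r <= delta / 8 by rewrite ge_min lexx.
have rm : r <= m * h / 2 by rewrite ge_min lexx orbT.
pose Phi s w := gam k s + w *: d.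
have GPhi s w : cross d (Phi s w) = G s by rewrite /Phi crossD crossZ crossvv mulr0 addr0.
have Phi_ball s w : s \in `[a, b] -> `|w| < rho -> ball x delta (Phi s w).
  move=> /abgam[B1 B2] wr; rewrite -ball_normE/= in B1; rewrite -ball_normE/= in B2.
  have cw : `|w * c| <= `|w| by rewrite normrM ler_piMr.
  split; rewrite -ball_normE/= /GRing.scale/=.
    rewrite mulr1 opprD addrA; apply: le_lt_trans (ler_normB _ _) _.
    by rewrite /rho in wr; clear - wr B1 B2 cw delta0; lra.
  rewrite opprD addrA; apply: le_lt_trans (ler_normB _ _) _.
  by rewrite /rho in wr; clear - wr B1 B2 cw delta0; lra.
(* By [Hdel] such a boundary point is [gam k s'] with [s'] in []a0, b0[]. It has the same [cross d]
   as [gam k s], so [s' = s] by injectivity of [G], and nothing is left for [w]. *)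
have Phi_bd s w : s \in `]a, b[ -> `|w| < rho -> boundary Omega (Phi s w) -> w = 0.
  move=> sab wr; rewrite bE => -[l _ [s' s'01 E]].
  have := Hdel l s' s'01; rewrite E => /(_ (Phi_ball s w (incl s sab) wr))[lk s'ab].
  have ss : s' = s.
    by apply: G_inj => //; [exact/ab_ab0/incl|rewrite -(GPhi s w) -E lk].
  move: E; rewrite lk ss /Phi -{1}[gam k s]addr0 => /addrI/(congr1 fst)/=.
  by rewrite /GRing.scale/= mulr1 => <-.
(* Interpolating [s] and [w] linearly keeps the sign of [w], so by [Phi_bd] the path never meets the
   boundary. *)
have side_same s w s' w' : s \in `]a, b[ -> s' \in `]a, b[ -> `|w| < rho -> `|w'| < rho ->
    0 < w * w' -> Omega (Phi s w) -> Omega (Phi s' w').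
  move=> sab s'ab wr w'r ww Op.
  pose hs (t : R) := s + t * (s' - s); pose hw (t : R) := w + t * (w' - w).
  have hsab t : t \in `[0, 1] -> hs t \in `]a, b[.
    rewrite in_itv/= => t01; move: sab s'ab.
    rewrite !in_itv/= => /andP[? ?] /andP[? ?]; apply/andP.
    by split; [exact: convex_gt|exact: convex_lt].
  have hwr t : t \in `[0, 1] -> `|hw t| < rho.
    rewrite in_itv/= => t01; move: wr w'r.
    rewrite !ltr_norml => /andP[? ?] /andP[? ?]; apply/andP.
    by split; [exact: convex_gt|exact: convex_lt].
  have hw0 t : t \in `[0, 1] -> hw t != 0.
    rewrite in_itv/= => t01; have : 0 < w * w + t * (w * w' - w * w).
      apply: convex_gt => //; rewrite -expr2 exprn_even_gt0//.
      by apply: contraTneq ww => ->; rewrite mul0r ltxx.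
    apply: contraTneq => hz.
    by rewrite -mulrBr mulrCA -mulrDr -/(hw t) hz mulr0 ltxx.
  have -> : Phi s' w' = Phi (hs 1) (hw 1) by rewrite /hs /hw !mul1r !subrKC.
  apply: (@path_avoid _ Omega (fun t => Phi (hs t) (hw t)) oO).
  - move=> t t01.
    have caff (u z : R) : {for t, continuous (fun t' : R => u + t' * z)}.
      by apply: continuousD_fun; [exact: continuous_cst|
        apply: continuousM_fun; [exact: continuous_at_id|exact: continuous_cst]].
    have c1' : {for t, continuous (fun t => gam k (hs t))}.
      apply: (@continuous_comp_at _ _ _ hs (gam k)); first exact: caff.
      by have /incl/He0'[? _ _] := hsab t t01; exact/cg/U01.
    have c2' : {for t, continuous (fun t => hw t *: d)}.
      by apply: (@continuous_comp_at _ _ _ hw (fun w => w *: d)); [exact: caff|exact: scalel_continuous].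
    exact: (cvgD c1' c2').
  - move=> t t01 /(Phi_bd _ _ (hsab t t01) (hwr t t01))/eqP.
    by rewrite (negbTE (hw0 t t01)).
  - by rewrite /hs /hw !mul0r !addr0.
have Gdist s t : s \in `[a, b] -> t \in `[a, b] -> m * `|t - s| <= `|G t - G s|.
  move=> sab tab; have [z /He0'[_ mz _] E] := MVTab d s t sab tab.
  rewrite /G -crossB E normrM ler_wpM2r//; apply: le_trans (ltW mz) _.
  apply: le_trans (ler_norm _) _; rewrite normrM.
  by case: sig => ->; rewrite ?normrN normr1 mul1r.
have dcross p : `|cross d p| <= `|p.1| + `|p.2|.
  rewrite /cross /d/= mul1r; apply: le_trans (ler_normB _ _) _.
  by rewrite addrC lerD2r normrM ler_piMl.
have aab : a \in `[a, b] by rewrite in_itv/= lexx /a /b; clear - h0; lra.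
have bab : b \in `[a, b] by rewrite in_itv/= lexx /a /b andbT; clear - h0; lra.
have Gcont : {within `[a, b], continuous G}.
  apply: derivable_within_continuous => s /He0'[s01' _ _].
  by have [] := dgamE d s (U01 _ s01').
have Gsign s t : s \in `[a, b] -> t \in `[a, b] -> s < t -> sigma * G s < sigma * G t.
  move=> sab tab st; have [z /He0'[_ mz _] E] := MVTab d s t sab tab.
  rewrite -subr_gt0 -mulrBr /G -crossB E mulrA mulr_gt0 ?subr_gt0//.
  exact: lt_trans mz.
(* The intermediate value theorem for [G] finds the [s] with [cross d (gam k s) = cross d p]; then
   [p - gam k s] is parallel to [d], whose first coordinate is 1, so [w] is read off the first
   coordinate. *)
have cover p : ball x r p ->
    exists s w, [/\ s \in `]a, b[, `|w| <= rho' & p = Phi s w].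
  move=> [p1 p2]; rewrite -ball_normE/= in p1; rewrite -ball_normE/= in p2.
  have dp : `|cross d p - G s0| < m * h.
    rewrite /G -crossB; apply: le_lt_trans (dcross _) _.
    by rewrite /= -(distrC x.1) -(distrC x.2); clear - p1 p2 rm; lra.
  have la : m * h <= `|G s0 - G a|.
    by apply: le_trans (Gdist a s0 aab s0ab); rewrite /a subKr ger0_norm// ltW.
  have lb : m * h <= `|G b - G s0|.
    by apply: le_trans (Gdist s0 b s0ab bab); rewrite /b addrC addKr ger0_norm// ltW.
  have as0 : a < s0 by rewrite /a; clear - h0; lra.
  have s0b : s0 < b by rewrite /b; clear - h0; lra.
  have ltab : Num.min (G a) (G b) <= cross d p <= Num.max (G a) (G b) /\
      cross d p != G a /\ cross d p != G b.
    have := Gsign _ _ aab s0ab as0; have := Gsign _ _ s0ab bab s0b.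
    rewrite ge_min le_max; move: dp; rewrite ltr_norml => /andP[dp1 dp2].
    case: sig => ->; rewrite ?mul1r ?mulN1r ?ltrN2 => G1 G2.
      rewrite ger0_norm ?subr_ge0 ?(ltW G2)// in la.
      rewrite ger0_norm ?subr_ge0 ?(ltW G1)// in lb.
      have ? : G a < cross d p by clear - dp1 dp2 la; lra.
      have ? : cross d p < G b by clear - dp1 dp2 lb; lra.
      split; last by rewrite gt_eqF// lt_eqF.
      by apply/andP; split; apply/orP; [left|right]; exact: ltW.
    rewrite ler0_norm ?subr_le0 ?(ltW G2)// in la.
    rewrite ler0_norm ?subr_le0 ?(ltW G1)// in lb.
    have ? : cross d p < G a by clear - dp1 dp2 la; lra.
    have ? : G b < cross d p by clear - dp1 dp2 lb; lra.
    split; last by rewrite lt_eqF// gt_eqF.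
    by apply/andP; split; apply/orP; [right|left]; exact: ltW.
  have [mm [na nb]] := ltab.
  have [|s sab Gs] := IVT (_ : a <= b) Gcont mm; first by rewrite ltW// (lt_trans as0).
  have sab' : s \in `]a, b[.
    move: sab; rewrite !in_itv/= !le_eqVlt => /andP[/orP[/eqP sa|->] /orP[/eqP sb|->]] //.
    - by rewrite -Gs sa eqxx in na.
    - by rewrite -Gs sa eqxx in na.
    - by rewrite -Gs sb eqxx in nb.
  exists s, (p.1 - (gam k s).1); split=> //.
    have [B1 _] := abgam _ sab; rewrite -ball_normE/= in B1.
    have -> : p.1 - (gam k s).1 = (x.1 - (gam k s).1) - (x.1 - p.1) by ring.
    apply: le_trans (ler_normB _ _) _; rewrite /rho'; clear - B1 p1 rd; lra.
  apply: injective_projections; rewrite /Phi /= /GRing.scale/=; first by ring.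
  by move: Gs; rewrite /G /cross /d/= => Gs; clear - Gs; lra.
(* Taking [cross v] of the equation gives [w * kap = theta * nv] plus the drift of the arc from its
   tangent; taking [cross d] bounds [s - s0] by a multiple of [theta], hence the drift by half of
   the main term. So [w * kap] has the sign of [theta]. *)
have sign_w theta s w : theta != 0 -> s \in `]a, b[ -> x + theta *: n x = Phi s w ->
    0 < theta * (sigma * w).
  move=> th0 /incl sab E.
  have E' : theta *: n x = gam k s - x + w *: d.
    by rewrite -addrAC -/(Phi s w) -E addrC addKr.
  have [z1 /He0'[_ _ z1e] E1] := MVTab v s0 s s0ab sab.
  have [z2 /He0'[_ z2e _] E2] := MVTab d s0 s s0ab sab.
  have F1 : w * kap = cross v (gam k s - x) + theta * nv.
    have := congr1 (cross v) E'; rewrite crossZ cnv crossD crossZ.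
    have -> : cross v d = - kap by rewrite /kap /cross; ring.
    by move=> EE; clear - EE; lra.
  have F2 : theta * cross d (n x) = cross d (gam k s - x).
    have := congr1 (cross d) E'; rewrite crossZ crossD crossZ.
    by rewrite crossvv mulr0 addr0.
  have L2 : m * `|s - s0| <= 2 * `|theta|.
    have : m * `|s - s0| <= `|cross d (gam k s - x)|.
      by have := Gdist s0 s s0ab sab; rewrite /G -crossB.
    move=> /le_trans; apply; rewrite -F2 normrM mulrC ler_wpM2r//.
    by apply: le_trans (dcross _) _; clear - n1 n2; lra.
  have L1 : `|cross v (gam k s - x)| <= nv / 2 * `|theta|.
    rewrite E1 normrM; apply: (@le_trans _ _ (eps * `|s - s0|)).
      by rewrite ler_wpM2r// ltW.
    rewrite /eps; have -> : nv * m / 4 * `|s - s0| = nv / 4 * (m * `|s - s0|) by ring.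
    have -> : nv / 2 * `|theta| = nv / 4 * (2 * `|theta|) by field.
    by rewrite ler_wpM2l// divr_ge0// ltW.
  have : 0 < theta * (w * kap).
    rewrite F1 mulrDr mulrA -expr2.
    have t2 : 0 < theta ^+ 2 by rewrite exprn_even_gt0.
    have : `|theta * cross v (gam k s - x)| <= nv / 2 * theta ^+ 2.
      rewrite normrM mulrC -(real_normK (num_real theta)) expr2 mulrA.
      by rewrite ler_wpM2r.
    by rewrite ler_norml => /andP[tl _]; clear - tl t2 nv0; nra.
  have -> : w * kap = (sigma * w) * (sigma * kap) by case: sig => ->; ring.
  by rewrite sk mulrA pmulr_lgt0// normr_gt0.
have [tau [tau0 tr Oin Oout]] : exists tau : R, [/\ 0 < tau, tau < r,
    Omega (x - tau *: n x) & ~ closure Omega (x + tau *: n x)].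
  suff /filter_ex[tau [[? ?] [? ?]]] : \forall tau \near 0^'+,
      (0 < tau /\ tau < r) /\ (Omega (x - tau *: n x) /\ ~ closure Omega (x + tau *: n x)).
    by exists tau.
  apply: filterI => //; apply: filterI; first exact: nbhs_right_gt.
  exact: nbhs_right_lt.
have xball theta : `|theta| = tau -> ball x r (x + theta *: n x).
  move=> tE; split; rewrite -ball_normE/= opprD addNKr normrN /GRing.scale/= normrM tE.
    by apply: le_lt_trans tr; rewrite ler_piMr// ltW.
  by apply: le_lt_trans tr; rewrite ler_piMr// ltW.
have rr : rho' < rho by rewrite /rho' /rho; clear - delta0; lra.
have tn : `|- tau| = tau by rewrite normrN gtr0_norm.
have [s1 [w1 [s1ab w1r E1]]] := cover _ (xball _ tn).
have [s2 [w2 [s2ab w2r E2]]] := cover _ (xball _ (gtr0_norm tau0)).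
have tau_neq0 : tau != 0 by rewrite gt_eqF.
have ntau_neq0 : - tau != 0 by rewrite lt_eqF// oppr_lt0.
have S1 := sign_w _ _ _ ntau_neq0 s1ab E1.
have S2 := sign_w _ _ _ tau_neq0 s2ab E2.
rewrite mulNr oppr_gt0 pmulr_rlt0// in S1; rewrite pmulr_rgt0// in S2.
have w1rho := le_lt_trans w1r rr; have w2rho := le_lt_trans w2r rr.
have sig2 (w w' : R) : w * w' = (sigma * w) * (sigma * w').
  by case: sig => ->; ring.
exists sigma, a, b, rho, rho', r; split=> //.
- split=> //; rewrite /a /b.
    by apply/andP; split; have [_ _] := He0' _ aab; have [/andP[]] := He0' _ aab;
       rewrite /a // => ? ? *; clear - h0; lra.
  by have [/andP[]] := He0' _ bab.
- by move=> s /He0'[_ ms _]; exact: lt_trans ms.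
- move=> s w sab wr; split=> [Op|sw].
    rewrite ltNge le_eqVlt; apply/negP => /orP[/eqP sw|sw].
      have w0 : w = 0 by clear - sig sw; case: sig sw => ->; lra.
      move: Op; rewrite w0 scale0r addr0; apply: boundary_notin => //.
      by apply: (boundary_gam bO); have [/andP[? ?] _ _] := He0' _ (incl _ sab); rewrite in_itv/= !ltW.
    apply: Oout; apply: subset_closure; rewrite E2.
    apply: (side_same s w) => //.
    by rewrite sig2 mulr_gt0.
  apply: (side_same s1 w1) => //; first by rewrite sig2 nmulr_rgt0.
  by rewrite -E1 scaleNr.
- move=> l s s01' /[dup] bs.
  have xd : ball x delta (gam l s).
    by apply: le_ball bs; apply: le_trans rd _; clear - delta0; lra.
  have [lk sab0] := Hdel l s s01' xd.
  move=> /cover[s' [w [s'ab wr E]]]; split=> //.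
  have w0 : w = 0.
    by apply: (Phi_bd s' w) => //; [exact: le_lt_trans rr|rewrite -E; exact: boundary_gam bO _ _ _].
  have s'01 : s' \in `]0, 1[ by have [/andP[? ?] _ _] := He0' _ (incl _ s'ab); rewrite in_itv/=; apply/andP.
  move: E; rewrite /Phi w0 scale0r addr0 => /(inj _ _ _ _ s01' s'01)[_ ->].
  exact: s'ab.
Qed.

(** * The chain rule and C^1 cutoff functions *)

Section chain.
Context {R : realType} {V : normedModType R}.

Lemma derive_scale (f : V -> R) (c : R) (v x : V) :
  derivable f x v -> 'D_(c *: v) f x = c * 'D_v f x.
Proof.
move=> d.
have E (w : V) : x = x + 0 *: w by rewrite scale0r addr0.
pose F (s : R) := f (x + s *: v).
have DF : is_derive (0 * c) 1 F ('D_v f x).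
  have dF : derivable F (0 * c) 1 by rewrite mul0r -derivable_line -E.
  apply: DeriveDef => //; rewrite mul0r -derive_line.
  by rewrite -E.
have dm : is_derive (0 : R) 1 (fun s : R => s * c) c.
  have := is_deriveM_fun (is_derive_id (0 : R) 1) (is_derive_cst c (0 : R) 1).
  by rewrite mulr0 add0r mulr1.
have D := @is_derive1_comp R F (fun s => s * c) 0 _ _ DF dm.
rewrite {1}(E (c *: v)) derive_line.
have -> : (fun s : R => f (x + s *: (c *: v))) = (fun s => F (s * c)).
  by apply/funext => s; rewrite /F /= scalerA.
by rewrite mulrC; exact: (@derive_val _ _ _ _ _ _ _ D).
Qed.

(** The one-variable chain rule on the line through [x] with direction [v]. *)
Lemma is_derive_comp_fun (f : V -> R) (g : R -> R) (dg : R) (v x : V) :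
  derivable f x v -> is_derive (f x) 1 g dg ->
  is_derive x v (fun y => g (f y)) (dg * 'D_v f x).
Proof.
move=> d Dg.
have E : x + 0 *: v = x by rewrite scale0r addr0.
pose F (s : R) := f (x + s *: v).
have DF : is_derive (0 : R) 1 F ('D_v f x).
  have dF : derivable F 0 1 by rewrite -derivable_line E.
  by apply: DeriveDef => //; rewrite -derive_line E.
have DgF : is_derive (F 0) 1 g dg by rewrite /F E.
have D := @is_derive1_comp R g F 0 _ _ DgF DF.
apply: DeriveDef.
  by rewrite -[X in derivable _ X]E derivable_line; case: D.
rewrite -[X in derive _ X]E derive_line.
exact: (@derive_val _ _ _ _ _ _ _ D).
Qed.

Lemma Ck1_comp (U : set V) (f : V -> R) (g dg : R -> R) : open U ->
  (forall y : R, is_derive y 1 g (dg y)) -> continuous dg -> Ck 1 U f ->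
  Ck 1 U (fun x => g (f x)).
Proof.
move=> oU Dg cdg /Ck1P[cf df]; apply/Ck1P.
have cg : continuous g.
  by move=> y; apply: differentiable_continuous; apply/derivable1_diffP; case: (Dg y).
split=> [x Ux|v x Ux]; first exact: (continuous_comp_at (cf x Ux) (cg _)).
have D y : U y -> is_derive y v (fun z => g (f z)) (dg (f y) * 'D_v f y).
  by move=> Uy; apply: is_derive_comp_fun => //; exact: (df v y Uy).1.
split; first by case: (D x Ux).
apply: (near_continuous_eq oU Ux (fun y Uy => esym (@derive_val _ _ _ _ _ _ _ (D y Uy)))).
apply: continuousM_fun; last exact: (df v x Ux).2.
exact: (continuous_comp_at (cf x Ux) (cdg _)).
Qed.

End chain.

Section plateau.
Context {R : realType}.

(** The square makes the positive part C^1 at 0, which is all the smoothness that the cutoffs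
    need. *)
Definition possq (y : R) : R := Num.max 0 y ^+ 2.

Lemma is_derive_possq (y : R) : is_derive y 1 possq (2 * Num.max 0 y).
Proof.
have [y0|y0|<-] := ltgtP 0 y.
- have E : \forall z \near y, z * z = possq z.
    have : \forall z \near y, 0 < z by apply: open_nbhs_nbhs; split => //; exact: open_gt.
    by apply: filterS => z z0; rewrite /possq max_r ?ltW// expr2.
  apply: (near_eq_is_derive E).
  have := is_deriveM_fun (is_derive_id y 1) (is_derive_id y 1).
  by rewrite mulr1 mulr2n mulrDl mul1r.
- have E : \forall z \near y, 0 = possq z.
    have : \forall z \near y, z < 0 by apply: open_nbhs_nbhs; split => //; exact: open_lt.
    by apply: filterS => z z0; rewrite /possq max_l ?ltW// expr0n.
  rewrite mulr0.
  exact: (@near_eq_is_derive R R R (fun=> 0) possq y 1 0 E (is_derive_cst (0 : R) y 1)).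
- have c : h^-1 *: (possq (h *: 1 + 0) - possq 0) @[h --> 0^'] --> 0.
    apply/cvgr0Pnorm_lt => e e0; near=> h.
    have hn : h != 0 by near: h; exact: nbhs_dnbhs_neq.
    have he : `|h| < e by near: h; apply: dnbhs0_lt.
    rewrite addr0 [h *: 1]mulr1 /possq maxxx expr0n subr0 /GRing.scale/=.
    apply: le_lt_trans he; rewrite normrM normfV ler_pdivrMl ?normr_gt0// -expr2.
    rewrite normrX lerXn2r ?nnegrE//.
    by rewrite ger0_norm ?le_max ?lexx// ge_max normr_ge0 ler_norm.
  rewrite mulr0; apply: DeriveDef; last exact: cvg_lim.
  by apply/cvg_ex; exists 0.
Unshelve. all: by end_near.
Qed.

Lemma continuous_dpossq : continuous (fun y : R => 2 * Num.max 0 y).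
Proof.
move=> y.
have c : {for y, continuous (fun z : R => Num.max 0 z)}.
  exact: (continuous_max (@continuous_cst R R 0 y) (@continuous_at_id R y)).
exact: (continuousM_fun (@continuous_cst R R 2 y) c).
Qed.

(** For [|t| >= 1] the inner [possq] is 0 and the outer one is 1. For [|t| <= 1 / 2] the inner one
    is at least [9 / 16], so the factor 2 makes the argument of the outer one negative and the value
    is 1. *)
Definition hump (t : R) : R := 1 - possq (1 - 2 * possq (1 - t * t)).

Lemma hump_out t : 1 <= `|t| -> hump t = 0.
Proof.
move=> t1; have tt : 1 - t * t <= 0.
  by rewrite subr_le0 -expr2 -real_normK ?num_real// exprn_ege1.
by rewrite /hump /possq (max_l tt) expr0n mulr0 subr0 max_r// expr1n subrr.
Qed.

Lemma hump_in t : `|t| <= 2^-1 -> hump t = 1.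
Proof.
move=> t1; have tt : t * t <= 4^-1.
  rewrite -expr2 -real_normK ?num_real//; apply: (@le_trans _ _ (2^-1 ^+ 2)).
    by rewrite lerXn2r ?nnegrE.
  by rewrite expr2; lra.
rewrite /hump /possq [Num.max 0 (1 - t * t)]max_r; last lra.
by rewrite max_l ?expr0n ?subr0//; nra.
Qed.

Lemma Ck1_coord1 (U : set (R * R)) : Ck 1 U (fun p : R * R => p.1).
Proof.
apply/Ck1P; split=> [x _|v x _]; first exact: continuous_fst.
have D (y : R * R) : is_derive y v (fun p : R * R => p.1) v.1.
  by have := is_derive_fst (is_derive_id y v).
split; first by case: (D x).
have -> : (fun y => 'D_v (fun p : R * R => p.1) y) = (fun=> v.1).
  by apply/funext => y; exact: (@derive_val _ _ _ _ _ _ _ (D y)).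
exact: continuous_cst.
Qed.

Lemma Ck1_coord2 (U : set (R * R)) : Ck 1 U (fun p : R * R => p.2).
Proof.
apply/Ck1P; split=> [x _|v x _]; first exact: continuous_snd.
have D (y : R * R) : is_derive y v (fun p : R * R => p.2) v.2.
  by have := is_derive_snd (is_derive_id y v).
split; first by case: (D x).
have -> : (fun y => 'D_v (fun p : R * R => p.2) y) = (fun=> v.2).
  by apply/funext => y; exact: (@derive_val _ _ _ _ _ _ _ (D y)).
exact: continuous_cst.
Qed.

(** A product over the coordinates, because the balls of the maximum norm are squares. *)
Definition plateau0 (p : R * R) : R := hump p.1 * hump p.2.

Lemma Ck1_hump {V : normedModType R} (U : set V) (f : V -> R) : open U -> Ck 1 U f ->
  Ck 1 U (fun x => hump (f x)).
Proof.
move=> oU Cf.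
have cst (c : R) : Ck 1 U (fun _ : V => c) := Ck1_cst U c.
have C1 := Ck1D oU (cst 1) (Ck1M oU (cst (-1)) (Ck1M oU Cf Cf)).
have C2 := Ck1_comp oU is_derive_possq continuous_dpossq C1.
have C3 := Ck1D oU (cst 1) (Ck1M oU (cst (-2)) C2).
have C4 := Ck1_comp oU is_derive_possq continuous_dpossq C3.
have C5 := Ck1D oU (cst 1) (Ck1M oU (cst (-1)) C4).
have -> // : (fun x => hump (f x)) =
    (fun x => 1 + -1 * possq (1 + -2 * possq (1 + -1 * (f x * f x)))).
by apply/funext => x; rewrite /hump !mulN1r mulNr.
Qed.

Lemma Ck1_plateau0 : Ck 1 setT plateau0.
Proof.
exact: (Ck1M openT (Ck1_hump openT (Ck1_coord1 _)) (Ck1_hump openT (Ck1_coord2 _))).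
Qed.

Definition plateau (x : R * R) (r : R) (p : R * R) : R := plateau0 (r^-1 *: (p - x)).

Lemma plateau_quotient x r v p :
  (fun h : R => h^-1 *: (plateau x r (h *: v + p) - plateau x r p)) =
  (fun h : R => h^-1 *: (plateau0 (h *: (r^-1 *: v) + r^-1 *: (p - x)) - plateau0 (r^-1 *: (p - x)))).
Proof.
apply/funext => h; rewrite /plateau; congr (_ *: (plateau0 _ - _)).
by rewrite -addrA scalerDr; congr (_ + _); rewrite !scalerA mulrC.
Qed.

Lemma derive_plateau x r v p : 'D_v (plateau x r) p = r^-1 * 'D_v plateau0 (r^-1 *: (p - x)).
Proof.
have [_ D] := (Ck1P _ _).1 Ck1_plateau0.
rewrite -derive_scale; last exact: (D v (r^-1 *: (p - x)) I).1.
by rewrite /derive plateau_quotient.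
Qed.

Lemma Ck1_plateau x r : Ck 1 setT (plateau x r).
Proof.
have [c D] := (Ck1P _ _).1 Ck1_plateau0.
have ca (p : R * R) : {for p, continuous (fun q : R * R => r^-1 *: (q - x))}.
  apply: (@continuous_comp_at _ _ _ (fun q : R * R => q - x) (fun q => r^-1 *: q)).
    exact: (cvgB (@continuous_at_id _ p) (@continuous_cst _ _ x p)).
  exact: scaler_continuous.
apply/Ck1P; split=> [p _|v p _].
  exact: (continuous_comp_at (ca p) (c _ I)).
split; first by rewrite /derivable plateau_quotient; exact: (D (r^-1 *: v) (r^-1 *: (p - x)) I).1.
have -> : (fun y => 'D_v (plateau x r) y) = (fun p => r^-1 * 'D_v plateau0 (r^-1 *: (p - x))).
  by apply/funext => y; exact: derive_plateau.
apply: continuousM_fun; first exact: continuous_cst.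
exact: (continuous_comp_at (ca p) (D v _ I).2).
Qed.

Lemma plateau_in x r p : 0 < r -> ball x (r / 2) p -> plateau x r p = 1.
Proof.
move=> r0 [p1 p2]; rewrite -ball_normE/= in p1; rewrite -ball_normE/= in p2.
have half (a b : R) : `|a - b| < r / 2 -> hump (r^-1 * (b - a)) = 1.
  move=> ab; apply: hump_in.
  by rewrite normrM normfV (gtr0_norm r0) ler_pdivrMl// distrC ltW.
by rewrite /plateau /plateau0 /= /GRing.scale/= !half ?mulr1.
Qed.

Lemma plateau_out x r p : 0 < r -> ~ ball x r p -> plateau x r p = 0.
Proof.
move=> r0 np; apply: contrapT => /eqP bp; apply: np.
have out (u : R) : hump (r^-1 * u) != 0 -> `|u| < r.
  move=> hu; rewrite ltNge; apply: contraNN hu => ru; apply/eqP/hump_out.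
  by rewrite normrM normfV (gtr0_norm r0) ler_pdivlMl// mulr1.
move: bp; rewrite /plateau /plateau0 mulf_eq0 negb_or => /andP[/out b1 /out b2].
by split; rewrite -ball_normE/= distrC.
Qed.

Lemma bounded_supp (f : R * R -> R) (r : R) : continuous f ->
  (forall p, f p != 0 -> `|p.1| <= r /\ `|p.2| <= r) -> exists2 M : R, 0 <= M & forall p, `|f p| <= M.
Proof.
move=> cf fr; pose box := `[- r, r]%classic `*` `[- r, r]%classic.
have cb : compact box by apply: compact_setX; exact: segment_compact.
have /compact_bounded[M [_ HM]] := continuous_compact (continuous_subspaceT cf) cb.
exists (`|M| + 1) => [|p]; first by rewrite addr_ge0.
have [->|/fr[p1 p2]] := eqVneq (f p) 0; first by rewrite normr0 addr_ge0.
apply: (HM (`|M| + 1)); first by rewrite ltr_pwDr// ler_norm.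
by exists p => //; split; rewrite /= in_itv/= -ler_norml.
Qed.

(** By scaling: one bound for the unit cutoff serves all centres and all radii. *)
Lemma plateau_derive_bounded v :
  exists2 M : R, 0 <= M & forall x r p, 0 < r -> `|'D_v (plateau x r) p| <= M / r.
Proof.
have [_ D] := (Ck1P _ _).1 Ck1_plateau0.
have cD : continuous ('D_v plateau0) by move=> p; exact: (D v p I).2.
have supp p : plateau0 p != 0 -> `|p.1| <= 1 /\ `|p.2| <= 1.
  rewrite /plateau0 mulf_eq0 negb_or => /andP[h1 h2]; split; rewrite leNgt.
    by apply: contraNN h1 => /ltW/hump_out ->.
  by apply: contraNN h2 => /ltW/hump_out ->.
have [M M0 HM] := bounded_supp cD (derive_supp supp).
exists M => // x r p r0.
by rewrite derive_plateau normrM normfV (gtr0_norm r0) mulrC ler_wpM2r// invr_ge0 ltW.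
Qed.

Lemma hump_itv t : 0 <= hump t <= 1.
Proof.
rewrite /hump; set z := 1 - 2 * _.
have z1 : z <= 1 by rewrite /z gerBl mulr_ge0// /possq sqr_ge0.
rewrite /possq.
rewrite gerBl sqr_ge0 subr_ge0 andbT expr_le1 ?le_max ?lexx//.
by rewrite ge_max ler01.
Qed.

Lemma plateau_itv x r p : 0 <= plateau x r p <= 1.
Proof.
rewrite /plateau /plateau0; have /andP[? ?] := hump_itv (r^-1 *: (p - x)).1.
have /andP[? ?] := hump_itv (r^-1 *: (p - x)).2.
by rewrite mulr_ge0//= mulr_ile1.
Qed.

End plateau.

Lemma ball_coord {R : realType} (x p : R * R) (r : R) : ball x r p ->
  `|p.1| <= Num.max `|x.1| `|x.2| + r /\ `|p.2| <= Num.max `|x.1| `|x.2| + r.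
Proof.
move=> [p1 p2]; rewrite -ball_normE/= in p1; rewrite -ball_normE/= in p2.
have tri (a b : R) : `|a - b| < r -> `|b| <= `|a| + r.
  move=> ab; have -> : b = a - (a - b) by ring.
  by apply: le_trans (ler_normB _ _) _; rewrite lerD2l ltW.
split; [apply: le_trans (tri _ _ p1) _|apply: le_trans (tri _ _ p2) _].
  by rewrite lerD2r le_max lexx.
by rewrite lerD2r le_max lexx orbT.
Qed.

(** At most one of the slopes 0, 1, -1 is parallel to [v], so two of them remain. *)
Lemma cross_dir_neq0 {R : realType} (v : R * R) : v != 0 ->
  exists c c' : R, [/\ c != c', `|c| <= 1, `|c'| <= 1,
    cross (1, c) v != 0 & cross (1, c') v != 0].
Proof.
move=> v0; have n10 : (1 : R) != 0 by rewrite oner_eq0.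
have n1N : (1 : R) != -1 by rewrite -subr_eq0 opprK (_ : 1 + 1 = 2%:R)// pnatr_eq0.
have [z0|z0] := eqVneq (cross (1, 0) v) 0; last first.
  have [z1|z1] := eqVneq (cross (1, 1) v) 0; last first.
    by exists 0, 1; rewrite normr0 normr1 ler01 lexx eq_sym.
  exists 0, (-1); rewrite normr0 normrN normr1 ler01 lexx; split=> //.
    by rewrite eq_sym oppr_eq0.
  move: z0 z1; rewrite /cross/= => z0 z1; apply: contraNneq z0 => z2; apply/eqP.
  lra.
have v2 : v.2 = 0 by move: z0; rewrite /cross/=; lra.
have v1 : v.1 != 0.
  by apply: contraNneq v0 => v1; apply/eqP; apply: injective_projections.
exists 1, (-1); rewrite normrN normr1 lexx; split=> //.
  by rewrite /cross/= v2 !mul1r sub0r oppr_eq0.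
by rewrite /cross/= v2 mul1r sub0r mulN1r opprK.
Qed.

Lemma Ck1_line {R : realType} {W : normedModType R} (x0 v : W) :
  Ck 1 setT (fun s : R => x0 + s *: v) /\
  forall s : R, derive1 (fun s : R => x0 + s *: v) s = v.
Proof.
have d (s : R) : derivable (fun s : R => x0 + s *: v) s 1.
  by rewrite -(derivable_line (fun y => y)); exact: derivable_id.
have E (s : R) : 'D_1 (fun s : R => x0 + s *: v) s = v.
  by rewrite -(derive_line (fun y => y)); exact: derive_id.
split=> [|s]; last by rewrite derive1E.
apply/Ck1P; split=> [s _|w s _].
  by apply: differentiable_continuous; apply/derivable1_diffP.
have Ew (s' : R) : 'D_w (fun s : R => x0 + s *: v) s' = w *: v.
  rewrite deriveE; last exact/derivable1_diffP.
  have -> : w = w *: (1 : R) by rewrite /GRing.scale/= mulr1.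
  rewrite linearZ/= -deriveE; last exact/derivable1_diffP.
  by rewrite E [in RHS]/GRing.scale/= mulr1.
split; last first.
  have -> : (fun y => 'D_w (fun s : R => x0 + s *: v) y) = (fun=> w *: v).
    by apply/funext => s'; exact: Ew.
  exact: (@continuous_cst R W (w *: v) s).
by apply: diff_derivable; exact/derivable1_diffP.
Qed.

Lemma gt0_cp {R : realType} (y : R) : 0 < y -> - y < y.
Proof. by move=> y0; rewrite (lt_trans _ y0)// oppr_lt0. Qed.

Lemma dist_far {R : realType} (x p r r2 : R) : `|x - p| < r -> r2 = r + r ->
  `|p - (x + r2)| <= 4 * r.
Proof.
by move=> xp ->; move: xp; rewrite ltr_norml ler_norml => /andP[? ?]; apply/andP; split; lra.
Qed.

Lemma near_lt_side {R : realType} (x2 c r s w : R) :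
  0 < r -> `|c| <= 1 -> `|x2 - (s + c * w)| < r -> `|w| <= 4 * r ->
  x2 - 8 * r < s /\ s < x2 + 8 * r.
Proof.
move=> r0 c1; rewrite ltr_norml => /andP[h1 h2] wr.
have : `|c * w| <= 4 * r by rewrite normrM; apply: le_trans wr; rewrite ler_piMl.
by rewrite ler_norml => /andP[h3 h4]; split; lra.
Qed.

Lemma affine_eq {R : realType} (a1 a2 b1 b2 c c' : R) : c != c' ->
  a1 + c * a2 = b1 + c * b2 -> a1 + c' * a2 = b1 + c' * b2 -> a1 = b1 /\ a2 = b2.
Proof.
move=> cc E E'.
have E2 : a2 = b2.
  have cc0 : c - c' != 0 by rewrite subr_eq0.
  by apply: (mulfI cc0); rewrite !mulrBl; lra.
by split=> //; move: E; rewrite E2 => /addIr.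
Qed.

(** * The divergence theorem on a bounded piecewise C^1 domain *)

Section divergence.
Context {R : realType}.
Local Notation mR := (measurableTypeR R).
Local Notation mu := (@lebesgue_measure R).
Local Notation mu2 := (lebesgue2 R).
Local Notation e1 := ((1, 0) : R * R).
Local Notation e2 := ((0, 1) : R * R).
Variables (Omega : set (R * R)) (N : nat) (gam : 'I_N -> R -> R * R) (n : R * R -> R * R).
Hypothesis oO : open Omega.
Hypothesis bdO : bounded_set Omega.
Hypothesis bO : piecewise_C1_boundary Omega gam n.

Lemma bounded_box : exists2 r : R, 0 < r & Omega `<=` `[- r, r] `*` `[- r, r].
Proof.
have [M [_ HM]] := bdO.
exists (`|M| + 1) => [|[x y] Ox]; first by rewrite ltr_wpDl.
have : `|(x, y) : R * R| <= `|M| + 1 by apply: HM => //; rewrite ltr_pwDr ?ler_norm.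
rewrite -[X in X <= _]/(Num.max `|x| `|y|) ge_max => /andP[x1 x2].
by split; rewrite /= in_itv/= -ler_norml.
Qed.

Lemma closure_compact : compact (closure Omega).
Proof.
have [r r0 Or] := bounded_box.
pose box : set (R * R) := `[- r, r]%classic `*` `[- r, r]%classic.
have cb : compact box by apply: compact_setX; exact: segment_compact.
have clb : closed box by apply: compact_closed cb; exact: norm_hausdorff.
apply: (subclosed_compact _ cb); first exact: closed_closure.
by rewrite (closure_id box).1//; exact: closureS.
Qed.

Lemma closure_gam k s : s \in `[0, 1] -> closure Omega (gam k s).
Proof. by move=> s01; have [] := boundary_gam bO k s01. Qed.

(** The outward flux of the field [f d]: as [n ds] is the tangent vector turned by [- pi / 2], the
    density of [d . n ds] is [cross d (derive1 (gam k) s)]. *)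
Definition flux (d : R * R) (f : R * R -> R) : R :=
  \sum_(k < N) \int[mu]_(s in `[0, 1]) (f (gam k s) * cross d (derive1 (gam k) s)).

Lemma continuous_dgam k s : s \in `[0, 1] -> {for s, continuous (derive1 (gam k))}.
Proof.
have [/(_ k)[V [oV sV /Ck1P[_ dg]]] _ _ _ _] := bO => s01.
have -> : derive1 (gam k) = (fun s => 'D_1 (gam k) s).
  by apply/funext => z; rewrite derive1E.
by apply: (dg 1 s _).2; exact: sV.
Qed.

Lemma flux_continuous d (f : R * R -> R) k s :
  (forall x, closure Omega x -> {for x, continuous f}) -> s \in `[0, 1] ->
  {for s, continuous (fun s => f (gam k s) * cross d (derive1 (gam k) s))}.
Proof.
move=> cf s01.
have c1 := continuous_comp_at (gam_continuous (k := k) bO s01) (cf _ (closure_gam (k := k) s01)).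
exact: (continuousM_fun c1 (continuous_cross (d := d) (continuous_dgam (k := k) s01))).
Qed.

Lemma segment_integrable (f : R -> R) (a b : R) :
  (forall s, s \in `[a, b] -> {for s, continuous f}) -> mu.-integrable `[a, b] (EFin \o f).
Proof.
move=> cf; apply: continuous_compact_integrable; first exact: segment_compact.
by apply: continuous_in_subspaceT => s /set_mem; exact: cf.
Qed.

Lemma omega_measurable : measurable (Omega : set (mR * mR)).
Proof. exact: open2_measurable. Qed.

Lemma omega_integrable (f : R * R -> R) :
  (forall x, closure Omega x -> {for x, continuous f}) -> mu2.-integrable Omega (EFin \o f).
Proof.
move=> cf; have [r r0 Or] := bounded_box.
have cw : {within closure Omega, continuous f}.
  by apply: continuous_in_subspaceT => x /set_mem; exact: cf.
have /compact_bounded[M [_ HM]] := continuous_compact cw closure_compact.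
apply: (@integrable2_bounded _ _ _ r (M + 1)) => //.
- exact: omega_measurable.
- by apply: open2_measurable_fun => // x Ox; apply: cf; exact: subset_closure.
- move=> x Ox; apply: (HM (M + 1)); first by rewrite ltrDl.
  by exists x => //; exact: subset_closure.
Qed.

Variable U : set (R * R).
Hypothesis oU : open U.
Hypothesis sU : closure Omega `<=` U.

(** The divergence theorem for the field [f d], whose divergence is ['D_d f]. *)
Definition Div (d : R * R) (f : R * R -> R) : Prop :=
  \int[mu2]_(p in Omega) 'D_d f p = flux d f.

Lemma omega_integralD d f g : Ck 1 U f -> Ck 1 U g ->
  \int[mu2]_(p in Omega) 'D_d (fun x => f x + g x) p =
  \int[mu2]_(p in Omega) 'D_d f p + \int[mu2]_(p in Omega) 'D_d g p.
Proof.
move=> /Ck1P[cf df] /Ck1P[cg dg].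
have i1 : mu2.-integrable Omega (EFin \o 'D_d f).
  by apply: omega_integrable => x /sU Ux; exact: (df d x Ux).2.
have i2 : mu2.-integrable Omega (EFin \o 'D_d g).
  by apply: omega_integrable => x /sU Ux; exact: (dg d x Ux).2.
rewrite -(RintegralD omega_measurable i1 i2).
apply: eq_Rintegral => x /set_mem/subset_closure/sU Ux.
exact: (@derive_val _ _ _ _ _ _ _ (is_deriveD_fun
  (derivableP (df d x Ux).1) (derivableP (dg d x Ux).1))).
Qed.

Lemma fluxD d f g : Ck 1 U f -> Ck 1 U g ->
  flux d (fun x => f x + g x) = flux d f + flux d g.
Proof.
move=> /Ck1P[cf df] /Ck1P[cg dg].
rewrite /flux -big_split/=; apply: eq_bigr => k _.
have mI : measurable (`[0, 1]%classic : set mR) by [].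
have ci (h : R * R -> R) : (forall x, U x -> {for x, continuous h}) ->
    mu.-integrable `[0, 1] (EFin \o (fun s => h (gam k s) * cross d (derive1 (gam k) s))).
  by move=> ch; apply: segment_integrable => s; apply: flux_continuous => x /sU; exact: ch.
rewrite -(RintegralD mI (ci f cf) (ci g cg)).
by apply: eq_Rintegral => s _; rewrite mulrDl.
Qed.

Lemma DivD d f g : Ck 1 U f -> Ck 1 U g -> Div d f -> Div d g -> Div d (fun x => f x + g x).
Proof. by move=> Cf Cg Df Dg; rewrite /Div omega_integralD// fluxD// Df Dg. Qed.

Lemma Div0 d f : (forall p, closure Omega p -> f p = 0) -> Div d f.
Proof.
move=> f0; rewrite /Div /flux big1 => [|k _]; last first.
  rewrite (eq_Rintegral _ (g := fun=> 0)) ?Rintegral_cst ?mul0r//.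
  by move=> s /set_mem s01; rewrite f0 ?mul0r//; exact: closure_gam.
rewrite (eq_Rintegral _ (g := fun=> 0)); first by rewrite Rintegral_cst ?mul0r//; exact: omega_measurable.
move=> x /set_mem Ox.
have [_ ->] := @derive_comp_near _ _ _ f (fun=> 0) Omega d x oO Ox (fun y Oy => f0 y (subset_closure Oy)).
exact: derive_cst.
Qed.

(* Two directions [(1, c)] span the plane. *)
Lemma Div_span (c c' : R) f : c != c' -> Ck 1 U f -> Div (1, c) f -> Div (1, c') f ->
  Div e1 f /\ Div e2 f.
Proof.
move=> cc Cf; have [cf df] := (Ck1P _ _).1 Cf.
have I1 : \int[mu2]_(p in Omega) 'D_e1 f p = \int[mu2]_(p in Omega) 'D_e1 f p by [].
have lin z : \int[mu2]_(p in Omega) 'D_((1, z) : R * R) f p =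
    \int[mu2]_(p in Omega) 'D_e1 f p + z * \int[mu2]_(p in Omega) 'D_e2 f p.
  have i1 : mu2.-integrable Omega (EFin \o 'D_e1 f).
    by apply: omega_integrable => x /sU Ux; exact: (df e1 x Ux).2.
  have i2 : mu2.-integrable Omega (EFin \o 'D_e2 f).
    by apply: omega_integrable => x /sU Ux; exact: (df e2 x Ux).2.
  have i3 : mu2.-integrable Omega (EFin \o (fun p => z * 'D_e2 f p)).
    apply: omega_integrable => x /sU Ux.
    exact: continuousM_fun (@continuous_cst _ R z x) (df e2 x Ux).2.
  have mO := omega_measurable.
  transitivity (\int[mu2]_(p in Omega) ('D_e1 f p + z * 'D_e2 f p)); last first.
    by rewrite (RintegralD mO i1 i3) (RintegralZl z mO i2).
  apply: eq_Rintegral => p /set_mem/subset_closure/sU Up.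
  rewrite -derive_scale; last exact: (df e2 p Up).1.
  rewrite -(derive_add _ _ oU Cf Up); congr ('D_ _ f p).
  by apply: injective_projections; rewrite /= /GRing.scale/= ?mulr0 ?mulr1 ?addr0 ?add0r.
have flin z : flux (1, z) f = flux e1 f + z * flux e2 f.
  rewrite /flux big_distrr/= -big_split/=; apply: eq_bigr => k _.
  have ci d : mu.-integrable `[0, 1] (EFin \o (fun s => f (gam k s) * cross d (derive1 (gam k) s))).
    by apply: segment_integrable => s; apply: flux_continuous => x /sU; exact: cf.
  have ci2 : mu.-integrable `[0, 1] (EFin \o (fun s => z * (f (gam k s) * cross e2 (derive1 (gam k) s)))).
    apply: segment_integrable => s s01.
    apply: (continuousM_fun (@continuous_cst _ R z s)).
    by apply: flux_continuous => // x /sU; exact: cf.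
  have mI : measurable (`[0, 1]%classic : set mR) by [].
  rewrite -(RintegralZl z mI (ci e2)) -(RintegralD mI (ci e1) ci2).
  by apply: eq_Rintegral => s _; rewrite /cross/=; ring.
move=> E E'; rewrite /Div (lin c) (flin c) in E; rewrite /Div (lin c') (flin c') in E'.
exact: (affine_eq cc E E').
Qed.

(** In the ball of the chart the boundary is only the piece of [gam k] over []a, b[], so the total
    flux reduces to the boundary term of [transversal_formula]. *)
Lemma Div_chart k s0 c : s0 \in `]0, 1[ -> `|c| <= 1 ->
  cross (1, c) (derive1 (gam k) s0) != 0 ->
  exists2 r : R, 0 < r & forall f, Ck 1 setT f ->
    (forall p, f p != 0 -> ball (gam k s0) r p) -> Div (1, c) f.
Proof.
move=> s01 c1 kap.
have [sigma [a [b [rho [rho' [r [[sig /andP[a0 asb] b1 rr r0] mono side cover only]]]]]]] :=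
  regular_chart oO bO s01 c1 kap.
exists r; first by [].
move=> f Cf fr.
have [/(_ k)[V [oV sV Cg]] _ _ _ _] := bO.
have ab_V s : s \in `[a, b] -> V s.
  rewrite in_itv/= => /andP[as_ sb]; apply: sV; rewrite /= in_itv/=.
  by rewrite (le_trans (ltW a0) as_) (le_trans sb (ltW b1)).
have fB p (fp : f p != 0) := ball_coord (fr p fp).
have fsupp p (fp : f p != 0) := cover p (fr p fp).
rewrite /Div (@transversal_formula R f Omega (gam k) c a b rho rho' sigma _ V asb oO sig rr Cf fB fsupp side oV ab_V Cg mono).
have z l s : s \in `[0, 1] -> ~ (l = k /\ s \in `]a, b[) -> f (gam l s) = 0.
  by move=> s01' nls; apply: contrapT => /eqP/fr/(only l s s01').
rewrite /flux (bigD1 k)//= big1 => [|l lk]; last first.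
  rewrite (eq_Rintegral _ (g := fun=> 0)) ?Rintegral_cst ?mul0r// => s /set_mem s01'.
  by rewrite z ?mul0r// => -[/eqP]; rewrite (negbTE lk).
rewrite addr0 Rintegral_mkcond [RHS]Rintegral_mkcond.
apply: eq_Rintegral => s _; rewrite !patchE.
have [/set_mem sab|sab] := boolP (s \in `[a, b]%classic).
  rewrite ifT//; apply/mem_set; move: sab; rewrite /= !in_itv/= => /andP[as_ sb].
  by rewrite (le_trans (ltW a0) as_) (le_trans sb (ltW b1)).
case: ifPn => // /set_mem s01'; rewrite z ?mul0r// => -[_ sab'].
by move: sab; rewrite mem_setE (subset_itv_oo_cc sab').
Qed.

Lemma Div_regular k s0 : s0 \in `]0, 1[ ->
  exists2 r : R, 0 < r & forall f, Ck 1 setT f ->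
    (forall p, f p != 0 -> ball (gam k s0) r p) -> Div e1 f /\ Div e2 f.
Proof.
move=> s01; have [_ /(_ k s0 (subset_itv_oo_cc s01)) v0 _ _ _] := bO.
have [c [c' [cc c1 c'1 z z']]] := cross_dir_neq0 v0.
have [r r0 H] := Div_chart s01 c1 z.
have [r' r'0 H'] := Div_chart s01 c'1 z'.
exists (Num.min r r'); first by rewrite lt_min r0.
move=> f Cf fr; apply: (Div_span cc (Ck_subset (@subsetT _ U) Cf)).
  by apply: H => // p /fr; apply: le_ball; rewrite ge_min lexx.
by apply: H' => // p /fr; apply: le_ball; rewrite ge_min lexx orbT.
Qed.

(** Both sides are 0. The support misses the boundary, so the flux vanishes; for the integral,
    [Omega] is exchanged for a half-plane that also contains the support, and [transversal_formula]
    is applied to its boundary line, where [f] vanishes. *)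
Lemma Div_inside x : Omega x -> exists2 r : R, 0 < r & forall f, Ck 1 setT f ->
    (forall p, f p != 0 -> ball x r p) -> Div e1 f /\ Div e2 f.
Proof.
move=> Ox.
have [r2 r20 xO] := (nbhs_ballP _ _).1 (open_nbhs_nbhs (conj oO Ox)).
pose r := r2 / 2; have r0 : 0 < r by rewrite divr_gt0.
have r2E : r2 = r + r by rewrite /r -splitr.
exists r; first by [].
move=> f Cf fr.
have n10 : (0 : R) != 1 by rewrite eq_sym oner_eq0.
suff H c : `|c| <= 1 -> Div (1, c) f.
  have D0 : Div (1, 0) f by apply: H; rewrite normr0.
  have D1 : Div (1, 1) f by apply: H; rewrite normr1.
  exact: (Div_span n10 (Ck_subset (@subsetT _ U) Cf) D0 D1).
move=> c1.
have fB p (fp : f p != 0) := ball_coord (fr p fp).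
rewrite /Div; have -> : flux (1, c) f = 0.
  rewrite /flux big1// => k _.
  rewrite (eq_Rintegral _ (g := fun=> 0)) ?Rintegral_cst ?mul0r// => s /set_mem s01.
  have -> : f (gam k s) = 0; last by rewrite mul0r.
  apply: contrapT => /eqP/fr xb.
  apply: (boundary_notin oO (boundary_gam bO k s01)); apply: xO.
  by apply: le_ball xb; rewrite r2E lerDl ltW.
pose A : R := x.1 + r2.
(* The vertical line bounding the half-plane, placed at distance [r2] to the right of [x], beyond
   the support. *)
pose g (s : R) : R * R := (A, 0) + s *: ((0, 1) : R * R).
have [Cg dg] : Ck 1 setT g /\ forall s, derive1 g s = (0, 1) by exact: Ck1_line.
have gE s w : g s + w *: ((1, c) : R * R) = (A + w, s + c * w).
  by apply: injective_projections; rewrite /= /GRing.scale/= ?mulr0 ?mulr1 ?addr0 ?add0r// [w * c]mulrC.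
pose O' : set (R * R) := [set p | p.1 < A].
have oO' : open O'.
  have -> : O' = [set p : R * R | - A < - p.1] by apply/seteqP; split=> p; rewrite /O'/= ltrN2.
  apply: open_superlevel => p; apply: cvgN; exact: continuous_fst.
(* A point of the support is less than [3 * r] away horizontally from the line, so [4 * r] bounds
   [w]; with [|c| <= 1] its parameter [s] differs from [x.2] by less than [r + 4 * r]. The remaining
   slack is arbitrary, and so is [5 * r], since the half-plane is on one side for all [w]. *)
pose a := x.2 - 8 * r; pose b := x.2 + 8 * r.
have r80 : 0 < 8 * r by rewrite mulr_gt0.
have ab : a < b by rewrite /a /b ltrD2l gt0_cp.
have asupp p : f p != 0 -> exists s w,
    [/\ s \in `]a, b[, `|w| <= 4 * r & p = g s + w *: ((1, c) : R * R)].
  move=> /fr[p1 p2]; rewrite -ball_normE/= in p1; rewrite -ball_normE/= in p2.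
  have w4 : `|p.1 - A| <= 4 * r by exact: dist_far p1 r2E.
  exists (p.2 - c * (p.1 - A)), (p.1 - A); rewrite gE; split=> //.
    rewrite in_itv/=; apply/andP; apply: (near_lt_side r0 c1 _ w4).
    by rewrite subrK.
  by apply: injective_projections => /=; [rewrite subrKC|rewrite subrK].
have side s w : s \in `]a, b[ -> `|w| < 5 * r -> O' (g s + w *: ((1, c) : R * R)) <-> 1 * w < 0.
  by move=> _ _; rewrite gE /O'/= gtrDl mul1r.
have D0 p : ~ ball x r2 p -> 'D_((1, c) : R * R) f p = 0.
  move=> np.
  pose h (q : R * R) : R := Num.max `|x.1 - q.1| `|x.2 - q.2|.
  have ch (q : R * R) : {for q, continuous h}.
    apply: continuous_max; apply: continuous_norm_at; apply: cvgB;
      [exact: cvg_cst|exact: continuous_fst|exact: cvg_cst|exact: continuous_snd].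
  have hp : r < h p.
    rewrite ltNge; apply/negP; rewrite /h ge_max => /andP[h1 h2]; apply: np.
    by split; rewrite -ball_normE/=; apply: le_lt_trans; [exact: h1|rewrite r2E ltrDl|exact: h2|rewrite r2E ltrDl].
  have h0 q : r < h q -> f q = 0.
    move=> hq; apply: contrapT => /eqP/fr[q1 q2]; rewrite -ball_normE/= in q1; rewrite -ball_normE/= in q2.
    by move: hq; rewrite /h lt_max => /orP[/lt_trans/(_ q1)|/lt_trans/(_ q2)]; rewrite ltxx.
  have [_ ->] := @derive_comp_near _ _ _ f (fun=> 0) _ (1, c) p (open_superlevel r ch) hp h0.
  exact: derive_cst.
have -> : \int[mu2]_(p in Omega) 'D_((1, c) : R * R) f p = \int[mu2]_(p in O') 'D_((1, c) : R * R) f p.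
  rewrite Rintegral_mkcond [RHS]Rintegral_mkcond.
  apply: eq_Rintegral => p _; rewrite !patchE.
  have [xp|/D0 ->] := pselect (ball x r2 p); last by do 2 case: ifP.
  rewrite !ifT//; apply/mem_set; last exact: xO.
  move: xp => [p1 _]; rewrite -ball_normE/= in p1; rewrite /O'/= /A.
  by move: p1; rewrite distrC => /(le_lt_trans (ler_norm _)); rewrite ltrBlDl.
have r45 : 4 * r < 5 * r by rewrite ltr_pM2r// ltr_nat.
rewrite (@transversal_formula R f O' g c a b (5 * r) (4 * r) 1 _ setT ab oO' (or_introl erefl) r45 Cf fB asupp side openT (fun _ _ => I) Cg); last first.
  move=> s _; rewrite dg; have -> : cross (1, c) (0, 1) = 1 by rewrite /cross/=; ring.
  by rewrite mulr1.
rewrite (eq_Rintegral _ (g := fun=> 0)) ?Rintegral_cst ?mul0r// => s /set_mem sab.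
have -> : f (g s) = 0; last by rewrite mul0r.
apply: contrapT => /eqP/fr[]; rewrite -ball_normE/= /GRing.scale/= mulr0 addr0 /A opprD addNKr normrN.
by rewrite gtr0_norm// r2E gtrDl ltNge ltW.
Qed.

End divergence.

(** * Patching the local formulas away from the end points of the arcs *)

Lemma open_far {R : realType} (x : R * R) (r : R) : open [set q : R * R | r < `|x - q|].
Proof.
apply: open_superlevel => q.
apply: (@continuous_comp_at _ _ _ (fun z : R * R => x - z) Num.norm); last exact: norm_continuous.
exact: (cvgB (@continuous_cst _ _ x q) (@continuous_at_id _ q)).
Qed.

Lemma Ck1_setU {R : realType} {V W : normedModType R} (A B : set V) (f : V -> W) :
  Ck 1 A f -> Ck 1 B f -> Ck 1 (A `|` B) f.
Proof.
move=> /Ck1P[cA dA] /Ck1P[cB dB]; apply/Ck1P; split=> [x [Ax|Bx]|v x [Ax|Bx]].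
- exact: cA.
- exact: cB.
- exact: dA.
- exact: dB.
Qed.

(** The local formulas want functions that are C^1 on the whole plane, while [f] is so on [U] only.
    Beyond distance [r] from [x] the product is 0 whatever [f] is there, and this open set together
    with [U] covers the plane. *)
Lemma Ck1_cutoff {R : realType} (U : set (R * R)) (f : R * R -> R) x (r r' : R) :
  open U -> 0 < r -> r < r' -> ball x r' `<=` U -> Ck 1 U f ->
  Ck 1 setT (fun p => plateau x r p * f p).
Proof.
move=> oU r0 rr xU Cf.
have -> : setT = U `|` [set q | r < `|x - q|].
  apply/esym/seteqP; split=> // q _.
  have [xq|xq] := leP `|x - q| r; last by right.
  left; apply: xU; rewrite -ball_normE/=; exact: le_lt_trans rr.
apply: Ck1_setU; first exact: (Ck1M oU (Ck_subset (@subsetT _ U) (Ck1_plateau x r)) Cf).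
apply: (Ck_eq (f := fun=> 0)); last exact: Ck1_cst.
  exact: open_far.
move=> q /= rq; rewrite plateau_out ?mul0r//.
by rewrite -ball_normE/= => /lt_trans/(_ rq); rewrite ltxx.
Qed.

Lemma plateau_supp {R : realType} (f : R * R -> R) (x : R * R) (r : R) p : 0 < r ->
  plateau x r p * f p != 0 -> ball x r p.
Proof.
by move=> r0 nz; apply: contrapT => np; move: nz; rewrite plateau_out// mul0r eqxx.
Qed.

Section divergence_theorem.
Context {R : realType}.
Local Notation e1 := ((1, 0) : R * R).
Local Notation e2 := ((0, 1) : R * R).
Variables (Omega : set (R * R)) (N : nat) (gam : 'I_N -> R -> R * R) (n : R * R -> R * R).
Hypothesis oO : open Omega.
Hypothesis bdO : bounded_set Omega.
Hypothesis bO : piecewise_C1_boundary Omega gam n.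
Variable U : set (R * R).
Hypothesis oU : open U.
Hypothesis sU : closure Omega `<=` U.

Local Notation Div2 f := (Div Omega gam e1 f /\ Div Omega gam e2 f).

Lemma Div2_split (g h : R * R -> R) : Ck 1 setT g -> Ck 1 U h ->
  Div2 (fun p => g p * h p) -> Div2 (fun p => (1 + -1 * g p) * h p) -> Div2 h.
Proof.
move=> /(Ck_subset (@subsetT _ U)) Cg Ch [D1 D2] [E1 E2].
have Cc := Ck1D oU (@Ck1_cst R (R * R)%type U R 1) (Ck1M oU (@Ck1_cst R (R * R)%type U R (-1)) Cg).
have C1 := Ck1M oU Cg Ch; have C2 := Ck1M oU Cc Ch.
have E : h = (fun p => g p * h p + (1 + -1 * g p) * h p).
  by apply/funext => p; ring.
rewrite E; split; first exact: (DivD oO bdO bO sU C1 C2 D1 E1).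
exact: (DivD oO bdO bO sU C1 C2 D2 E2).
Qed.

(* Multiplying by [1 - plateau] for the balls of a finite cover, one at a time,
   replaces a partition of unity. *)
Lemma Div2_peel (f : R * R -> R) (rad : R * R -> R) (xs : seq (R * R)) : Ck 1 U f ->
  (forall x, x \in xs -> 0 < rad x /\
     forall g : R * R -> R, Ck 1 setT g -> Div2 (fun p => plateau x (rad x) p * (g p * f p))) ->
  forall g : R * R -> R, Ck 1 setT g ->
  (forall p, closure Omega p -> g p * f p != 0 ->
    exists2 x, x \in xs & ball x (rad x / 2) p) ->
  Div2 (fun p => g p * f p).
Proof.
move=> Cf; elim: xs => [|x xs IH] Hxs g Cg cov.
  have z p : closure Omega p -> g p * f p = 0.
    by move=> Kp; apply: contrapT => /eqP/(cov p Kp)[].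
  by split; exact: (Div0 (n := n)).
have [rx Hx] := Hxs x (mem_head _ _).
have Cb := Ck1_plateau x (rad x).
have Ch := Ck1M oU (Ck_subset (@subsetT _ U) Cg) Cf.
apply: (Div2_split Cb Ch); first exact: Hx.
have Cg' := Ck1M openT (Ck1D openT (@Ck1_cst R (R * R)%type setT R 1) (Ck1M openT (@Ck1_cst R (R * R)%type setT R (-1)) Cb)) Cg.
have -> : (fun p => (1 + -1 * plateau x (rad x) p) * (g p * f p)) =
   (fun p => ((1 + -1 * plateau x (rad x) p) * g p) * f p).
  by apply/funext => p; rewrite mulrA.
apply: IH => //.
  by move=> y ys; apply: Hxs; rewrite inE ys orbT.
move=> p Kp nz.
have gf0 : g p * f p != 0.
  by apply: contraNneq nz => gf; rewrite -mulrA gf mulr0.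
have [y yxs yp] := cov p Kp gf0.
move: yxs; rewrite inE => /orP[/eqP yx|ys]; last by exists y.
(* On the half ball around [x] the factor [1 - plateau] vanishes, so these points no longer have to
   be covered by the remaining balls. *)
exfalso; move: nz; rewrite plateau_in//; last by rewrite -yx.
by rewrite mulr1 subrr !mul0r eqxx.
Qed.

Definition endpoint (p : R * R) : Prop := exists k, p = gam k 0 \/ p = gam k 1.

Lemma closure_cases p : closure Omega p ->
  [\/ Omega p, (exists k s, p = gam k s /\ s \in `]0, 1[) | endpoint p].
Proof.
move=> Kp; have [Op|nOp] := pselect (Omega p); first by constructor 1.
have : boundary Omega p by split=> // /interior_subset.
have [_ _ _ -> _] := bO => -[k _ [s s01 <-]].
have [s0|s0] := eqVneq s 0; first by constructor 3; exists k; left; rewrite s0.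
have [s1|s1] := eqVneq s 1; first by constructor 3; exists k; right; rewrite s1.
constructor 2; exists k, s; split=> //.
by move: s01; rewrite /= !in_itv/= !lt_neqAle eq_sym s0 s1.
Qed.

(** Every point of the closure has a radius at which the cut-off function satisfies the formula: by
    [Div_inside], by [Div_regular], or trivially near an end point, where [f] vanishes. Compactness
    leaves finitely many half balls for [Div2_peel]. *)
Lemma Div2_away (f : R * R -> R) : Ck 1 U f ->
  (forall p, endpoint p -> exists2 e, 0 < e & forall q, ball p e q -> f q = 0) -> Div2 f.
Proof.
move=> Cf f0.
have loc x : exists r : R, closure Omega x -> 0 < r /\
    forall g : R * R -> R, Ck 1 setT g -> Div2 (fun p => plateau x r p * (g p * f p)).
  have [Kx|nK] := pselect (closure Omega x); last by exists 0.
  suff [r r0 H] : exists2 r : R, 0 < r &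
      forall g : R * R -> R, Ck 1 setT g -> Div2 (fun p => plateau x r p * (g p * f p)) by exists r.
  have good : (exists2 r : R, 0 < r & forall h : R * R -> R, Ck 1 setT h ->
      (forall p, h p != 0 -> ball x r p) -> Div2 h) ->
      exists2 r : R, 0 < r & forall g : R * R -> R, Ck 1 setT g -> Div2 (fun p => plateau x r p * (g p * f p)).
    move=> [r r0 Hr].
    have [r1 r10 xU] := (nbhs_ballP _ _).1 (open_nbhs_nbhs (conj oU (sU Kx))).
    (* Below [r], for the local formula, and strictly below [r1], so that the product with the
       cutoff is C^1 on the plane. *)
    pose r2 := Num.min r r1 / 2.
    have m0 : 0 < Num.min r r1 by rewrite lt_min r0.
    have r20 : 0 < r2 by rewrite divr_gt0.
    have r2m : r2 < Num.min r r1 by rewrite ltr_pdivrMr// ltr_pMr// ltr1n.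
    have [r2r r2r1] : r2 < r /\ r2 < r1 by apply/andP; rewrite -lt_min.
    exists r2 => // g Cg; apply: Hr.
      exact: (Ck1_cutoff oU r20 r2r1 xU (Ck1M oU (Ck_subset (@subsetT _ U) Cg) Cf)).
    by move=> p /(@plateau_supp _ (fun p => g p * f p) x r2 p r20); apply: le_ball; exact: ltW.
  have [Ox|[k [s [xE s01]]]|ex] := closure_cases Kx.
  - by apply: good; exact: (Div_inside oO bdO bO oU sU).
  - by apply: good; rewrite xE; exact: (Div_regular oO bdO bO oU sU).
  have [e e0 He] := f0 x ex; exists e => // g Cg.
  have z p : plateau x e p * (g p * f p) = 0.
    have [xp|/(plateau_out e0) ->] := pselect (ball x e p); last by rewrite mul0r.
    by rewrite (He p xp) !mulr0.
  by split; apply: (Div0 oO bO) => p _; exact: z.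
have [rad Hrad] := choice loc.
have cK : cover_compact (closure Omega).
  have E := @compact_cover ((R * R)%type : normedModType R).
  exact: (eq_ind _ (fun C => C (closure Omega)) (closure_compact bdO) _ E).
have [||D DK cov] := cK (R * R)%type (closure Omega) (fun x => ball x (rad x / 2)).
- by move=> x _; exact: ball_open.
- move=> x Kx; exists x => //; apply: ballxx.
  by have [r0 _] := Hrad x Kx; rewrite divr_gt0.
have Cone := @Ck1_cst R (R * R)%type setT R 1.
have -> : f = (fun p => 1 * f p) by apply/funext => p; rewrite mul1r.
apply: (@Div2_peel f rad (finmap.enum_fset D) Cf _ (fun=> 1) Cone).
  by move=> x xD; have /set_mem Kx := DK x xD; exact: Hrad.
move=> p Kp _; have [x xD xp] := cov p Kp.
by exists x.
Qed.

End divergence_theorem.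

(** * Removing the end points of the arcs *)

Section corners.
Context {R : realType}.
Local Notation mR := (measurableTypeR R).
Local Notation mu := (@lebesgue_measure R).
Local Notation mu2 := (lebesgue2 R).
Local Notation e1 := ((1, 0) : R * R).
Local Notation e2 := ((0, 1) : R * R).
Variables (Omega : set (R * R)) (N : nat) (gam : 'I_N -> R -> R * R) (n : R * R -> R * R).
Hypothesis oO : open Omega.
Hypothesis bdO : bounded_set Omega.
Hypothesis bO : piecewise_C1_boundary Omega gam n.
Variable U : set (R * R).
Hypothesis oU : open U.
Hypothesis sU : closure Omega `<=` U.

(** The integrand lives on a square of side [2 * e], whence the area [4 * e ^+ 2]. *)
Lemma small_integral (h : R * R -> R) (p : R * R) (e B : R) : 0 <= e -> 0 <= B ->
  (forall x, closure Omega x -> {for x, continuous h}) ->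
  (forall x, Omega x -> `|h x| <= B) ->
  (forall x, Omega x -> h x != 0 -> `|p - x| <= e) ->
  `|\int[mu2]_(x in Omega) h x| <= B * (4 * e ^+ 2).
Proof.
move=> e0 B0 ch hB hs.
pose box := `[p.1 - e, p.1 + e]%classic `*` `[p.2 - e, p.2 + e]%classic.
have mO : measurable (Omega : set (mR * mR)) by exact: omega_measurable.
have mb : measurable (box : set (mR * mR)) by exact: measurableX.
have mD : measurable (Omega `&` box : set (mR * mR)) by exact: measurableI.
have iO := omega_integrable oO bdO ch.
have iD : mu2.-integrable (Omega `&` box) (EFin \o h).
  by apply: (integrableS mO mD _ iO); exact: subIsetl.
have boxE : mu2 box = (4 * e ^+ 2)%:E.
  rewrite /box lebesgue2_box; first by congr EFin; ring.
    by rewrite lerBlDr -addrA lerDl addr_ge0.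
  by rewrite lerBlDr -addrA lerDl addr_ge0.
have Dbox : (mu2 (Omega `&` box) <= (4 * e ^+ 2)%:E)%E.
  rewrite -boxE; apply: le_measure; [by rewrite inE|by rewrite inE|].
  exact: subIsetr.
have Dfin : (mu2 (Omega `&` box) < +oo)%E by apply: le_lt_trans Dbox _; rewrite ltry.
have -> : \int[mu2]_(x in Omega) h x = \int[mu2]_(x in Omega `&` box) h x.
  rewrite Rintegral_mkcond [RHS]Rintegral_mkcond; apply: eq_Rintegral => x _; rewrite !patchE.
  have [Ox|nO] := pselect (Omega x); last first.
    rewrite ifF; last by apply/negP => /set_mem.
    by rewrite ifF//; apply/negP => /set_mem[].
  rewrite ifT; last exact/mem_set.
  have [->|hx] := eqVneq (h x) 0; first by case: ifP.
  rewrite ifT//; apply/mem_set; split => //.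
  have := hs x Ox hx; rewrite -[X in X <= _]/(Num.max `|p.1 - x.1| `|p.2 - x.2|) ge_max.
  by rewrite !ler_distlC => /andP[? ?]; split; rewrite /= in_itv.
apply: le_trans (le_normr_Rintegral mD iD) _.
have iB : mu2.-integrable (Omega `&` box) (EFin \o (fun=> B)).
  exact: (measurable_bounded_integrable mD Dfin (measurable_cst _) (bounded_cst _ _)).
apply: (@le_trans _ _ (\int[mu2]_(x in Omega `&` box) B)).
  apply: (le_Rintegral mD _ iB); first exact: integrable_norm.
  by move=> x [Ox _]; exact: hB.
rewrite Rintegral_cst//; apply: ler_wpM2l => //.
rewrite -lee_fin fineK//.
by rewrite ge0_fin_numE.
Qed.

(** Dominated convergence on []0, 1[]: there [gam k s] differs from [p], so the cutoff is eventually
    0 at each [s]. The end points, where the arc may reach [p], have measure zero. *)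
Lemma flux_shrink (f : R * R -> R) d (p : R * R) k (e : nat -> R) :
  (forall x, closure Omega x -> {for x, continuous f}) ->
  (forall s, s \in `]0, 1[ -> gam k s <> p) ->
  (forall m, 0 < e m) -> e m @[m --> \oo] --> 0 ->
  \int[mu]_(s in `[0, 1]) (plateau p (e m) (gam k s) * f (gam k s) * cross d (derive1 (gam k) s))
    @[m --> \oo] --> 0.
Proof.
move=> cf np e0 ecvg.
pose h m s := plateau p (e m) (gam k s) * f (gam k s) * cross d (derive1 (gam k) s).
have cpl m x : {for x, continuous (fun q => plateau p (e m) q * f q)} \/ ~ closure Omega x.
  have [Kx|nK] := pselect (closure Omega x); last by right.
  left; apply: continuousM_fun; last exact: cf.
  have [c _] := (Ck1P _ _).1 (Ck1_plateau p (e m)).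
  exact: c.
have ch m s : s \in `[0, 1] -> {for s, continuous (h m)}.
  apply: (@flux_continuous _ _ _ _ _ bO d (fun q => plateau p (e m) q * f q)) => x Kx.
  by case: (cpl m x).
have cg s : s \in `[0, 1] ->
    {for s, continuous (fun s => `|f (gam k s) * cross d (derive1 (gam k) s)|)}.
  move=> s01; have c := @flux_continuous _ _ _ _ _ bO d f k s cf s01.
  exact: (continuous_norm_at c).
have mI : measurable (`]0, 1[%classic : set mR) by [].
have oc : `]0, 1[%classic `<=` (`[0, 1]%classic : set R) by exact: subset_itv_oo_cc.
have ig : mu.-integrable `]0, 1[ (EFin \o (fun s => `|f (gam k s) * cross d (derive1 (gam k) s)|)).
  by apply: (integrableS _ mI oc (segment_integrable cg)).
have ih m : mu.-integrable `]0, 1[ (EFin \o h m).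
  by apply: (integrableS _ mI oc (segment_integrable (ch m))).
have hE m : \int[mu]_(s in `[0, 1]) h m s = fine (\int[mu]_(s in `]0%R, 1%R[) (h m s)%:E)%E.
  have i1 : mu.-integrable `]0, 1] (EFin \o h m).
    apply: (integrableS _ _ _ (segment_integrable (ch m))) => //.
    exact: subset_itv_oc_cc.
  by rewrite -(Rintegral_itv_obnd_cbnd i1) -(Rintegral_itv_bndo_bndc (ih m)).
have -> : (fun m => \int[mu]_(s in `[0, 1]) (plateau p (e m) (gam k s) * f (gam k s) * cross d (derive1 (gam k) s))) =
   (fun m => fine (\int[mu]_(s in `]0%R, 1%R[) (h m s)%:E)%E) by apply/funext => m; exact: hE.
suff cE : ((\int[mu]_(s in `]0%R, 1%R[) (h m s)%:E)%E @[m --> \oo] --> (0 : R)%:E) by exact: (fine_cvg cE).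
have dom := @dominated_cvg _ _ _ mu `]0, 1[%classic mI (fun m s => (h m s)%:E) (fun=> 0%E)
   (fun s => (`|f (gam k s) * cross d (derive1 (gam k) s)|)%:E).
rewrite (_ : 0%:E = (\int[mu]_(s in `]0%R, 1%R[) (fun=> 0) s)%E); last by rewrite integral0.
apply: dom => //.
- by move=> m; exact: (measurable_int _ (ih m)).
- move=> s s01; apply: cvg_near_cst.
  have d0 : 0 < `|p - gam k s|.
    by rewrite normr_gt0 subr_eq0 eq_sym; apply/eqP; exact: np.
  have /cvgr0_norm_lt/(_ _ d0) := ecvg.
  apply: filterS => m; rewrite gtr0_norm// => em.
  rewrite /h plateau_out ?mul0r//.
  by rewrite -ball_normE/= => /lt_trans/(_ em); rewrite ltxx.
- move=> m s s01; rewrite /= lee_fin /h -mulrA normrM ler_piMl//.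
  by have /andP[p0 p1] := plateau_itv p (e m) (gam k s); rewrite ger0_norm.
Qed.

(* The cutoff has a gradient of order [1 / e] on an area of order [e ^ 2]. *)
Lemma shrinking_defect (f : R * R -> R) d (p : R * R) : Ck 1 U f -> closure Omega p ->
  exists C e0 : R, [/\ 0 < C, 0 < e0 & forall e, 0 < e -> e < e0 ->
    Ck 1 setT (fun q => plateau p e q * f q) /\
    `|\int[mu2]_(q in Omega) 'D_d (fun q => plateau p e q * f q) q| <= C * e].
Proof.
move=> Cf Kp; have [cf df] := (Ck1P _ _).1 Cf.
have Up := sU Kp.
have [M0 M00 HM0] := plateau_derive_bounded d.
pose M := `|f p| + `|'D_d f p| + 1.
have M1 : 1 <= M by rewrite /M lerDr addr_ge0.
have M_gt0 : 0 < M by rewrite (lt_le_trans ltr01).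
have fM : \forall q \near p, `|f q| < M.
  apply: (cvgr_lt _ (continuous_norm_at (cf p Up))).
  by rewrite /M -addrA ltrDl ltr_wpDl.
have DM : \forall q \near p, `|'D_d f q| < M.
  apply: (cvgr_lt _ (continuous_norm_at (df d p Up).2)).
  by rewrite /M -addrA addrCA ltrDl ltr_wpDl.
have [r0 r00 Hr] := (nbhs_ballP _ _).1 (filterI (open_nbhs_nbhs (conj oU Up)) (filterI fM DM)).
have pU : ball p r0 `<=` U by move=> q /Hr[].
(* [M] bounds [f] and its derivative near [p], and [M0 / e] the derivative of the cutoff. The
   integral is at most [4 * M * e ^ 2 + 4 * M * M0 * e], and [e < 1] absorbs the first term. *)
exists (4 * M * (1 + M0)), (Num.min r0 1); split.
- by rewrite !mulr_gt0// ltr_wpDr.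
- by rewrite lt_min r00 ltr01.
move=> e e0; rewrite lt_min => /andP[er e1].
have CF := Ck1_cutoff oU e0 er pU Cf; split=> //.
have [cF dF] := (Ck1P _ _).1 CF.
have [_ dpl] := (Ck1P _ _).1 (Ck1_plateau p e).
have DF q : U q -> 'D_d (fun q => plateau p e q * f q) q =
    plateau p e q * 'D_d f q + f q * 'D_d (plateau p e) q.
  move=> Uq.
  exact: (@derive_val _ _ _ _ _ _ _ (is_deriveM_fun
    (derivableP (dpl d q I).1) (derivableP (df d q Uq).1))).
have Dout q : e < `|p - q| -> 'D_d (fun q => plateau p e q * f q) q = 0.
  move=> eq.
  have z y : [set y | e < `|p - y|] y -> plateau p e y * f y = 0.
    move=> /= ey; rewrite plateau_out ?mul0r//.
    by rewrite -ball_normE/= => /lt_trans/(_ ey); rewrite ltxx.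
  have [_ ->] := @derive_comp_near _ _ _ (fun q => plateau p e q * f q) (fun=> 0) _ d q
    (@open_far R p e) eq z.
  exact: derive_cst.
have B0 : 0 <= M + M * (M0 / e).
  have M_ge0 := ltW M_gt0; have e_ge0 := ltW e0.
  by rewrite addr_ge0// mulr_ge0// divr_ge0.
apply: (@le_trans _ _ ((M + M * (M0 / e)) * (4 * e ^+ 2))).
  apply: (@small_integral _ p) => //; first exact: ltW.
  - by move=> x _; exact: (dF d x I).2.
  - move=> x Ox; have [xe|xe] := ltP e `|p - x|; first by rewrite Dout// normr0.
    have /Hr[_ [f1 D1]] : ball p r0 x by rewrite -ball_normE/=; exact: le_lt_trans er.
    rewrite DF; last exact/sU/subset_closure.
    apply: le_trans (ler_normD _ _) _.
    rewrite (normrM (plateau p e x)) (normrM (f x)); apply: lerD.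
      have /andP[p0 p1] := plateau_itv p e x.
      by rewrite (ger0_norm p0); apply: le_trans (ltW D1); rewrite ler_piMl.
    by rewrite ler_pM//; [exact: ltW|exact: HM0].
  - by move=> x Ox; apply: contraNT; rewrite -ltNge => /Dout ->.
have -> : (M + M * (M0 / e)) * (4 * e ^+ 2) = 4 * M * (e * e) + 4 * M * M0 * e.
  by field; rewrite gt_eqF.
have -> : 4 * M * (1 + M0) * e = 4 * M * e + 4 * M * M0 * e by ring.
by rewrite lerD2r ler_pM2l ?mulr_gt0// ler_piMl// ltW.
Qed.

(** The defect of the formula is additive and, by hypothesis, zero for the part of [f] cut away from
    [p]. So for every small [e] it equals the defect of [plateau p e * f], whose integral and flux
    both tend to 0 with [e]. *)
Lemma Div_corner (f : R * R -> R) d (p : R * R) : Ck 1 U f -> closure Omega p ->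
  (forall k s, s \in `]0, 1[ -> gam k s <> p) ->
  (forall e, 0 < e -> Div Omega gam d (fun q => (1 + -1 * plateau p e q) * f q)) ->
  Div Omega gam d f.
Proof.
move=> Cf Kp np Hd.
have [C [e0 [C0 e00 HC]]] := shrinking_defect d Cf Kp.
pose e (m : nat) : R := e0 / 2 * (m.+1%:R)^-1.
have em0 m : 0 < e m by rewrite mulr_gt0 ?divr_gt0// invr_gt0.
have eme m : e m < e0.
  apply: (@le_lt_trans _ _ (e0 / 2)); last by rewrite ltr_pdivrMr// ltr_pMr// ltr1n.
  by rewrite ler_piMr ?divr_ge0 ?(ltW e00)// invf_le1// ler1n.
have ecvg : e m @[m --> \oo] --> 0.
  rewrite -[X in _ --> X](mulr0 (e0 / 2)).
  by apply: cvgM; [exact: cvg_cst|exact: cvg_harmonic].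
pose A := \int[mu2]_(q in Omega) 'D_d f q - flux gam d f.
pose F m := fun q => plateau p (e m) q * f q.
have AE m : A = \int[mu2]_(q in Omega) 'D_d (F m) q - flux gam d (F m).
  have CF := Ck_subset (@subsetT _ U) (HC _ (em0 m) (eme m)).1.
  have Cp := Ck_subset (@subsetT _ U) (Ck1_plateau p (e m)).
  have CG := Ck1M oU (Ck1D oU (@Ck1_cst R (R * R)%type U R 1)
    (Ck1M oU (@Ck1_cst R (R * R)%type U R (-1)) Cp)) Cf.
  have fE : f = (fun q => F m q + (1 + -1 * plateau p (e m) q) * f q).
    by apply/funext => q; rewrite /F; ring.
  have I1 := omega_integralD oO bdO sU d CF CG.
  have I2 := fluxD bO sU d CF CG.
  rewrite /A {1 2}fE I1 I2 (Hd _ (em0 m)) /F; ring.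
have fluxc : flux gam d (F m) @[m --> \oo] --> 0.
  rewrite -[X in _ --> X](@big1 _ 0 +%R _ (index_enum 'I_N) xpredT (fun=> 0))//.
  rewrite /flux; apply: cvg_big => [|k _]; first exact: add_continuous.
  apply: flux_shrink => //; last by move=> s; exact: np.
  by have [cf _] := (Ck1P _ _).1 Cf => x /sU; exact: cf.
have Dc : \int[mu2]_(q in Omega) 'D_d (F m) q @[m --> \oo] --> 0.
  apply: norm_cvg0.
  apply: (@squeeze_cvgr _ _ _ _ (fun=> 0) (fun m => C * e m)).
  - by apply: nearW => m; rewrite normr_ge0 (HC _ (em0 m) (eme m)).2.
  - exact: cvg_cst.
  - by rewrite -[X in _ --> X](mulr0 C); apply: cvgM => //; exact: cvg_cst.
have A0 : A = 0.
  have c1 := cvgB Dc fluxc; rewrite subr0 in c1.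
  have c2 : (fun m => \int[mu2]_(q in Omega) 'D_d (F m) q - flux gam d (F m)) = (fun=> A).
    by apply/funext => m; rewrite -AE.
  have c3 : A @[m --> \oo] --> 0 by rewrite -c2; exact: c1.
  exact: (cvg_unique (@Rhausdorff R) (@cvg_cst _ A _ \oo _) c3).
by move: A0; rewrite /A /Div => /eqP; rewrite subr_eq0 => /eqP.
Qed.

(** [ps] lists the end points near which [f] may be nonzero. Each inductive step cuts one of them
    off and concludes by [Div_corner], an end point never being interior to an arc; with the list
    exhausted, [Div2_away] applies. *)
Lemma Div2_endpoints (ps : seq (R * R)) : (forall p, p \in ps -> endpoint gam p) ->
  forall f : R * R -> R, Ck 1 U f ->
  (forall p, endpoint gam p ->
     p \in ps \/ exists2 e, 0 < e & forall q, ball p e q -> f q = 0) ->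
  Div Omega gam e1 f /\ Div Omega gam e2 f.
Proof.
elim: ps => [|p ps IH] Hps f Cf f0.
  by apply: (Div2_away oO bdO bO oU sU Cf) => p /f0[].
have [k pE] := Hps p (mem_head _ _).
have [s' s'01 pE'] : exists2 s, s \in `[0, 1] & p = gam k s.
  by case: pE => ->; [exists 0|exists 1]; rewrite // in_itv/= ?lexx ler01.
have Kp : closure Omega p by rewrite pE'; exact: (closure_gam bO s'01).
have np l s : s \in `]0, 1[ -> gam l s <> p.
  have [_ _ inj _ _] := bO => s01 E.
  have i0 : (0 : R) \in `[0, 1] by rewrite in_itv/= lexx ler01.
  have i1 : (1 : R) \in `[0, 1] by rewrite in_itv/= lexx ler01.
  case: pE => pE; rewrite pE in E.
    have [_ sE] := inj k l 0 s i0 s01 (esym E).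
    by move: s01; rewrite -sE in_itv/= ltxx.
  have [_ sE] := inj k l 1 s i1 s01 (esym E).
  by move: s01; rewrite -sE in_itv/= ltxx andbF.
have cut e : 0 < e -> Div Omega gam e1 (fun q => (1 + -1 * plateau p e q) * f q) /\
    Div Omega gam e2 (fun q => (1 + -1 * plateau p e q) * f q).
  move=> e0; apply: IH.
  - by move=> q qps; apply: Hps; rewrite inE qps orbT.
  - exact: (Ck1M oU (Ck1D oU (@Ck1_cst R (R * R)%type U R 1)
      (Ck1M oU (@Ck1_cst R (R * R)%type U R (-1))
        (Ck_subset (@subsetT _ U) (Ck1_plateau p e)))) Cf).
  - move=> q /f0[|[e' e'0 He']]; last by right; exists e' => // y /He' ->; rewrite mulr0.
    rewrite inE => /orP[/eqP ->|]; last by left.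
    right; exists (e / 2); first by rewrite divr_gt0.
    by move=> y yp; rewrite plateau_in// mulr1 subrr mul0r.
by split; apply: (Div_corner Cf Kp np) => e /cut[].
Qed.

Theorem divergence_theorem (F1 F2 : R * R -> R) : Ck 1 U F1 -> Ck 1 U F2 ->
  \int[mu2]_(p in Omega) ('D_e1 F1 p + 'D_e2 F2 p) =
  \sum_(k < N) \int[mu]_(s in `[0, 1]) (F1 (gam k s) * (derive1 (gam k) s).2
                                       - F2 (gam k s) * (derive1 (gam k) s).1).
Proof.
move=> C1 C2.
pose ps := [seq gam k 0 | k <- enum 'I_N] ++ [seq gam k 1 | k <- enum 'I_N].
have psP p : endpoint gam p <-> p \in ps.
  rewrite mem_cat; split=> [[k [->|->]]|/orP[/mapP[k _ ->]|/mapP[k _ ->]]].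
  - by apply/orP; left; apply: map_f; rewrite mem_enum.
  - by apply/orP; right; apply: map_f; rewrite mem_enum.
  - by exists k; left.
  - by exists k; right.
have H f (Cf : Ck 1 U f) := Div2_endpoints (fun p => (psP p).2) Cf (fun p ep => or_introl ((psP p).1 ep)).
have [D1 _] := H F1 C1; have [_ D2] := H F2 C2.
have [c1 d1] := (Ck1P _ _).1 C1; have [c2 d2] := (Ck1P _ _).1 C2.
have i1 : mu2.-integrable Omega (EFin \o 'D_e1 F1).
  by apply: (omega_integrable oO bdO) => x /sU Ux; exact: (d1 e1 x Ux).2.
have i2 : mu2.-integrable Omega (EFin \o 'D_e2 F2).
  by apply: (omega_integrable oO bdO) => x /sU Ux; exact: (d2 e2 x Ux).2.
rewrite (RintegralD (omega_measurable oO) i1 i2) D1 D2 /flux -big_split/=.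
apply: eq_bigr => k _.
have mI : measurable (`[0, 1]%classic : set mR) by [].
have j1 : mu.-integrable `[0, 1] (EFin \o (fun s => F1 (gam k s) * cross e1 (derive1 (gam k) s))).
  by apply: segment_integrable => s; apply: (flux_continuous bO) => x /sU; exact: c1.
have j2 : mu.-integrable `[0, 1] (EFin \o (fun s => F2 (gam k s) * cross e2 (derive1 (gam k) s))).
  by apply: segment_integrable => s; apply: (flux_continuous bO) => x /sU; exact: c2.
rewrite -(RintegralD mI j1 j2).
by apply: eq_Rintegral => s _; rewrite /cross/=; ring.
Qed.

End corners.

(** * Energy balance *)

Section slices.
Context {R : realType}.

Lemma slice_quotient {W : normedModType R} (f : (R * R) * R -> W) (v x : R * R) (t : R) :
  (fun h : R => h^-1 *: ((fun y => f (y, t)) (h *: v + x) - (fun y => f (y, t)) x)) =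
  (fun h : R => h^-1 *: (f (h *: ((v, 0) : (R * R) * R) + (x, t)) - f (x, t))).
Proof.
apply/funext => h; congr (_ *: (f _ - _)).
by apply: injective_projections; rewrite //= [h *: (0 : R)]mulr0 add0r.
Qed.

Lemma slice_derivable {W : normedModType R} (f : (R * R) * R -> W) (v x : R * R) (t : R) :
  derivable (fun y => f (y, t)) x v = derivable f (x, t) ((v, 0) : (R * R) * R).
Proof. by rewrite /derivable slice_quotient. Qed.

Lemma slice_derive {W : normedModType R} (f : (R * R) * R -> W) (v x : R * R) (t : R) :
  'D_v (fun y => f (y, t)) x = 'D_((v, 0) : (R * R) * R) f (x, t).
Proof. by rewrite /derive slice_quotient. Qed.

Lemma slice_continuous {T : topologicalType} (f : (R * R) * R -> T) (x : R * R) (t : R) :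
  {for (x, t), continuous f} -> {for x, continuous (fun y => f (y, t))}.
Proof.
move=> cf; apply: (@continuous_comp_at _ _ _ (fun y => (y, t)) f) => //.
by apply: continuous_pair; [exact: continuous_at_id|exact: continuous_cst].
Qed.

Lemma slice_time_continuous {T : topologicalType} (f : (R * R) * R -> T) (x : R * R) (t : R) :
  {for (x, t), continuous f} -> {for t, continuous (fun s => f (x, s))}.
Proof.
move=> cf; apply: (@continuous_comp_at _ _ _ (fun s => (x, s)) f) => //.
by apply: continuous_pair; [exact: continuous_cst|exact: continuous_at_id].
Qed.

Lemma Ck1_slice (U : set ((R * R) * R)) (f : (R * R) * R -> R) (t : R) :
  Ck 1 U f -> Ck 1 [set x | U (x, t)] (fun x => f (x, t)).
Proof.
move=> /Ck1P[cf df]; apply/Ck1P; split=> [x Ux|v x Ux].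
  by apply: slice_continuous; exact: cf.
split; first by rewrite slice_derivable; exact: (df (v, 0) _ Ux).1.
have -> : (fun y => 'D_v (fun y => f (y, t)) y) =
    (fun y => 'D_((v, 0) : (R * R) * R) f (y, t)).
  by apply/funext => y; exact: slice_derive.
by apply: (slice_continuous (f := 'D_((v, 0) : (R * R) * R) f)); exact: (df (v, 0) _ Ux).2.
Qed.

Lemma open_slice (U : set ((R * R) * R)) (t : R) : open U -> open [set x | U (x, t)].
Proof.
move=> oU; apply: (@open_comp _ _ (fun x => (x, t)) U) => // x _.
by apply: continuous_pair; [exact: continuous_at_id|exact: continuous_cst].
Qed.

Lemma Ck1_lift (U : set (R * R)) (f : R * R -> R) : Ck 1 U f ->
  Ck 1 [set z : (R * R) * R | U z.1] (fun z => f z.1).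
Proof.
move=> /Ck1P[cf df]; apply/Ck1P; split=> [z Uz|v z Uz].
  apply: (@continuous_comp_at _ _ _ (fun z : (R * R) * R => z.1) f); first exact: continuous_fst.
  exact: cf.
have E (y : (R * R) * R) : (fun h : R => h^-1 *: ((fun z : (R * R) * R => f z.1) (h *: v + y) - f y.1)) =
   (fun h : R => h^-1 *: (f (h *: v.1 + y.1) - f y.1)) by [].
split; first by rewrite /derivable E; exact: (df v.1 _ Uz).1.
have -> : (fun y => 'D_v (fun z : (R * R) * R => f z.1) y) = (fun y => 'D_(v.1) f y.1).
  by apply/funext => y; rewrite /derive E.
apply: (@continuous_comp_at _ _ _ (fun z : (R * R) * R => z.1) ('D_(v.1) f)).
  exact: continuous_fst.
exact: (df v.1 _ Uz).2.
Qed.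

Lemma pdt_lift (f : R * R -> R) z : pdt (fun z : (R * R) * R => f z.1) z = 0.
Proof.
rewrite /pdt /derive.
have -> : (fun h : R => h^-1 *: ((fun z : (R * R) * R => f z.1)
    (h *: (((0, 0), 1) : (R * R) * R) + z) - f z.1)) = (fun=> 0).
  apply/funext => h /=.
  have -> : h *: ((0, 0) : R * R) + z.1 = z.1.
    by apply: injective_projections; rewrite /= scaler0 add0r.
  by rewrite subrr scaler0.
exact: lim_cst.
Qed.

End slices.

(** * Line integrals over measurable parts of the boundary *)

Section line_integrals.
Context {R : realType}.
Local Notation mR := (measurableTypeR R).
Local Notation mu := (@lebesgue_measure R).
Variables (Omega : set (R * R)) (N : nat) (gam : 'I_N -> R -> R * R) (n : R * R -> R * R).
Hypothesis bO : piecewise_C1_boundary Omega gam n.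

(** [gam k] is known to be continuous on [[0, 1]] only. Precomposing it with the clamping onto
    [[0, 1]] gives a map continuous on the whole line, hence measurable. *)
Lemma arc_preimage_measurable k (G : set (R * R)) : measurable (G : set (mR * mR)) ->
  exists2 S : set R, measurable (S : set mR) &
    forall s, s \in `[0, 1] -> (S s <-> G (gam k s)).
Proof.
move=> mG.
pose clamp (s : R) := Num.max 0 (Num.min 1 s).
have clampE s : s \in `[0, 1] -> clamp s = s.
  by rewrite in_itv/= /clamp => /andP[s0 s1]; rewrite min_r// max_r.
have clamp_in s : clamp s \in `[0, 1].
  by rewrite in_itv/= /clamp le_max lexx ge_max ler01 ge_min lexx.
have cc : continuous clamp.
  move=> s.
  have c1 : {for s, continuous (fun z : R => Num.min 1 z)}.
    exact: (continuous_min (@continuous_cst R R 1 s) (@continuous_at_id R s)).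
  exact: (continuous_max (@continuous_cst R R 0 s) c1).
have cg s : {for s, continuous (fun s => gam k (clamp s))}.
  exact: (continuous_comp_at (cc s) (gam_continuous bO (k := k) (clamp_in s))).
have m1 : measurable_fun setT (fun s : mR => (gam k (clamp s)).1 : mR).
  by apply: continuous_measurable_fun => s; exact: (continuous_fst_at (cg s)).
have m2 : measurable_fun setT (fun s : mR => (gam k (clamp s)).2 : mR).
  by apply: continuous_measurable_fun => s; exact: (continuous_snd_at (cg s)).
have mg := measurable_fun_pair m1 m2.
exists ((fun s => ((gam k (clamp s)).1, (gam k (clamp s)).2)) @^-1` G).
  by have := mg measurableT _ mG; rewrite setTI.
by move=> s s01; rewrite /preimage/= clampE//; case: (gam k s).
Qed.

Lemma arc_set_measurable k (G : set (R * R)) : measurable (G : set (mR * mR)) ->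
  measurable (`]0, 1[%classic `&` gam k @^-1` G : set mR).
Proof.
move=> mG; have [S mS SE] := arc_preimage_measurable k mG.
have -> : `]0, 1[%classic `&` gam k @^-1` G = `]0, 1[%classic `&` S.
  by apply/seteqP; split=> s [s01 Gs]; split=> //; apply/(SE s (subset_itv_oo_cc s01)).
exact: measurableI.
Qed.

(** The integrands of the line integrals contain [n], about which nothing is known at the end
    points; these have measure zero and are dropped. *)
Lemma Rintegral_open_segment (D : set R) (f : R -> R) :
  measurable_fun (`]0, 1[%classic : set mR) (f \_ D : mR -> mR) ->
  \int[mu]_(s in `[0, 1] `&` D) f s = \int[mu]_(s in `]0, 1[ `&` D) f s.
Proof.
move=> mf; rewrite /Rintegral; congr fine.
rewrite integral_mkcondr [RHS]integral_mkcondr.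
have E : (fun x => ((fun s => (f s)%:E) \_ D) x) = (fun x => ((f \_ D) x)%:E).
  by apply/funext => x; rewrite !patchE; case: ifP.
have mE : measurable_fun (`]0, 1[%classic : set mR) (fun x => ((f \_ D) x)%:E).
  exact/measurable_EFinP.
rewrite (_ : ((fun s => (f s)%:E) \_ D) = (fun x => ((f \_ D) x)%:E)) //.
rewrite [RHS]integral_itv_bndo_bndc//.
rewrite [RHS]integral_itv_obnd_cbnd//.
by apply/measurable_EFinP; exact: (measurable_fun_itv_oc mf).
Qed.

(** Replaces an integrand containing [n] by a continuous function of the parameter, from which
    measurability is obtained. *)
Lemma line_integralE (G : set (R * R)) (f : R * R -> R) (h : 'I_N -> R -> R) :
  measurable (G : set (mR * mR)) ->
  (forall k s, s \in `[0, 1] -> {for s, continuous (h k)}) ->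
  (forall k s, s \in `]0, 1[ -> G (gam k s) ->
     f (gam k s) * Num.sqrt (sqnorm (derive1 (gam k) s)) = h k s) ->
  line_integral gam G f = \sum_(k < N) \int[mu]_(s in `]0, 1[ `&` gam k @^-1` G) h k s.
Proof.
move=> mG ch fh; rewrite /line_integral; apply: eq_bigr => k _.
have [S mS SE] := arc_preimage_measurable k mG.
rewrite Rintegral_open_segment.
  by apply: eq_Rintegral => s /set_mem[s01 Gs]; exact: fh.
have mh : measurable_fun (`]0, 1[%classic : set mR) (h k \_ S : mR -> mR).
  apply/(measurable_restrict _ _ _) => //.
  apply: measurable_funS (_ : measurable_fun (`]0, 1[%classic : set mR) (h k : mR -> mR)) => //.
  apply: open_continuous_measurable_fun; first exact: interval_open.
  by move=> s /set_mem/subset_itv_oo_cc; exact: ch.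
apply: eq_measurable_fun mh => s /set_mem s01; rewrite !patchE.
have Ss := SE s (subset_itv_oo_cc s01).
have -> : (s \in gam k @^-1` G) = (s \in S).
  by apply/idP/idP => /set_mem /Ss /mem_set.
by case: ifPn => // /set_mem/Ss Gs; rewrite fh.
Qed.

End line_integrals.

(** Uniqueness of limits along [S]. It carries identities that are given for interior points or
    times in []0, T[] to the closure. *)
Lemma eq_on_closure {R : realType} {T : topologicalType} (S Q : set T) (f g : T -> R) z :
  S `<=` Q -> {within Q, continuous f} -> {within Q, continuous g} ->
  (forall y, S y -> f y = g y) -> Q z -> closure S z -> f z = g z.
Proof.
move=> SQ cf cg fg Qz Sz.
have PF : ProperFilter (within S (nbhs z)) by apply: within_nbhs_proper.
have c (h : T -> R) : {within Q, continuous h} -> h y @[y --> within S (nbhs z)] --> h z.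
  move=> ch; have := (subspace_continuousP _ _).1 ch z Qz.
  by apply: cvg_trans; apply: cvg_app; apply: within_subset.
have cf' := c _ cf; have cg' := c _ cg.
have cfg : f y @[y --> within S (nbhs z)] --> g z.
  apply: cvg_trans cg'; apply: near_eq_cvg.
  by apply: (filterS (P := S)); [move=> y /fg|exact: withinT].
exact: (cvg_unique (@Rhausdorff R) cf' cfg).
Qed.

Lemma closure_itvoo {R : realType} (T t : R) : 0 < T -> t \in `[0, T] ->
  closure (`]0, T[%classic : set R) t.
Proof.
rewrite in_itv/= => T0 /andP[t0 tT] B /nbhs_ballP[e e0 tB].
rewrite /= in e0.
(* The point [t] is moved towards the midpoint [T / 2] by the fraction [l], over a distance at most
   [l * T], hence less than [e]. *)
pose l := Num.min (1 / 2) (e / (2 * T)).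
have T2 : 0 < 2 * T by rewrite mulr_gt0.
have l0 : 0 < l by rewrite lt_min !divr_gt0.
have l1 : l <= 1 / 2 by rewrite ge_min lexx.
have l2 : l * (2 * T) <= e by rewrite -ler_pdivlMr// ge_min lexx orbT.
exists (t + l * (T / 2 - t)); split.
  rewrite /= in_itv/=; apply/andP; split; nra.
apply: tB; rewrite -ball_normE/= opprD addNKr normrN normrM gtr0_norm//.
have : `|T / 2 - t| <= T by rewrite ler_norml; apply/andP; split; lra.
nra.
Qed.

Lemma closure_setX {T1 T2 : topologicalType} (A : set T1) (B : set T2) x y :
  closure A x -> closure B y -> closure (A `*` B) (x, y).
Proof.
move=> Ax By W [[W1 W2] [/= n1 n2] sW].
have [x' [Ax' Wx']] := Ax _ n1; have [y' [By' Wy']] := By _ n2.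
by exists (x', y'); split=> //; apply: sW.
Qed.

Section transmission_sign.
Context {R : realType}.

(* With [c = c0 sqrt (g zeta)], so that [phi w = c eta], the left-hand side is
   [- rho c eta^2 g (c0^2 zeta eta + 2 phi^2) / (2 phi^2)]. *)
Lemma transmission_sign (rho g c0 alpha phi eta zeta w : R) :
  0 < rho -> 0 < g -> 0 < c0 -> 0 < alpha < 1 ->
  c0 <= Num.sqrt (2 / alpha) * (1 - alpha) ->
  0 < zeta -> 0 < phi -> phi = eta + zeta -> - alpha * zeta <= eta ->
  w = c0 * Num.sqrt (g * zeta) * (eta / phi) ->
  - (rho / 2) * (phi * (w * w) * w) + - (rho * g) * (phi * eta * w) <= 0.
Proof.
move=> r0 g0 c00 /andP[a0 a1] cle z0 p0 pE eta_ge wE.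
pose c := c0 * Num.sqrt (g * zeta).
have c_gt0 : 0 < c by rewrite mulr_gt0// sqrtr_gt0 mulr_gt0.
have cc : c ^+ 2 = c0 ^+ 2 * (g * zeta).
  by rewrite exprMn sqr_sqrtr// ltW// mulr_gt0.
have ac : alpha * c0 ^+ 2 <= 2 * (1 - alpha) ^+ 2.
  have : c0 ^+ 2 <= (Num.sqrt (2 / alpha) * (1 - alpha)) ^+ 2.
    by rewrite ler_pXn2r// nnegrE; [exact: ltW|exact: le_trans (ltW c00) cle].
  have q0 : 0 <= 2 / alpha by rewrite divr_ge0// ltW.
  rewrite exprMn sqr_sqrtr// => /(ler_wpM2l (ltW a0)).
  have -> // : alpha * (2 / alpha * (1 - alpha) ^+ 2) = 2 * (1 - alpha) ^+ 2.
  by field; rewrite gt_eqF.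
(* For [eta < 0]: [c0^2 zeta eta >= - alpha c0^2 zeta^2 >= - 2 (1 - alpha)^2 zeta^2 >= - 2
   phi^2]. *)
have key : 0 <= c0 ^+ 2 * (zeta * eta) + 2 * phi ^+ 2.
  have [e0|e0] := leP 0 eta.
    by rewrite addr_ge0// ?mulr_ge0// ?sqr_ge0// ltW.
  have h1 : (1 - alpha) * zeta <= phi by rewrite pE; lra.
  have h2 : ((1 - alpha) * zeta) ^+ 2 <= phi ^+ 2.
    by rewrite ler_pXn2r// nnegrE; [rewrite mulr_ge0 ?subr_ge0// ltW|exact: ltW].
  have h3 : - (alpha * zeta ^+ 2) <= zeta * eta.
    by rewrite expr2; have := ler_wpM2l (ltW z0) eta_ge; lra.
  have h4 := ler_wpM2l (sqr_ge0 c0) h3.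
  have h5 := ler_wpM2r (sqr_ge0 zeta) ac.
  rewrite exprMn in h2; lra.
rewrite -/c in wE.
have phin : phi != 0 by rewrite gt_eqF.
have -> : - (rho / 2) * (phi * (w * w) * w) + - (rho * g) * (phi * eta * w) =
   - ((rho * c * eta ^+ 2 * g) * ((c0 ^+ 2 * (zeta * eta) + 2 * phi ^+ 2) / (2 * phi ^+ 2))).
  have -> : phi * (w * w) * w = c ^+ 2 * (c * eta ^+ 3 / phi ^+ 2) by rewrite wE; field.
  by rewrite cc wE; field.
rewrite oppr_le0 mulr_ge0//.
  apply: mulr_ge0; last exact: ltW.
  by apply: mulr_ge0; [apply: mulr_ge0; exact: ltW|exact: sqr_ge0].
by rewrite divr_ge0// mulr_ge0// sqr_ge0.
Qed.

End transmission_sign.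

(* The momentum equations are multiplied by [a] and [b]; what is left of the
   flux divergence is the viscous dissipation [2 mu phi |D(u)|^2]. *)
Lemma dissipation_algebra {R : realType} (rho mu g p a b pt at_ bt p1 p2 a1 a2 b1 b2 h z1 z2
    P11 P12 P21 P22 : R) : 0 < mu -> 0 <= p ->
  pt = - (p * a1 + a * p1 + (p * b2 + b * p2)) ->
  rho * p * (at_ + (a * a1 + b * a2)) - 2 * mu * (P11 + P12) + rho * g * p * (p1 - z1) = 0 ->
  rho * p * (bt + (a * b1 + b * b2)) - 2 * mu * (P21 + P22) + rho * g * p * (p2 - z2) = 0 ->
  rho / 2 * (pt * (a * a + b * b)) + rho * p * (a * at_ + b * bt) + rho * g * ((p - h) * pt) <=
  (- (rho / 2) * ((a * a + b * b) * (p1 * a + p * a1) + p * a * 2 * (a * a1 + b * b1)) +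
   - (rho * g) * ((p - h) * (p1 * a + p * a1) + p * a * (p1 - z1)) +
   2 * mu * (P11 * a + p * (2^-1 * (a1 + a1)) * a1 + P21 * b + p * (2^-1 * (b1 + a2)) * b1)) +
  (- (rho / 2) * ((a * a + b * b) * (p2 * b + p * b2) + p * b * 2 * (a * a2 + b * b2)) +
   - (rho * g) * ((p - h) * (p2 * b + p * b2) + p * b * (p2 - z2)) +
   2 * mu * (P12 * a + p * (2^-1 * (a2 + b1)) * a2 + P22 * b + p * (2^-1 * (b2 + b2)) * b2)).
Proof.
move=> mu0 p0 -> mA mB; rewrite -subr_ge0.
set X := (X in 0 <= X).
(* The bracket is [|D(u)|^2]. Adding [a] and [b] times the momentum equations, which are 0, makes
   this a rational identity in the variables. *)
have -> : X = 2 * mu * (p * (a1 ^+ 2 + b2 ^+ 2 + 2^-1 * (a2 + b1) ^+ 2)).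
  transitivity (X + a * (rho * p * (at_ + (a * a1 + b * a2)) - 2 * mu * (P11 + P12) +
      rho * g * p * (p1 - z1)) + b * (rho * p * (bt + (a * b1 + b * b2)) -
      2 * mu * (P21 + P22) + rho * g * p * (p2 - z2))).
    by rewrite mA mB !mulr0 !addr0.
  by rewrite /X; field.
apply: mulr_ge0; first by rewrite mulr_ge0// ltW.
apply: mulr_ge0 => //.
by rewrite !addr_ge0 ?sqr_ge0// mulr_ge0// sqr_ge0.
Qed.

(** * The pointwise energy balance *)

Section energy_balance.
Context {R : realType}.
Local Notation d1 := (((1, 0), 0) : (R * R) * R).
Local Notation d2 := (((0, 1), 0) : (R * R) * R).
Local Notation dt := (((0, 0), 1) : (R * R) * R).
Variables (rho mu g : R) (phi : (R * R) * R -> R) (u : (R * R) * R -> R * R) (zeta : R * R -> R).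
Local Notation a := (fun z => (u z).1).
Local Notation b := (fun z => (u z).2).
Local Notation S11 := (fun z => (strain u z).1.1).
Local Notation S12 := (fun z => (strain u z).1.2).
Local Notation S21 := (fun z => (strain u z).2.1).
Local Notation S22 := (fun z => (strain u z).2.2).

(** [eta] is not assumed differentiable, so it is replaced here and in the fluxes by [phi - zeta];
    the form [phi + -1 * zeta] fits the closure of C^1 functions under sums and products. *)
Definition edens (z : (R * R) * R) : R :=
  rho / 2 * (phi z * (a z * a z + b z * b z)) +
  rho * g / 2 * ((phi z + -1 * zeta z.1) * (phi z + -1 * zeta z.1)).

Definition eflux1 (z : (R * R) * R) : R :=
  - (rho / 2) * (phi z * (a z * a z + b z * b z) * a z) +
  - (rho * g) * (phi z * (phi z + -1 * zeta z.1) * a z) +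
  2 * mu * (phi z * S11 z * a z + phi z * S21 z * b z).

Definition eflux2 (z : (R * R) * R) : R :=
  - (rho / 2) * (phi z * (a z * a z + b z * b z) * b z) +
  - (rho * g) * (phi z * (phi z + -1 * zeta z.1) * b z) +
  2 * mu * (phi z * S12 z * a z + phi z * S22 z * b z).

Variable V : set ((R * R) * R).
Hypothesis oV : open V.
Hypothesis Cphi : Ck 1 V phi.
Hypothesis Cu : Ck 2 V u.
Hypothesis Czeta : Ck 1 V (fun z : (R * R) * R => zeta z.1).

Let Ca : Ck 2 V a. Proof. exact: Ck_fst. Qed.
Let Cb : Ck 2 V b. Proof. exact: Ck_snd. Qed.
Let Ca1 : Ck 1 V a. Proof. exact: CkW. Qed.
Let Cb1 : Ck 1 V b. Proof. exact: CkW. Qed.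
Let cst (c : R) : Ck 1 V (fun _ : (R * R) * R => c). Proof. exact: Ck1_cst. Qed.
Let Cd (f : (R * R) * R -> R) v : Ck 2 V f -> Ck 1 V ('D_v f).
Proof. by move=> [_ /(_ v)[]]. Qed.

Let CS11 : Ck 1 V S11.
Proof. exact: (Ck1M oV (cst 2^-1) (Ck1D oV (Cd d1 Ca) (Cd d1 Ca))). Qed.
Let CS12 : Ck 1 V S12.
Proof. exact: (Ck1M oV (cst 2^-1) (Ck1D oV (Cd d2 Ca) (Cd d1 Cb))). Qed.
Let CS21 : Ck 1 V S21.
Proof. exact: (Ck1M oV (cst 2^-1) (Ck1D oV (Cd d1 Cb) (Cd d2 Ca))). Qed.
Let CS22 : Ck 1 V S22.
Proof. exact: (Ck1M oV (cst 2^-1) (Ck1D oV (Cd d2 Cb) (Cd d2 Cb))). Qed.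

Let Caabb := Ck1D oV (Ck1M oV Ca1 Ca1) (Ck1M oV Cb1 Cb1).
Let Ceta := Ck1D oV Cphi (Ck1M oV (cst (-1)) Czeta).

Lemma Ck1_kinetic : Ck 1 V (fun z => rho / 2 * (phi z * (a z * a z + b z * b z))).
Proof. exact: (Ck1M oV (cst (rho / 2)) (Ck1M oV Cphi Caabb)). Qed.

Lemma Ck1_potential : Ck 1 V (fun z => rho * g / 2 *
  ((phi z + -1 * zeta z.1) * (phi z + -1 * zeta z.1))).
Proof. exact: (Ck1M oV (cst (rho * g / 2)) (Ck1M oV Ceta Ceta)). Qed.

Lemma Ck1_kinetic_flux w : Ck 1 V w ->
  Ck 1 V (fun z => phi z * (a z * a z + b z * b z) * w z).
Proof. by move=> Cw; exact: (Ck1M oV (Ck1M oV Cphi Caabb) Cw). Qed.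

Lemma Ck1_potential_flux w : Ck 1 V w ->
  Ck 1 V (fun z => phi z * (phi z + -1 * zeta z.1) * w z).
Proof. by move=> Cw; exact: (Ck1M oV (Ck1M oV Cphi Ceta) Cw). Qed.

Lemma Ck1_viscous_flux1 : Ck 1 V (fun z => phi z * S11 z * a z + phi z * S21 z * b z).
Proof. exact: (Ck1D oV (Ck1M oV (Ck1M oV Cphi CS11) Ca1) (Ck1M oV (Ck1M oV Cphi CS21) Cb1)). Qed.

Lemma Ck1_viscous_flux2 : Ck 1 V (fun z => phi z * S12 z * a z + phi z * S22 z * b z).
Proof. exact: (Ck1D oV (Ck1M oV (Ck1M oV Cphi CS12) Ca1) (Ck1M oV (Ck1M oV Cphi CS22) Cb1)). Qed.

Lemma Ck1_edens : Ck 1 V edens.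
Proof. exact: (Ck1D oV Ck1_kinetic Ck1_potential). Qed.

Lemma Ck1_eflux1 : Ck 1 V eflux1.
Proof.
exact: (Ck1D oV (Ck1D oV
  (Ck1M oV (cst (- (rho / 2))) (Ck1_kinetic_flux Ca1))
  (Ck1M oV (cst (- (rho * g))) (Ck1_potential_flux Ca1)))
  (Ck1M oV (cst (2 * mu)) Ck1_viscous_flux1)).
Qed.

Lemma Ck1_eflux2 : Ck 1 V eflux2.
Proof.
exact: (Ck1D oV (Ck1D oV
  (Ck1M oV (cst (- (rho / 2))) (Ck1_kinetic_flux Cb1))
  (Ck1M oV (cst (- (rho * g))) (Ck1_potential_flux Cb1)))
  (Ck1M oV (cst (2 * mu)) Ck1_viscous_flux2)).
Qed.

Let D (f : (R * R) * R -> R) z v : Ck 1 V f -> V z -> is_derive z v f ('D_v f z).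
Proof. by move=> /Ck1P[_ df] Vz; apply/derivableP; exact: (df v z Vz).1. Qed.

Let Dcst (c : R) z v : is_derive z v (fun _ : (R * R) * R => c) 0.
Proof. exact: is_derive_cst. Qed.

Lemma pdt_edens z : V z -> pdt edens z =
  rho / 2 * (pdt phi z * (a z * a z + b z * b z)) + rho * phi z * (a z * pdt a z + b z * pdt b z) +
  rho * g * ((phi z - zeta z.1) * pdt phi z).
Proof.
move=> Vz.
have Dp := D dt Cphi Vz; have Da := D dt Ca1 Vz; have Db := D dt Cb1 Vz.
have Dz := D dt Czeta Vz.
have Daabb := is_deriveD_fun (is_deriveM_fun Da Da) (is_deriveM_fun Db Db).
have De := is_deriveD_fun Dp (is_deriveM_fun (Dcst (-1) z dt) Dz).
have H := is_deriveD_fun (is_deriveM_fun (Dcst (rho / 2) z dt) (is_deriveM_fun Dp Daabb))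
  (is_deriveM_fun (Dcst (rho * g / 2) z dt) (is_deriveM_fun De De)).
rewrite /pdt [LHS](@derive_val _ _ _ _ _ _ _ H).
have := pdt_lift zeta z; rewrite /pdt => ->.
by field.
Qed.

(** Both components of the energy flux have this shape: [w] is the velocity component along [v], and
    [c1], [c2] are the entries of the corresponding column of [phi D(u)]. *)
Let Dflux v z (c1 c2 : (R * R) * R -> R) (w : (R * R) * R -> R) : V z ->
  Ck 1 V c1 -> Ck 1 V c2 -> Ck 1 V w ->
  is_derive z v (fun z => - (rho / 2) * (phi z * (a z * a z + b z * b z) * w z) +
      - (rho * g) * (phi z * (phi z + -1 * zeta z.1) * w z) +
      2 * mu * (c1 z * a z + c2 z * b z))
   (- (rho / 2) * ((a z * a z + b z * b z) * ('D_v phi z * w z + phi z * 'D_v w z) +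
        phi z * w z * 2 * (a z * 'D_v a z + b z * 'D_v b z)) +
    - (rho * g) * ((phi z - zeta z.1) * ('D_v phi z * w z + phi z * 'D_v w z) +
        phi z * w z * ('D_v phi z - 'D_v (fun z : (R * R) * R => zeta z.1) z)) +
    2 * mu * ('D_v c1 z * a z + c1 z * 'D_v a z + 'D_v c2 z * b z + c2 z * 'D_v b z)).
Proof.
move=> Vz C1 C2 Cw.
have Dp := D v Cphi Vz; have Da := D v Ca1 Vz; have Db := D v Cb1 Vz.
have Dz := D v Czeta Vz; have Dw := D v Cw Vz; have D1 := D v C1 Vz; have D2 := D v C2 Vz.
have Daabb := is_deriveD_fun (is_deriveM_fun Da Da) (is_deriveM_fun Db Db).
have De := is_deriveD_fun Dp (is_deriveM_fun (Dcst (-1) z v) Dz).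
have H := is_deriveD_fun (is_deriveD_fun
  (is_deriveM_fun (Dcst (- (rho / 2)) z v) (is_deriveM_fun (is_deriveM_fun Dp Daabb) Dw))
  (is_deriveM_fun (Dcst (- (rho * g)) z v) (is_deriveM_fun (is_deriveM_fun Dp De) Dw)))
  (is_deriveM_fun (Dcst (2 * mu) z v) (is_deriveD_fun (is_deriveM_fun D1 Da) (is_deriveM_fun D2 Db))).
apply: (is_derive_eq H).
by field.
Qed.

(** The two sides differ by the viscous dissipation [2 mu phi |D(u)|^2], whose sign comes from
    [0 <= phi z]. *)
Lemma energy_dissipation (eta : (R * R) * R -> R) z : V z -> 0 < mu -> 0 <= phi z ->
  pd1 eta z = pd1 phi z - 'D_d1 (fun z : (R * R) * R => zeta z.1) z ->
  pd2 eta z = pd2 phi z - 'D_d2 (fun z : (R * R) * R => zeta z.1) z ->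
  pdt phi z + divg (fun y => phi y *: u y) z = 0 ->
  (rho * phi z) *: (pdt u z + advect u u z)
    - (2 * mu) *: tens_divg (fun y => (phi y *: (strain u y).1,
                                       phi y *: (strain u y).2)) z
    + (rho * g * phi z) *: grad eta z = 0 ->
  pdt edens z <= pd1 eflux1 z + pd2 eflux2 z.
Proof.
move=> Vz mu0 p0 eta1 eta2 mass mom.
have [_ du] := (Ck1P _ _).1 (CkW Cu).
have ua v : ('D_v u z).1 = 'D_v a z.
  exact: (esym (@derive_val _ _ _ _ _ _ _ (is_derive_fst (derivableP (du v z Vz).1)))).
have ub v : ('D_v u z).2 = 'D_v b z.
  exact: (esym (@derive_val _ _ _ _ _ _ _ (is_derive_snd (derivableP (du v z Vz).1)))).
have Dp v := D v Cphi Vz; have Da v := D v Ca1 Vz; have Db v := D v Cb1 Vz.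
pose P11 := 'D_d1 (fun y => phi y * S11 y) z; pose P12 := 'D_d2 (fun y => phi y * S12 y) z.
pose P21 := 'D_d1 (fun y => phi y * S21 y) z; pose P22 := 'D_d2 (fun y => phi y * S22 y) z.
have m1 : 'D_d1 (fun y => phi y * a y) z = phi z * 'D_d1 a z + a z * 'D_d1 phi z.
  exact: (@derive_val _ _ _ _ _ _ _ (is_deriveM_fun (Dp d1) (Da d1))).
have m2 : 'D_d2 (fun y => phi y * b y) z = phi z * 'D_d2 b z + b z * 'D_d2 phi z.
  exact: (@derive_val _ _ _ _ _ _ _ (is_deriveM_fun (Dp d2) (Db d2))).
have massE : pdt phi z = - (phi z * 'D_d1 a z + a z * 'D_d1 phi z + (phi z * 'D_d2 b z + b z * 'D_d2 phi z)).
  apply/eqP; rewrite -addr_eq0 -m1 -m2; apply/eqP; exact: mass.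
have mA : rho * phi z * ('D_dt a z + (a z * 'D_d1 a z + b z * 'D_d2 a z)) -
    2 * mu * (P11 + P12) +
    rho * g * phi z * ('D_d1 phi z - 'D_d1 (fun z : (R * R) * R => zeta z.1) z) = 0.
  rewrite -!ua; move: eta1; rewrite /pd1 => <-.
  exact: (congr1 fst mom).
have mB : rho * phi z * ('D_dt b z + (a z * 'D_d1 b z + b z * 'D_d2 b z)) -
    2 * mu * (P21 + P22) +
    rho * g * phi z * ('D_d2 phi z - 'D_d2 (fun z : (R * R) * R => zeta z.1) z) = 0.
  rewrite -!ub; move: eta2; rewrite /pd2 => <-.
  exact: (congr1 snd mom).
have F1 : pd1 eflux1 z = _ := @derive_val _ _ _ _ _ _ _
  (Dflux d1 Vz (Ck1M oV Cphi CS11) (Ck1M oV Cphi CS21) Ca1).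
have F2 : pd2 eflux2 z = _ := @derive_val _ _ _ _ _ _ _
  (Dflux d2 Vz (Ck1M oV Cphi CS12) (Ck1M oV Cphi CS22) Cb1).
rewrite F1 F2 pdt_edens//.
exact: (dissipation_algebra (zeta z.1) mu0 p0 massE mA mB).
Qed.

End energy_balance.

(** * Fluxes through parts of the boundary *)

Section normal_flux.
Context {R : realType}.
Local Notation mR := (measurableTypeR R).
Local Notation mu := (@lebesgue_measure R).
Variables (Omega : set (R * R)) (N : nat) (gam : 'I_N -> R -> R * R) (n : R * R -> R * R).
Hypothesis bO : piecewise_C1_boundary Omega gam n.

(* On an arc, [n ds = (gam'_2, - gam'_1) d s], and [n] does not occur in the
   second form, which is continuous up to the end points. *)
Definition normal_flux (G : set (R * R)) (A : R * R -> R * R) : R :=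
  \sum_(k < N) \int[mu]_(s in `]0, 1[ `&` gam k @^-1` G)
    cross (A (gam k s)) (derive1 (gam k) s).

Lemma dotp_normal a k s : s \in `]0, 1[ ->
  dotp a (n (gam k s)) * Num.sqrt (sqnorm (derive1 (gam k) s)) =
  cross a (derive1 (gam k) s).
Proof.
move=> s01; have [_ dg0 _ _ /(_ k s s01)[-> _]] := bO.
have [r0 _ _ _] := unit_normal (dg0 k s (subset_itv_oo_cc s01)).
by rewrite /dotp /cross/= /GRing.scale/=; field; rewrite gt_eqF.
Qed.

Lemma dotp_normal1 k s : s \in `]0, 1[ -> dotp (n (gam k s)) (n (gam k s)) = 1.
Proof.
move=> s01; have [_ dg0 _ _ /(_ k s s01)[-> _]] := bO.
by have [_ _ ->] := unit_normal (dg0 k s (subset_itv_oo_cc s01)).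
Qed.

Let dgam_gt0 k s : s \in `]0, 1[ -> 0 < Num.sqrt (sqnorm (derive1 (gam k) s)).
Proof.
move=> s01; have [_ dg0 _ _ _] := bO.
by have [] := unit_normal (dg0 k s (subset_itv_oo_cc s01)).
Qed.

Let cont (A : R * R -> R * R) := forall x, closure Omega x -> {for x, continuous A}.

Lemma normal_flux_continuous A k s : cont A -> s \in `[0, 1] ->
  {for s, continuous (fun s => cross (A (gam k s)) (derive1 (gam k) s))}.
Proof.
move=> cA s01.
have cAg := continuous_comp_at (gam_continuous (k := k) bO s01) (cA _ (closure_gam (k := k) bO s01)).
have cd := continuous_dgam (k := k) bO s01.
have c1 := continuousM_fun (continuous_fst_at cAg) (continuous_snd_at cd).
have c2 := continuousM_fun (@continuous_cst R R (-1) s)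
  (continuousM_fun (continuous_snd_at cAg) (continuous_fst_at cd)).
have -> : (fun s => cross (A (gam k s)) (derive1 (gam k) s)) =
  (fun s => (A (gam k s)).1 * (derive1 (gam k) s).2 +
    -1 * ((A (gam k s)).2 * (derive1 (gam k) s).1)).
  by apply/funext => z; rewrite /cross; ring.
exact: (continuousD_fun c1 c2).
Qed.

Lemma normal_flux_integrable (D : set R) A k : measurable (D : set mR) -> D `<=` `[0, 1] ->
  cont A -> mu.-integrable D (EFin \o (fun s => cross (A (gam k s)) (derive1 (gam k) s))).
Proof.
move=> mD D01 cA; apply: (integrableS (E := `[0, 1]%classic : set mR)) => //.
by apply: segment_integrable => s; exact: normal_flux_continuous.
Qed.

Let arc_sub k G : (`]0, 1[ `&` gam k @^-1` G : set R) `<=` `[0, 1].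
Proof. by move=> s [+ _]; exact: subset_itv_oo_cc. Qed.

Lemma normal_flux_linear G c A B : measurable (G : set (mR * mR)) -> cont A -> cont B ->
  normal_flux G (fun x => c *: A x + B x) = c * normal_flux G A + normal_flux G B.
Proof.
move=> mG cA cB; rewrite /normal_flux mulr_sumr -big_split/=; apply: eq_bigr => k _.
have mD := arc_set_measurable bO k mG.
have iA := normal_flux_integrable k mD (@arc_sub k G) cA.
have iB := normal_flux_integrable k mD (@arc_sub k G) cB.
have icA := integrableZl mD c iA.
have -> : c * \int[mu]_(s in `]0, 1[ `&` gam k @^-1` G) cross (A (gam k s)) (derive1 (gam k) s) =
   \int[mu]_(s in `]0, 1[ `&` gam k @^-1` G) (c * cross (A (gam k s)) (derive1 (gam k) s)).
  exact: (esym (RintegralZl c mD iA)).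
have := RintegralD mD icA iB; move=> <-.
by apply: eq_Rintegral => s _; rewrite /cross/= /GRing.scale/=; ring.
Qed.

Lemma normal_fluxZ G c A : measurable (G : set (mR * mR)) -> cont A ->
  normal_flux G (fun x => c *: A x) = c * normal_flux G A.
Proof.
(* Homogeneity from linearity: [c A = (c - 1) A + A]. *)
move=> mG cA; have := normal_flux_linear (c - 1) mG cA cA.
have -> : (fun x => (c - 1) *: A x + A x) = (fun x => c *: A x).
  by apply/funext => x; rewrite scalerBl scale1r subrK.
by move=> ->; ring.
Qed.

Lemma line_integral_normal_flux G A f : measurable (G : set (mR * mR)) -> cont A ->
  (forall k s, s \in `]0, 1[ -> G (gam k s) ->
    f (gam k s) = dotp (A (gam k s)) (n (gam k s))) ->
  line_integral gam G f = normal_flux G A.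
Proof.
move=> mG cA fA.
apply: (@line_integralE _ _ _ _ _ bO _ _
    (fun k s => cross (A (gam k s)) (derive1 (gam k) s))) => // k s s01.
  exact: normal_flux_continuous.
by move=> Gs; rewrite fA// dotp_normal.
Qed.

Lemma normal_flux_le0 G A : (forall k s, s \in `]0, 1[ -> G (gam k s) ->
    dotp (A (gam k s)) (n (gam k s)) <= 0) -> measurable (G : set (mR * mR)) -> cont A ->
  normal_flux G A <= 0.
Proof.
move=> A0 mG cA; apply: sumr_le0 => k _.
have mD := arc_set_measurable bO k mG.
have iA := normal_flux_integrable k mD (@arc_sub k G) cA.
have i0 : mu.-integrable (`]0, 1[ `&` gam k @^-1` G) (EFin \o (fun=> 0 : R)) := integrable0 mu _.
have e0 : \int[mu]_(s in `]0, 1[ `&` gam k @^-1` G) (0 : R) = 0.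
  by rewrite /Rintegral integral0.
rewrite -[leRHS]e0; apply: (le_Rintegral mD iA i0) => s [s01 Gs].
by rewrite -dotp_normal// mulr_le0_ge0 ?A0// ltW// dgam_gt0.
Qed.

(** Off [G] the integrand vanishes except on [Z] and at the end points, which are negligible in the
    parameter, so the two integrands agree almost everywhere. *)
Lemma normal_flux_support G Z A : measurable (G : set (mR * mR)) -> cont A ->
  null_length gam Z ->
  (forall k s, s \in `]0, 1[ -> ~ G (gam k s) -> ~ Z (gam k s) ->
    dotp (A (gam k s)) (n (gam k s)) = 0) ->
  \sum_(k < N) \int[mu]_(s in `[0, 1]) cross (A (gam k s)) (derive1 (gam k) s) =
  normal_flux G A.
Proof.
move=> mG cA nZ A0; apply: eq_bigr => k _; rewrite /Rintegral; congr fine.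
have mD := arc_set_measurable bO k mG.
have iA := normal_flux_integrable k mD (@arc_sub k G) cA.
have mo : measurable (`]0, 1[%classic : set mR) by [].
have io := normal_flux_integrable k mo (@subset_itv_oo_cc _ _ 0 1) cA.
pose f s := cross (A (gam k s)) (derive1 (gam k) s).
have /integrableP[/measurable_EFinP mfo _] := io.
have /integrableP[mfA _] := iA.
have mfc : measurable_fun (`]0, 1]%classic : set mR) (fun s => (f s)%:E).
  by apply/measurable_EFinP; exact: (measurable_fun_itv_oc mfo).
rewrite -(integral_itv_obnd_cbnd mfc).
have mfo' : measurable_fun (`]0, 1[%classic : set mR) (fun s => (f s)%:E).
  exact/measurable_EFinP.
rewrite -(integral_itv_bndo_bndc mfo').
(* The interval is repeated so that, after the integral is taken over []0, 1[], the restricting set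
   is still the measurable []0, 1[] part of the preimage. *)
have DE : `]0, 1[%classic `&` gam k @^-1` G =
    `]0, 1[%classic `&` (`]0, 1[%classic `&` gam k @^-1` G) by rewrite setIA setIid.
rewrite [in RHS]DE integral_mkcondr.
have [Q [mQ Q0 sQ]] := nZ k.
apply: ae_eq_integral => //.
  by apply/(measurable_restrict _ mD mo); rewrite -DE.
exists Q; split=> // s nE; apply: sQ.
have s01 : s \in `]0, 1[ by apply: contrapT => ns; apply: nE => /= s01; case: ns.
split; first exact: subset_itv_oo_cc.
apply: contrapT => Zs; apply: nE => _; rewrite patchE.
case: ifPn => // /negP Gs; rewrite /f -dotp_normal// A0 ?mul0r// => G'.
by apply: Gs; exact/mem_set.
Qed.

End normal_flux.

(** * Differentiation in time under the integral *)

Section time_derivative.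
Context {R : realType}.
Local Notation mu2 := (lebesgue2 R).
Local Notation dt := (((0, 0), 1) : (R * R) * R).
Variables (Omega : set (R * R)) (T : R).
Hypothesis oO : open Omega.
Hypothesis bdO : bounded_set Omega.
Variable V : set ((R * R) * R).
Hypothesis sV : closure Omega `*` `[0, T] `<=` V.

Lemma time_quotient {W : normedModType R} (f : (R * R) * R -> W) (x : R * R) (t : R) :
  (fun h : R => h^-1 *: ((fun s => f (x, s)) (h *: (1 : R) + t) - (fun s => f (x, s)) t)) =
  (fun h : R => h^-1 *: (f (h *: dt + (x, t)) - f (x, t))).
Proof.
apply/funext => h; congr (_ *: (f _ - _)).
apply: injective_projections => //=.
by apply: injective_projections; rewrite /= scaler0 add0r.
Qed.

(** The dominating function is a constant: [pdt e] is continuous on the compact set [closure Omega]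
    times [[0, T]], hence bounded, and [Omega] has finite measure. *)
Lemma derivable_under_omega (e : (R * R) * R -> R) t : Ck 1 V e -> t \in `]0, T[ ->
  derivable (fun s => \int[mu2]_(x in Omega) e (x, s)) t 1 /\
  derive1 (fun s => \int[mu2]_(x in Omega) e (x, s)) t = \int[mu2]_(x in Omega) pdt e (x, t).
Proof.
move=> /Ck1P[ce de] tT.
have oOm := omega_measurable oO.
have inV x s : closure Omega x -> s \in `[0, T] -> V (x, s) by move=> Ox sT; apply: sV.
have cK : compact (closure Omega `*` (`[0, T]%classic : set R)).
  by apply: compact_setX; [exact: closure_compact bdO|exact: segment_compact].
have cw : {within closure Omega `*` (`[0, T]%classic : set R), continuous (pdt e)}.
  by apply: continuous_in_subspaceT => z /set_mem/sV Vz; exact: (de dt z Vz).2.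
have /compact_bounded[M [_ HM]] := continuous_compact cw cK.
pose B := Num.max 0 (M + 1).
have HB x s : Omega x -> s \in `[0, T] -> `|pdt e (x, s)| <= B.
  move=> Ox sT; rewrite le_max; apply/orP; right.
  apply: (HM (M + 1)); first by rewrite ltrDl.
  by exists (x, s) => //; split=> //; exact: subset_closure.
have B0 (x : R * R) : 0 <= B by rewrite le_max lexx.
have iB : mu2.-integrable Omega (EFin \o (fun=> B)).
  by apply: (omega_integrable oO bdO) => x _; exact: continuous_cst.
have ie s : (`]0, T[%classic : set R) s -> mu2.-integrable Omega (EFin \o (fun x => e (x, s))).
  move=> sT; apply: (omega_integrable oO bdO) => x Ox.
  by apply: slice_continuous; apply: ce; apply: inV => //; exact: subset_itv_oo_cc sT.
have der s x : (`]0, T[%classic : set R) s -> Omega x -> derivable (fun s => e (x, s)) s 1.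
  move=> sT Ox; rewrite /derivable time_quotient.
  by apply: (de dt _ _).1; apply: inV; [exact: subset_closure|exact: subset_itv_oo_cc sT].
pose f (s : R) (x : measurableTypeR R * measurableTypeR R) := e (x, s).
have dE s x : partial1of2 f s x = pdt e (x, s).
  by rewrite partial1of2E /derive time_quotient.
have G_ub s x : (`]0, T[%classic : set R) s -> Omega x -> `|partial1of2 f s x| <= B.
  by move=> sT Ox; rewrite dE; apply: HB => //; exact: subset_itv_oo_cc sT.
split.
  exact: (@derivable_under_integral _ _ _ mu2 f Omega oOm t 0 T tT ie der (fun=> B) B0 iB G_ub).
rewrite (@differentiation_under_integral _ _ _ mu2 f Omega oOm t 0 T tT ie der (fun=> B) B0 iB G_ub).
by apply: eq_Rintegral => x _; exact: dE.
Qed.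

End time_derivative.

(** The inner product computed in the orthogonal frame formed by [v] and [v] turned by a right
    angle. *)
Lemma dotp_frame {R : realType} (m w v : R * R) :
  dotp m w * dotp v v = dotp m v * dotp w v + cross m v * cross w v.
Proof. by rewrite /dotp /cross; ring. Qed.

(** * The energy inequality for the shallow water system *)

Section shallow_water_energy.
Context {R : realType}.
Local Notation mR := (measurableTypeR R).
Local Notation mu2 := (lebesgue2 R).
Local Notation e1 := ((1, 0) : R * R).
Local Notation e2 := ((0, 1) : R * R).
Variables (rho mu g c0 T : R) (Omega : set (R * R)) (N : nat)
  (gam : 'I_N -> R -> R * R) (n : R * R -> R * R) (GD GS GT : set (R * R))
  (zeta : R * R -> R) (phi eta : (R * R) * R -> R) (u : (R * R) * R -> R * R).
Hypothesis oO : open Omega.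
Hypothesis bdO : bounded_set Omega.
Hypothesis bO : piecewise_C1_boundary Omega gam n.
Hypothesis parts : boundary_parts Omega gam GD GS GT.
Hypothesis T_gt0 : 0 < T.
Hypothesis eta_cont : {within closure Omega `*` `[0, T], continuous eta}.
Hypothesis equations : shallow_water rho mu g T Omega zeta phi eta u.
Hypothesis conditions : boundary_conditions c0 g T gam n GD GS GT zeta phi eta u.
Hypothesis phi_gt0 : forall x t, closure GT x -> t \in `[0, T] -> 0 < phi (x, t).
Variable V : set ((R * R) * R).
Hypothesis oV : open V.
Hypothesis sV : closure Omega `*` `[0, T] `<=` V.
Hypothesis Cphi : Ck 1 V phi.
Hypothesis Cu : Ck 2 V u.
Hypothesis Czeta : Ck 1 V (fun z : (R * R) * R => zeta z.1).

Let a z := (u z).1.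
Let b z := (u z).2.
Let Ca : Ck 1 V a. Proof. exact: (CkW (Ck_fst oV Cu)). Qed.
Let Cb : Ck 1 V b. Proof. exact: (CkW (Ck_snd oV Cu)). Qed.

Let inV x t : closure Omega x -> t \in `[0, T] -> V (x, t).
Proof. by move=> Ox tT; exact: sV. Qed.

(** The relation is given on [Omega] and []0, T[] only; continuity of [eta] on the closed cylinder
    extends it to the boundary and to the extreme times. *)
Lemma water_level x t : closure Omega x -> t \in `[0, T] ->
  eta (x, t) = phi (x, t) + -1 * zeta x.
Proof.
move=> Ox tT.
apply: (eq_on_closure (S := Omega `*` `]0, T[) _ eta_cont (g := fun z => phi z + -1 * zeta z.1)).
- by move=> [y s] [Oy sT]; split; [exact: subset_closure|exact: subset_itv_oo_cc sT].
- apply: continuous_in_subspaceT => z /set_mem/sV Vz.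
  exact: (Ck1D oV Cphi (Ck1M oV (@Ck1_cst R ((R * R) * R)%type V R (-1)) Czeta)).1.
- by move=> [y s] [Oy sT]; have [_ _ ->] := equations Oy sT; rewrite /=; ring.
- by [].
- by apply: closure_setX => //; exact: closure_itvoo.
Qed.

(** The condition is given for [t] in []0, T[] and extends by continuity in time. Here [phi > 0] up
    to the extreme times allows the final division. *)
Lemma transmission_velocity k s t : s \in `]0, 1[ -> GT (gam k s) -> t \in `[0, T] ->
  u (gam k s, t) = (wave_speed c0 g zeta (gam k s) *
    (eta (gam k s, t) / phi (gam k s, t))) *: n (gam k s).
Proof.
set x := gam k s => s01 Gx tT.
have Ox : closure Omega x by exact: (closure_gam bO (subset_itv_oo_cc s01)).
have Gcx : closure GT x by exact: subset_closure.
have cphi s' : s' \in `[0, T] -> {for s', continuous (fun t => phi (x, t))}.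
  by move=> s'T; apply: slice_time_continuous; exact: (Cphi.1 _ (inV Ox s'T)).
(* One coordinate [c] at a time, multiplied by [phi] and with [eta] replaced by [phi - zeta], so
   that both sides are visibly continuous on [[0, T]]. *)
have key (c : R * R -> R) (nc : R) : (forall s', s' \in `[0, T] -> {for s', continuous (fun t => c (u (x, t)))}) ->
   (forall (r : R) , c (r *: n x) = r * nc) ->
   phi (x, t) * c (u (x, t)) = wave_speed c0 g zeta x * nc * (phi (x, t) + -1 * zeta x).
  move=> cc cn.
  apply: (@eq_on_closure _ _ (`]0, T[%classic : set R) (`[0, T]%classic : set R)
    (fun t => phi (x, t) * c (u (x, t)))
    (fun t => wave_speed c0 g zeta x * nc * (phi (x, t) + -1 * zeta x)) t) => //.
  - exact: subset_itv_oo_cc.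
  - by apply: continuous_in_subspaceT => s' /set_mem s'T; exact: (continuousM_fun (cphi _ s'T) (cc _ s'T)).
  - apply: continuous_in_subspaceT => s' /set_mem s'T.
    exact: (continuousM_fun (@continuous_cst R R (wave_speed c0 g zeta x * nc) s')
      (continuousD_fun (cphi _ s'T) (@continuous_cst R R (-1 * zeta x) s'))).
  - move=> s' s'T; have s'T' := subset_itv_oo_cc s'T.
    have [_ _ /(_ Gx)] := conditions x s'T.
    have rx : regular_points gam x by exists k; exists s.
    move=> /(_ rx) ->; rewrite cn -(water_level Ox s'T').
    by field; rewrite gt_eqF// phi_gt0.
  - exact: closure_itvoo.
have p0 : phi (x, t) != 0 by rewrite gt_eqF// phi_gt0.
have etaE := water_level Ox tT.
have solve (v nc : R) : phi (x, t) * v = wave_speed c0 g zeta x * nc * (phi (x, t) + -1 * zeta x) ->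
    v = wave_speed c0 g zeta x * (eta (x, t) / phi (x, t)) * nc.
  rewrite -etaE => E; apply: (mulfI p0); rewrite E; move: (phi _) (eta _) (wave_speed _ _ _ _) p0.
  by move=> p e w p0; field.
have ca s' : s' \in `[0, T] -> {for s', continuous (fun t => (u (x, t)).1)}.
  by move=> s'T; apply: (slice_time_continuous (f := a)); exact: (Ca.1 _ (inV Ox s'T)).
have cb s' : s' \in `[0, T] -> {for s', continuous (fun t => (u (x, t)).2)}.
  by move=> s'T; apply: (slice_time_continuous (f := b)); exact: (Cb.1 _ (inV Ox s'T)).
apply: injective_projections.
  exact: (solve _ _ (key fst (n x).1 ca (fun=> erefl))).
exact: (solve _ _ (key snd (n x).2 cb (fun=> erefl))).
Qed.

(** Together with the next two, the fields whose normal components are the integrands of [I1], [I2]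
    and [I3], without the physical constants. *)
Definition kinetic_flux t (x : R * R) : R * R :=
  let z := (x, t) in
  (phi z * (a z * a z + b z * b z) * a z, phi z * (a z * a z + b z * b z) * b z).

Definition potential_flux t (x : R * R) : R * R :=
  let z := (x, t) in
  (phi z * (phi z + -1 * zeta x) * a z, phi z * (phi z + -1 * zeta x) * b z).

(** The transpose of [D(u)] is applied to [u], so that the inner product with [n] is [(D(u) n) . u]
    without using symmetry. *)
Definition viscous_flux t (x : R * R) : R * R :=
  let z := (x, t) in
  (phi z * (strain u z).1.1 * a z + phi z * (strain u z).2.1 * b z,
   phi z * (strain u z).1.2 * a z + phi z * (strain u z).2.2 * b z).

Let cont (A : R * R -> R * R) := forall x, closure Omega x -> {for x, continuous A}.

Let cont_slice (f1 f2 : (R * R) * R -> R) t : Ck 1 V f1 -> Ck 1 V f2 -> t \in `[0, T] ->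
  cont (fun x => (f1 (x, t), f2 (x, t))).
Proof.
move=> C1 C2 tT x Ox; apply: continuous_pair.
  by apply: slice_continuous; exact: (C1.1 _ (inV Ox tT)).
by apply: slice_continuous; exact: (C2.1 _ (inV Ox tT)).
Qed.

Let kinetic_cont t : t \in `[0, T] -> cont (kinetic_flux t).
Proof. exact: (cont_slice (Ck1_kinetic_flux oV Cphi Cu Ca) (Ck1_kinetic_flux oV Cphi Cu Cb)). Qed.

Let potential_cont t : t \in `[0, T] -> cont (potential_flux t).
Proof.
exact: (cont_slice (Ck1_potential_flux oV Cphi Czeta Ca) (Ck1_potential_flux oV Cphi Czeta Cb)).
Qed.

Let viscous_cont t : t \in `[0, T] -> cont (viscous_flux t).
Proof. exact: (cont_slice (Ck1_viscous_flux1 oV Cphi Cu) (Ck1_viscous_flux2 oV Cphi Cu)). Qed.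

Definition inertial_flux t (x : R * R) : R * R :=
  - (rho / 2) *: kinetic_flux t x + - (rho * g) *: potential_flux t x.

Let inertial_cont t : t \in `[0, T] -> cont (inertial_flux t).
Proof.
move=> tT x Ox; have ck := kinetic_cont tT Ox; have cp := potential_cont tT Ox.
have c1 := continuousD_fun
  (continuousM_fun (@continuous_cst (R * R)%type R (- (rho / 2)) x) (continuous_fst_at ck))
  (continuousM_fun (@continuous_cst (R * R)%type R (- (rho * g)) x) (continuous_fst_at cp)).
have c2 := continuousD_fun
  (continuousM_fun (@continuous_cst (R * R)%type R (- (rho / 2)) x) (continuous_snd_at ck))
  (continuousM_fun (@continuous_cst (R * R)%type R (- (rho * g)) x) (continuous_snd_at cp)).
exact: (continuous_pair c1 c2).
Qed.

Let mGT : measurable (GT : set (mR * mR)).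
Proof. by have [_ _ _ [_ _ ?] _] := parts. Qed.

Let nfl := @normal_flux R N gam.

Lemma I12E t : t \in `[0, T] ->
  I1 rho phi u gam n GT t + I2 rho g phi eta u gam n GT t = nfl GT (inertial_flux t).
Proof.
move=> tT; rewrite /I1 /I2.
rewrite (line_integral_normal_flux bO mGT (kinetic_cont tT)); last first.
  move=> k s _ _; rewrite /kinetic_flux /sqnorm /dotp /a /b.
  by move: (u _) (n _) (phi _) => w m p /=; ring.
rewrite (line_integral_normal_flux bO mGT (potential_cont tT)); last first.
  move=> k s s01 _; have Ox := closure_gam (k := k) bO (subset_itv_oo_cc s01).
  rewrite (water_level Ox tT) /potential_flux /dotp /a /b.
  by move: (u _) (n _) (phi _) (zeta _) => w m p z /=; ring.
have E := normal_fluxZ bO (- (rho * g)) mGT (potential_cont tT).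
rewrite -E; apply: (esym (normal_flux_linear bO (- (rho / 2)) mGT (kinetic_cont tT) _)) => x Ox.
have cp := potential_cont tT Ox.
exact: (continuous_pair
  (continuousM_fun (@continuous_cst (R * R)%type R (- (rho * g)) x) (continuous_fst_at cp))
  (continuousM_fun (@continuous_cst (R * R)%type R (- (rho * g)) x) (continuous_snd_at cp))).
Qed.

Lemma I3E t : t \in `[0, T] ->
  I3 mu phi u gam n GT t = 2 * mu * nfl GT (viscous_flux t).
Proof.
move=> tT; rewrite /I3 (line_integral_normal_flux bO mGT (viscous_cont tT))//.
move=> k s _ _; rewrite /viscous_flux /tens_app /dotp /a /b.
by move: (strain _ _) (u _) (n _) (phi _) => D w m p /=; ring.
Qed.

Lemma I12_le0 alpha t : 0 < rho -> 0 < g -> 0 < c0 -> 0 < alpha < 1 ->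
  (forall x, closure Omega x -> 0 < zeta x) ->
  (forall x t, closure GT x -> t \in `[0, T] -> - alpha * zeta x <= eta (x, t)) ->
  c0 <= Num.sqrt (2 / alpha) * (1 - alpha) -> t \in `[0, T] ->
  I1 rho phi u gam n GT t + I2 rho g phi eta u gam n GT t <= 0.
Proof.
move=> rho0 g0 c00 a01 z0 eta_ge c0_le tT; rewrite I12E//.
apply: (normal_flux_le0 bO _ mGT (inertial_cont tT)) => k s s01 Gs.
set x := gam k s.
have Ox : closure Omega x by exact: (closure_gam bO (subset_itv_oo_cc s01)).
have Gcx : closure GT x by exact: subset_closure.
have uE := transmission_velocity s01 Gs tT; rewrite -/x in uE.
pose w := wave_speed c0 g zeta x * (eta (x, t) / phi (x, t)); rewrite -/w in uE.
have nn := dotp_normal1 bO k s01; rewrite -/x in nn.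
have aE : a (x, t) = w * (n x).1 by rewrite /a uE.
have bE : b (x, t) = w * (n x).2 by rewrite /b uE.
have etaE := water_level Ox tT.
(* With [u = w n] and [|n| = 1] the normal component depends on the scalar [w] alone, as
   [transmission_sign] requires. *)
have -> : dotp (inertial_flux t x) (n x) =
    - (rho / 2) * (phi (x, t) * (w * w) * w) + - (rho * g) * (phi (x, t) * eta (x, t) * w).
  transitivity (- (rho / 2) * (phi (x, t) * (w * w * dotp (n x) (n x)) * (w * dotp (n x) (n x))) +
     - (rho * g) * (phi (x, t) * (phi (x, t) + -1 * zeta x) * (w * dotp (n x) (n x)))).
    rewrite /inertial_flux /kinetic_flux /potential_flux aE bE /dotp.
    by move: (phi _) (n _) (zeta _) => p m z; rewrite /= /GRing.scale/=; ring.
  by rewrite nn !mulr1 -etaE.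
apply: (transmission_sign (zeta := zeta x) rho0 g0 c00 a01 c0_le) => //.
- exact: z0.
- exact: phi_gt0.
- by rewrite etaE; ring.
- exact: eta_ge.
Qed.

Lemma energyE t : t \in `]0, T[ ->
  energy rho g phi eta u Omega t = \int[mu2]_(x in Omega) edens rho g phi u zeta (x, t).
Proof.
move=> tT; have tT' := subset_itv_oo_cc tT.
have i (f : (R * R) * R -> R) : Ck 1 V f -> mu2.-integrable Omega (EFin \o (fun x => f (x, t))).
  move=> Cf; apply: (omega_integrable oO bdO) => x Ox.
  by apply: slice_continuous; exact: (Cf.1 _ (inV Ox tT')).
have i1 := i _ (Ck1_kinetic rho oV Cphi Cu).
have i2 := i _ (Ck1_potential rho g oV Cphi Czeta).
have oOm := omega_measurable oO.
have E := RintegralD oOm i1 i2.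
apply: (etrans _ (esym E)); congr (_ + _); apply: eq_Rintegral => x /set_mem Ox.
  by rewrite /sqnorm /dotp; move: (u _) (phi _) => w p; ring.
have [_ _ phiE] := equations Ox tT.
rewrite real_normK ?num_real// (_ : eta (x, t) = phi (x, t) + -1 * zeta x); first by field.
by rewrite phiE; ring.
Qed.

Lemma flux_through_boundary t : t \in `]0, T[ ->
  \sum_(k < N) \int[@lebesgue_measure R]_(s in `[0, 1])
    cross (eflux1 rho mu g phi u zeta (gam k s, t), eflux2 rho mu g phi u zeta (gam k s, t))
      (derive1 (gam k) s) =
  I1 rho phi u gam n GT t + I2 rho g phi eta u gam n GT t + I3 mu phi u gam n GT t.
Proof.
move=> tT; have tT' := subset_itv_oo_cc tT.
rewrite (I12E tT') (I3E tT') addrC.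
apply: etrans (normal_flux_linear bO (2 * mu) mGT (viscous_cont tT') (inertial_cont tT')).
pose F x := (2 * mu) *: viscous_flux t x + inertial_flux t x.
have FE x : (eflux1 rho mu g phi u zeta (x, t), eflux2 rho mu g phi u zeta (x, t)) = F x.
  rewrite /F /inertial_flux /viscous_flux /kinetic_flux /potential_flux /eflux1 /eflux2 /a /b.
  move: (strain _ _) (u _) (phi _) => D w p.
  by apply: injective_projections; rewrite /= /GRing.scale/=; ring.
under eq_bigr => k _ do under eq_Rintegral => s _ do rewrite FE.
have [[_ _ _] _ _ _ nZ] := parts.
have cF : cont F.
  move=> x Ox.
  have -> : F = (fun x => (eflux1 rho mu g phi u zeta (x, t), eflux2 rho mu g phi u zeta (x, t))).
    by apply/funext => y; rewrite FE.
  exact: (cont_slice (Ck1_eflux1 rho mu g oV Cphi Cu Czeta) (Ck1_eflux2 rho mu g oV Cphi Cu Czeta) tT' Ox).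
apply: (normal_flux_support bO mGT cF nZ) => k s s01 nT nU.
set x := gam k s in nT nU *.
have bx : boundary Omega x by exact: (boundary_gam bO k (subset_itv_oo_cc s01)).
have rx : regular_points gam x by exists k; exists s.
have [cD cS _] := conditions x tT.
have [Dx|nD] := pselect (GD x).
  have uE := cD Dx.
  rewrite /F /inertial_flux /viscous_flux /kinetic_flux /potential_flux /a /b uE /dotp.
  by move: (strain _ _) (phi _) (n _) => D' p m; rewrite /= /GRing.scale/=; ring.
have Sx : GS x by apply: contrapT => nS; apply: nU; split=> // -[[]|].
have [cr un] := cS Sx rx.
have nn := dotp_normal1 bO k s01; rewrite -/x in nn.
move: cr un; rewrite /tens_app; set D := strain _ _ => cr un.
pose m : R * R := (dotp D.1 (n x), dotp D.2 (n x)).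
(* In the frame of [n], the first product in [dotp_frame] dies with [u . n] and the second with the
   cross product of [D(u) n] and [n]. *)
have mu0 : dotp m (u (x, t)) = 0.
  have := dotp_frame m (u (x, t)) (n x).
  by rewrite nn un cr mulr1 mulr0 mul0r addr0.
transitivity (2 * mu * phi (x, t) * dotp m (u (x, t)) +
   (- (rho / 2) * (phi (x, t) * sqnorm (u (x, t))) +
    - (rho * g) * (phi (x, t) * (phi (x, t) + -1 * zeta x))) * dotp (u (x, t)) (n x)).
  rewrite /F /inertial_flux /viscous_flux /kinetic_flux /potential_flux -/D /sqnorm /m /dotp /a /b.
  by move: (u _) (phi _) (n _) => w p m'; rewrite /= /GRing.scale/=; ring.
by rewrite mu0 un !mulr0 addr0.
Qed.

Lemma energy_rate t : 0 < mu -> (forall x t, Omega x -> t \in `]0, T[ -> 0 <= phi (x, t)) ->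
  t \in `]0, T[ ->
  derivable (energy rho g phi eta u Omega) t 1 /\
  derive1 (energy rho g phi eta u Omega) t <=
    I1 rho phi u gam n GT t + I2 rho g phi eta u gam n GT t + I3 mu phi u gam n GT t.
Proof.
move=> mu0 p0 tT; have tT' := subset_itv_oo_cc tT.
have Ce := Ck1_edens rho g oV Cphi Cu Czeta.
have [d1 d2] := derivable_under_omega oO bdO sV Ce tT.
have oI : open (`]0, T[%classic : set R) by exact: interval_open.
(* [energyE] identifies the two functions on []0, T[] only; this interval is open, so derivability
   and derivative at [t] carry over. *)
have [dE DE] := @derive_comp_near R R R (energy rho g phi eta u Omega) _ `]0, T[%classic 1 t oI tT
  (fun s sT => energyE sT).
split; first exact/dE.
rewrite derive1E DE -derive1E d2 -flux_through_boundary//.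
pose F1 x := eflux1 rho mu g phi u zeta (x, t).
pose F2 x := eflux2 rho mu g phi u zeta (x, t).
have C1 := Ck1_eflux1 rho mu g oV Cphi Cu Czeta.
have C2 := Ck1_eflux2 rho mu g oV Cphi Cu Czeta.
have sU : closure Omega `<=` [set x | V (x, t)] by move=> x Ox; exact: inV.
have := divergence_theorem oO bdO bO (@open_slice _ _ t oV) sU (@Ck1_slice _ _ _ t C1) (@Ck1_slice _ _ _ t C2).
rewrite /cross/= => <-.
have oOm := omega_measurable oO.
have Dc v (f : (R * R) * R -> R) : Ck 1 V f -> forall x, closure Omega x ->
    {for x, continuous (fun x => 'D_v f (x, t))}.
  by move=> /Ck1P[_ df] x Ox; apply: (slice_continuous (f := 'D_v f)); exact: (df v _ (inV Ox tT')).2.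
apply: (le_Rintegral oOm).
- by apply: (omega_integrable oO bdO); exact: Dc.
- apply: (omega_integrable oO bdO) => x Ox.
  have -> : (fun x => 'D_e1 F1 x + 'D_e2 F2 x) =
      (fun x => 'D_((e1, 0) : (R * R) * R) (eflux1 rho mu g phi u zeta) (x, t) +
                'D_((e2, 0) : (R * R) * R) (eflux2 rho mu g phi u zeta) (x, t)).
    by apply/funext => y; rewrite !slice_derive.
  exact: (continuousD_fun (Dc _ _ C1 _ Ox) (Dc _ _ C2 _ Ox)).
move=> x Ox; rewrite !slice_derive.
have Vz : V (x, t) by apply: inV => //; exact: subset_closure.
have [mass mom _] := equations Ox tT.
have oQ : open (Omega `*` (`]0, T[%classic : set R)).
  have -> : Omega `*` (`]0, T[%classic : set R) = (fst @^-1` Omega) `&` (snd @^-1` `]0, T[%classic) by [].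
  apply: openI.
    by apply: (@open_comp _ _ fst) => // z _; exact: continuous_fst.
  by apply: (@open_comp _ _ snd) => // z _; exact: continuous_snd.
(* Near [(x, t)] the function [eta] coincides with [phi - zeta], and this is how its gradient in the
   momentum equation is computed. *)
have etaD v : 'D_v eta (x, t) = 'D_v phi (x, t) - 'D_v (fun z : (R * R) * R => zeta z.1) (x, t).
  have wl z : (Omega `*` (`]0, T[%classic : set R)) z -> eta z = phi z + -1 * zeta z.1.
    by case: z => y s [Oy sT]; exact: (water_level (subset_closure Oy) (subset_itv_oo_cc sT)).
  have [_ ->] := @derive_comp_near R _ _ eta (fun z => phi z + -1 * zeta z.1) _ v (x, t) oQ
    (conj Ox tT) wl.
  have /Ck1P[_ dp] := Cphi; have /Ck1P[_ dz] := Czeta.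
  have H := is_deriveD_fun (derivableP (dp v _ Vz).1)
    (is_deriveM_fun (is_derive_cst (-1 : R) (x, t) v) (derivableP (dz v _ Vz).1)).
  by rewrite (@derive_val _ _ _ _ _ _ _ H) mulr0 addr0 mulN1r.
exact: (energy_dissipation oV Cphi Cu Czeta Vz mu0 (p0 _ _ Ox tT) (etaD _) (etaD _) mass mom).
Qed.

End shallow_water_energy.
Theorem theorem3p4 (R : realType) (rho mu g c0 T : R)
    (Omega : set (R * R)) (N : nat) (gam : 'I_N -> R -> R * R)
    (n : R * R -> R * R) (GD GS GT : set (R * R))
    (zeta : R * R -> R) (phi eta : (R * R) * R -> R)
    (u : (R * R) * R -> R * R) (alpha : R)
    (rho_gt0 : 0 < rho) (mu_gt0 : 0 < mu) (g_gt0 : 0 < g) (c0_gt0 : 0 < c0)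
    (T_gt0 : 0 < T)
    (Omega_domain : domain Omega) (Omega_bounded : bounded_set Omega)
    (Omega_boundary : piecewise_C1_boundary Omega gam n)
    (Gamma_parts : boundary_parts Omega gam GD GS GT)
    (zeta_C1 : Ck_on 1 (closure Omega) zeta)
    (zeta_gt0 : forall x, closure Omega x -> 0 < zeta x)
    (phi_smooth : smooth_on (closure Omega `*` `[0, T]) phi)
    (u_smooth : smooth_on (closure Omega `*` `[0, T]) u)
    (eta_cont : {within closure Omega `*` `[0, T], continuous eta})
    (equations : shallow_water rho mu g T Omega zeta phi eta u)
    (conditions : boundary_conditions c0 g T gam n GD GS GT zeta phi eta u)
    (phi_gt0 : forall x t, closure GT x -> t \in `[0, T] -> 0 < phi (x, t))
    (alpha_01 : 0 < alpha < 1)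
    (eta_ge : forall x t, closure GT x -> t \in `[0, T] ->
      - alpha * zeta x <= eta (x, t))
    (c0_le : 0 < c0 <= Num.sqrt (2 / alpha) * (1 - alpha)) :
  (forall t, t \in `[0, T] ->
     I1 rho phi u gam n GT t + I2 rho g phi eta u gam n GT t <= 0) /\
  ((forall x t, Omega x -> t \in `]0, T[ -> 0 <= phi (x, t)) ->
   forall t, t \in `]0, T[ ->
     derivable (energy rho g phi eta u Omega) t 1 /\
     derive1 (energy rho g phi eta u Omega) t <= I3 mu phi u gam n GT t).
Proof.
have [oO _ _] := Omega_domain.
have [U1 [oU1 sU1 C1]] := phi_smooth.
have [U2 [oU2 sU2 C2]] := u_smooth.
have [U3 [oU3 sU3 C3]] := zeta_C1.
(* One open neighbourhood of the closed cylinder for all three functions. Two derivatives of [u] are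
   used there: one in the strain and one more in its divergence. *)
pose V := U1 `&` U2 `&` [set z | U3 z.1].
have oV : open V.
  apply: openI; first exact: openI.
  by apply: (@open_comp _ _ fst U3) => // z _; exact: continuous_fst.
have sV : closure Omega `*` `[0, T] `<=` V.
  by move=> z Kz; split; [split; [exact: sU1|exact: sU2]|exact: (sU3 _ Kz.1)].
have Cphi : Ck 1 V phi by apply: Ck_subset (C1 1%N) => z [[]].
have Cu : Ck 2 V u by apply: Ck_subset (C2 2%N) => z [[]].
have Czeta : Ck 1 V (fun z : (R * R) * R => zeta z.1).
  by apply: Ck_subset (Ck1_lift C3) => z [].
have /andP[_ c0_le'] := c0_le.
have I12 t : t \in `[0, T] -> I1 rho phi u gam n GT t + I2 rho g phi eta u gam n GT t <= 0.
  exact: (I12_le0 Omega_boundary Gamma_parts T_gt0 eta_cont equations conditions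
    phi_gt0 oV sV Cphi Cu Czeta rho_gt0 g_gt0 c0_gt0 alpha_01 zeta_gt0 eta_ge c0_le').
(* [phi_ge0] provides the sign of the viscous dissipation in the interior; the rate is then at most
   [I1 + I2 + I3], and [I12] discards the first two terms. *)
split=> [//|phi_ge0 t tT].
have [dE DE] := energy_rate oO Omega_bounded Omega_boundary Gamma_parts T_gt0 eta_cont equations
  conditions oV sV Cphi Cu Czeta mu_gt0 phi_ge0 tT.
split=> //; apply: (le_trans DE); rewrite gerDr.
by apply: I12; exact: subset_itv_oo_cc tT.
Qed.
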